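(* For every $p\in(1,\infty)$ there exist constants $c(p)>0$ and $C(p)<\infty$, depending only on $p$, such that the following holds. For every $M>2$ and every (arbitrarily small) $\delta>0$ there exists an $A_p$ weight $w$ on $\mathbb{R}$ with $M\le [w]_{A_p}\le C(p)M$, such that the doubling constants of the weights $w$ and $\sigma=w^{-1/(p-1)}$ are bounded by $2+\delta$, and $$\|H\|_{L^p(w)}\ge c(p)\,M^{s},\qquad s=\max\{1,\,1/(p-1)\}.$$
   Context: A weight on $\mathbb{R}$ is a locally integrable function that is positive a.e. The norm in $L^p(w)$ is $\|f\|_{L^p(w)}^p=\int_{\mathbb{R}}|f(x)|^pw(x)\,dx$. For $1<p<\infty$ the Muckenhoupt characteristic is $$[w]_{A_p}=\sup_I\Big(\frac1{|I|}\int_I w(x)\,dx\Big)\Big(\frac1{|I|}\int_I w(x)^{-1/(p-1)}\,dx\Big)^{p-1},$$ the supremum being over all (bounded) intervals $I\subset\mathbb{R}$; $w$ is an $A_p$ weight if $[w]_{A_p}<\infty$. The doubling constant of a weight $w$ is $D_w=\sup_I w(2I)/w(I)$, where the supremum is over all intervals $I$ in $\mathbb{R}$, $2I$ is the interval with the same center as $I$ and length $2|I|$, and $w(I)=\int_I w\,dx$. $H$ is the Hilbert transform, $Hf(x)=\mathrm{p.v.}\int_{\mathbb{R}}\frac{f(y)}{x-y}\,dy$, and $\|H\|_{L^p(w)}$ denotes its operator norm on $L^p(w)$. *)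

(* Defs.v *)
From mathcomp Require Export all_boot all_order all_algebra.
From mathcomp Require Export all_classical all_reals all_analysis.

Set Implicit Arguments.
Unset Strict Implicit.
Unset Printing Implicit Defensive.

Import Order.TTheory GRing.Theory Num.Theory numFieldNormedType.Exports.

Local Open Scope classical_set_scope.
Local Open Scope ring_scope.

Definition is_weight (R : realType) (w : R -> R) : Prop :=
  locally_integrable setT w /\ {ae (@lebesgue_measure R), forall x, 0 < w x}.

(* The mass w(I) of the interval I = [a, b], possibly +oo. *)
Definition weight_mass (R : realType) (w : R -> R) (a b : R) : \bar R :=
  (\int[@lebesgue_measure R]_(x in `[a, b]) (w x)%:E)%E.

Definition average (R : realType) (w : R -> R) (a b : R) : \bar R :=
  (((b - a)^-1)%:E * weight_mass w a b)%E.

Definition dual_weight (R : realType) (p : R) (w : R -> R) : R -> R :=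
  fun x => w x `^ (- (p - 1)^-1).

(* Endpoints do not affect the integrals, so the supremum over all bounded
   nondegenerate intervals is taken over the closed ones.  The averages are
   extended reals: the characteristic is +oo if the dual weight is not
   integrable on some interval. *)
Definition Ap_char (R : realType) (p : R) (w : R -> R) : \bar R :=
  ereal_sup [set t : \bar R | exists a b : R, a < b /\
    t = (average w a b * poweR (average (dual_weight p w) a b) (p - 1))%E].

Definition is_Ap_weight (R : realType) (p : R) (w : R -> R) : Prop :=
  is_weight w /\ (Ap_char p w < +oo)%E.

(* I = [z - r, z + r] and 2I = [z - 2r, z + 2r]. *)
Definition doubling_const (R : realType) (w : R -> R) : \bar R :=
  ereal_sup [set t : \bar R | exists z r : R, 0 < r /\
    t = (weight_mass w (z - 2 * r) (z + 2 * r) /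
         weight_mass w (z - r) (z + r))%E].

Definition weighted_norm (R : realType) (p : R) (w f : R -> R) : \bar R :=
  poweR (\int[@lebesgue_measure R]_x (`|f x| `^ p * w x)%:E)%E p^-1.

(* The integral over |x - y| > eps converges absolutely for every f in L^p(w)
   and every A_p weight w, so no truncation at infinity is needed.  [lim]
   returns the default value 0 at the points, forming a null set for such f,
   where the principal value does not exist. *)
Definition hilbert_transform (R : realType) (f : R -> R) : R -> R := fun x =>
  lim ((fun eps : R =>
    Rintegral (@lebesgue_measure R) [set y : R | eps < `|x - y|]
      (fun y => f y / (x - y))) @ 0^'+).

Definition hilbert_opnorm (R : realType) (p : R) (w : R -> R) : \bar R :=
  ereal_sup [set t : \bar R | exists f : R -> R,
    [/\ measurable_fun setT f, (weighted_norm p w f <= 1)%E &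
        t = weighted_norm p w (hilbert_transform f)]].

(* Main.v *)
(** The weight is the terminal value [om] of a positive martingale started at
    about 1/2 and indexed by a tree of nested intervals.  At each step [om] moves
    up or down by a small fraction of its running maximum [G], and it is frozen
    once its drawdown reaches the floor [eps G], [eps = 1 / (4 T)].  Each
    coordinate of the tree varies slowly, so neighbouring intervals have
    comparable averages: this gives the doubling constants close to 2.  As [om]
    never falls below [eps G], while [om ^ -tau] averages to at least
    [eps ^ -tau / 4], the [A_p] characteristic has order [T] for the weight [om]
    with [tau = 1 / (p - 1)], used when [p >= 2], and order [T ^ tau] for the
    weight [om ^ -tau] with [tau = p - 1], used when [p < 2].

    A second martingale [g] is driven by the pattern [qpat], orthogonal to the
    pattern [rpat] of [om].  The Hilbert transform pairs a fast oscillation of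
    [rpat] positively with one of [qpat] on the same interval, and it pairs
    oscillations of [rpat] with themselves to zero by antisymmetry.  Choosing the
    oscillations of each generation much finer than those before makes the other
    interactions negligible, so [int (H om) g] grows to order [T].  The drift of
    [g] along [rpat], which drops out of the pairing, is opposed to the sign of
    [g] and confines it: [int om cosh g] stays bounded, hence so does every
    moment of [g] weighted by [om].  Duality between [L^p(w)] and
    [L^q(w^(1-q))] then bounds the operator norm from below by a multiple of
    [T]. *)

Require Import Defs.
From mathcomp Require Import ring lra zify.
Import Order.TTheory GRing.Theory Num.Theory numFieldNormedType.Exports.
Local Open Scope ring_scope.
Set Implicit Arguments.
Unset Strict Implicit.
Unset Printing Implicit Defensive.

(** One stopping event has to be likely for one measure and rare for another. In diffusive time
    ([chL ^ 2] moves per unit) the plain walk, started halfway to the floor, meets it before a new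
    maximum with probability 1/2; a fixed share of Lebesgue measure thus ends at the floor, and this
    makes [om ^ -tau] large in mean. Under the measure weighted by [om] the floor is met at a rate
    of order at most [eps] per unit of time, so after [T = 1 / (4 eps)] units most of that mass is
    still moving. Each unit adds a constant to the pairing, hence its order [T]. In that time a free
    [g] would acquire variance of order [T], and its norm would eat up part of the gain. Weighting
    by [om] favours upward moves, so a drift of [g] tied to those moves and opposed to the sign of
    [g] acts as a restoring force. Near the floor [om] is far below its maximum [G], while the error
    terms have size [G]: the potentials [Dfun], [Yfun] and [Xfun] trade these errors for multiples
    of [om]. *)

(** * The averaging operator of an eight-branch tree *)

Section Averaging.
Variables (R : realType) (S : Type) (step : S -> nat -> S).
Implicit Types (phi psi : S -> R) (z : S).

Definition avg8 phi z : R := 8^-1 * \sum_(c < 8) phi (step z c).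

Variable ok : S -> bool.
Hypothesis ok_step : forall z c, ok z -> ok (step z c).

Lemma avg8_le phi psi : (forall z, ok z -> phi z <= psi z) ->
  forall z, ok z -> avg8 phi z <= avg8 psi z.
Proof.
move=> h z oz; rewrite /avg8 ler_pM2l ?invr_gt0 ?ltr0n//.
by apply: ler_sum => i _; apply: h; exact: ok_step.
Qed.

Lemma iter_avg8_le k phi psi : (forall z, ok z -> phi z <= psi z) ->
  forall z, ok z -> iter k avg8 phi z <= iter k avg8 psi z.
Proof. by move=> h; elim: k => //= k IH; apply: avg8_le. Qed.

Lemma avg8_lin (c d : R) phi psi z :
  avg8 (fun z => c * phi z + d * psi z) z = c * avg8 phi z + d * avg8 psi z.
Proof.
rewrite /avg8 big_split/= -!mulr_sumr; ring.
Qed.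

Lemma iter_avg8_lin k (c d : R) phi psi z :
  iter k avg8 (fun z => c * phi z + d * psi z) z =
  c * iter k avg8 phi z + d * iter k avg8 psi z.
Proof.
elim: k z => //= k IH z; rewrite -avg8_lin.
by congr (avg8 _ z); apply/funext => w; exact: IH.
Qed.

Lemma iter_avg8_fix k phi : (forall z, avg8 phi z = phi z) ->
  forall z, iter k avg8 phi z = phi z.
Proof.
move=> h; elim: k => //= k IH z; rewrite -[RHS]h.
by congr (avg8 _ z); apply/funext => w; exact: IH.
Qed.

(** As [om] is invariant under averaging, the source [c om] contributes the same amount at each of
    the [k] steps. *)
Lemma iter_avg8_drift (om : S -> R) (c : R) phi :
  (forall z, avg8 om z = om z) ->
  (forall z, ok z -> avg8 phi z <= phi z + c * om z) ->
  forall k z, ok z -> iter k avg8 phi z <= phi z + k%:R * c * om z.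
Proof.
move=> hom h; elim=> [|k IH] z oz; first by rewrite !mul0r addr0.
rewrite iterSr; apply: (le_trans (iter_avg8_le k h oz)).
have -> : (fun z => phi z + c * om z) = (fun z => 1 * phi z + c * om z).
  by apply/funext => w; rewrite mul1r.
rewrite iter_avg8_lin (iter_avg8_fix _ hom) mul1r -natr1.
have := IH z oz; lra.
Qed.

(** The damped sources form a geometric series with sum [c / q], so the bound does not depend on the
    number of steps. *)
Lemma iter_avg8_contract (om : S -> R) (c q : R) phi : 0 < q <= 1 ->
  (forall z, ok z -> 0 <= phi z) ->
  (forall z, avg8 om z = om z) ->
  (forall z, ok z -> avg8 phi z <= (1 - q) * phi z + c * om z) ->
  forall k z, ok z -> 0 <= c * om z -> iter k avg8 phi z <= phi z + c / q * om z.
Proof.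
move=> /andP[q0 q1] phi0 hom h; elim=> [|k IH] z oz c0.
  by rewrite lerDl mulrAC divr_ge0 ?(ltW q0)//.
rewrite iterSr; apply: (le_trans (iter_avg8_le k h oz)).
rewrite iter_avg8_lin (iter_avg8_fix _ hom).
have := IH z oz c0; have := phi0 z oz.
have -> : c / q * om z = (c * om z) / q by ring.
move: (iter _ _ _ _) (phi z) (c * om z) c0 => A B C C0 B0 AB.
have h1 : (1 - q) * A <= (1 - q) * (B + C / q) by apply: ler_wpM2l => //; lra.
apply: (le_trans (lerD h1 (lexx C))).
have -> : (1 - q) * (B + C / q) + C = B + C / q - q * B.
  by field; lra.
by rewrite gerBl mulr_ge0// ltW.
Qed.

End Averaging.

(** * The Markov chain of the weight and of its partner *)

Section Chain.
Variable R : realType.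

Definition rpat (c : nat) : R :=
  match c with 2 | 3 => 1 | 4 | 5 => -1 | _ => 0 end.
Definition qpat (c : nat) : R :=
  match c with 2 | 5 => -1 | 3 | 4 => 1 | _ => 0 end.

(* [cn] counts the new maxima of the martingale, [cj] is its relative drawdown
   below the running maximum in units of [1 / L]. *)
Record cstate := CState { cn : nat; cj : nat; cg : R }.

Variables (T l : nat).
Definition chL : nat := (2 * l)%N.
Definition cheps : R := (4 * T%:R)^-1.
Definition chy : R := chL%:R^-1.
Definition cha : R := (1 - cheps) * chy.
Definition chgam : R := 1 + cha.
Definition chb : R := chy / 4.
Definition sgnp (g : R) : R := if 0 <= g then 1 else -1.

Definition jump (z : cstate) (r : R) (g : R) : cstate :=
  if 0 < r then
    if cj z is j.+1 then CState (cn z) j g else CState (cn z).+1 0 g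
  else CState (cn z) (cj z).+1 g.

(* Moves 0 and 7 are trivial: the first and last children of a cell repeat its
   state, so states vary slowly across the boundaries of coarser cells. *)
Definition cstep (z : cstate) (c : nat) : cstate :=
  if (cj z < chL)%N && (2 <= c <= 5)%N then
    jump z (rpat c) (cg z + chb * qpat c - chb * sgnp (cg z) * rpat c)
  else z.

(** The running maximum is [chgam ^+ cn]. With [chgam = 1 + cha] a new maximum has the same
    increment [cha * chgam ^+ cn] as every other move, which makes [om] a martingale. At drawdown
    [chL] it equals [cheps] times the maximum. *)
Definition om (z : cstate) : R := chgam ^+ cn z * (1 - cha * (cj z)%:R).
Definition z0 : cstate := CState 0 l 0.
Definition alive (z : cstate) : R := (cj z < chL)%N%:R.

Local Notation P := (@avg8 R cstate cstep).

Lemma avg8_dead phi z : (chL <= cj z)%N -> P phi z = phi z.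
Proof.
move=> h; rewrite /avg8 (eq_bigr (fun=> phi z)); last first.
  by move=> i _; rewrite /cstep ltnNge h.
rewrite sumr_const card_ord -[phi z *+ 8]mulr_natl mulrA mulVf ?mul1r//.
Qed.

Definition zup z g := jump z 1 g.
Definition zdn z g := jump z (-1) g.

Lemma avg8_alive phi z : (cj z < chL)%N -> P phi z = phi z / 2 +
  (phi (zup z (cg z - chb - chb * sgnp (cg z))) +
   phi (zup z (cg z + chb - chb * sgnp (cg z))) +
   phi (zdn z (cg z + chb + chb * sgnp (cg z))) +
   phi (zdn z (cg z - chb + chb * sgnp (cg z)))) / 8.
Proof.
move=> h; rewrite /avg8 !big_ord_recl big_ord0 /cstep h /= /bump /= /zup /zdn.
rewrite !(mulr1, mulrN1, opprK); by field.
Qed.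

End Chain.

Section ChainEstimates.
Variables (R : realType) (T l : nat).
Hypotheses (T12 : (12 <= T)%N) (l6 : (6 <= l)%N).
Local Notation P := (@avg8 R (cstate R) (cstep l)).
Local Notation L := (chL l).
Local Notation eps := (cheps R T).
Local Notation y := (chy R l).
Local Notation a := (cha R T l).
Local Notation gam := (chgam R T l).
Local Notation b := (chb R l).
Local Notation om := (@om R T l).
Local Notation z0 := (z0 R l).
Local Notation alive := (@alive R l).
Implicit Types z : cstate R.

Lemma chy_gt0 : 0 < y.
Proof. clear T12 T. by rewrite invr_gt0 ltr0n /chL; lia. Qed.

Lemma chy_le : y <= 1 / 12.
Proof. clear T12 T.
by rewrite div1r lef_pV2 ?posrE ?ltr0n ?ler_nat /chL; lia.
Qed.

Lemma cheps_gt0 : 0 < eps.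
Proof. clear l6 l. by rewrite invr_gt0 mulr_gt0 ?ltr0n//; lia. Qed.

Lemma cheps_le : eps <= 1 / 48.
Proof.
have h : 12 <= T%:R :> R by rewrite (ler_nat _ 12).
by rewrite div1r lef_pV2 ?posrE; lra.
Qed.

Lemma cheps_T : eps * T%:R = 1 / 4.
Proof.
have h : 12 <= T%:R :> R by rewrite (ler_nat _ 12).
by rewrite /cheps; field; lra.
Qed.

Lemma cha_bounds : [/\ 0 < a, 47 / 48 * y <= a & a <= y].
Proof.
have := chy_gt0; have := chy_le; have := cheps_gt0; have := cheps_le.
by rewrite /cha; move: eps y => e x *; split; nra.
Qed.

Lemma chgam_ge1 : 1 <= gam. Proof. by have [] := cha_bounds; rewrite /chgam; lra. Qed.

Lemma gamX_gt0 n : 0 < gam ^+ n.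
Proof. by rewrite exprn_gt0//; have := chgam_ge1; lra. Qed.

Lemma natL_y (j : nat) : (j <= L)%N -> 0 <= j%:R * y <= 1.
Proof. clear T12 T.
move=> h; have y0 := chy_gt0; rewrite mulr_ge0 ?(ltW y0)//=.
by rewrite ler_pdivrMr ?mul1r ?ler_nat// -invr_gt0.
Qed.

Lemma alive_y z : (cj z < L)%N -> (cj z)%:R * y + y <= 1.
Proof. clear T12 T.
by move=> h; have /andP[_] := natL_y h; rewrite -natr1 mulrDl mul1r.
Qed.

Lemma dead_y : L%:R * y = 1.
Proof. clear T12 T. by rewrite mulfV// pnatr_eq0 /chL; lia. Qed.

Lemma omE z : om z = gam ^+ cn z * (1 - (1 - eps) * ((cj z)%:R * y)).
Proof. by rewrite /om /cha; ring. Qed.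

Definition okst z : bool := (cj z <= L)%N.

Lemma om_zup z g : om (zup z g) = om z + a * gam ^+ cn z.
Proof.
rewrite /om /zup /jump ltr01; case: z => n [|j] h /=; rewrite ?exprS /chgam.
  by ring.
by rewrite -natr1; ring.
Qed.

Lemma om_zdn z g : om (zdn z g) = om z - a * gam ^+ cn z.
Proof.
rewrite /om /zdn /jump ltr0N1 /=; case: z => n j h /=.
by rewrite -natr1; ring.
Qed.

Lemma avg8_om z : P om z = om z.
Proof.
case: (ltnP (cj z) L) => h; last by rewrite avg8_dead.
by rewrite avg8_alive// !om_zup !om_zdn; field.
Qed.

Lemma om_gt0 z : okst z -> 0 < om z.
Proof.
move=> /natL_y/andP[h1 h2]; rewrite omE mulr_gt0 ?gamX_gt0//.
have := cheps_gt0; have := cheps_le; move: eps (_ * y) h1 h2 => e x; nra.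
Qed.

Lemma om_ge z : okst z -> eps * gam ^+ cn z <= om z.
Proof.
move=> /natL_y/andP[h1 h2]; rewrite omE mulrC ler_pM2l ?gamX_gt0//.
have := cheps_gt0; have := cheps_le; move: eps (_ * y) h1 h2 => e x; nra.
Qed.

Lemma om_gamX z : om z <= gam ^+ cn z.
Proof.
have /andP[e0 e1] : 0 <= 1 - eps <= 1.
  by have := cheps_gt0; have := cheps_le; lra.
rewrite omE ger_pMr ?gamX_gt0// gerBl mulr_ge0// mulr_ge0//.
exact: ltW chy_gt0.
Qed.

Lemma okst_step z c : okst z -> okst (cstep l z c).
Proof.
rewrite /okst /cstep; case: ifP => // /andP[h _] _; rewrite /jump.
by case: ifP => //= _; case: (cj z) h => //= j /ltnW/ltnW.
Qed.

Lemma okst_z0 : okst z0. Proof. clear T12 T. by rewrite /okst /= /chL; lia. Qed.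

Lemma om_z0 : om z0 = (1 + eps) / 2.
Proof.
rewrite omE expr0 mul1r /= /chy /chL natrM; field.
by rewrite pnatr_eq0; lia.
Qed.

(** The cubic with [h 0 = h 1 = 1], [h' 0 = -1] and [h'' x = 4 - 6 x]. The value at 1 makes [Dfun]
    equal to [om] at the floor, the slope at 0 offsets the gain [a <= y] of a new maximum, and the
    second derivative gives a drift that [om] dominates, because [1 - 3 x / 2 <= 1 - x]. *)
Definition hprof (x : R) : R := 1 - x + 2 * x ^+ 2 - x ^+ 3.
Definition Dfun z : R := eps * gam ^+ cn z * hprof ((cj z)%:R * y).

Lemma hprof_bounds x : 0 <= x <= 1 -> 0 <= hprof x <= 1.
Proof.
move=> /andP[x0 x1]; have h1 : 0 <= x ^+ 2 * (2 - x).
  by rewrite mulr_ge0 ?sqr_ge0//; lra.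
have h2 : 0 <= x * (1 - x) ^+ 2 by rewrite mulr_ge0 ?sqr_ge0.
by rewrite /hprof; apply/andP; split; lra.
Qed.

Lemma hprof_lip x d : 0 <= x - d -> 0 <= d -> x + d <= 1 ->
  - (2 * d) <= hprof (x + d) - hprof (x - d) <= 2 * d.
Proof.
move=> h1 h2 h3.
have -> : hprof (x + d) - hprof (x - d) =
  d * (- (2 * (1 - x) * (1 - 3 * x) + 2 * d ^+ 2)).
  by rewrite /hprof; ring.
have q1 : 0 <= d ^+ 2 by exact: sqr_ge0.
set A := (X in d * (- X)).
have [A1 A2] : - 2 <= A /\ A <= 2 by rewrite /A; split; nra.
by apply/andP; split; nra.
Qed.

Lemma Dfun_ge0 z : okst z -> 0 <= Dfun z.
Proof.
move=> /natL_y/hprof_bounds/andP[h _]; rewrite /Dfun mulr_ge0//.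
by rewrite mulr_ge0 ?(ltW (gamX_gt0 _))// ltW// cheps_gt0.
Qed.

Lemma Dfun_zup_le z g : okst z ->
  Dfun (zup z g) <= eps * gam ^+ cn z * (1 + y).
Proof.
have [a0 _ ay] := cha_bounds; have y0 := chy_gt0.
move=> hz; rewrite /Dfun /zup /jump ltr01; case: z hz => n [|j] h /=; rewrite /okst /= => hz.
  rewrite mul0r /hprof expr0n/= expr0n/= exprS.
  have -> : eps * (gam * gam ^+ n) * (1 - 0 + 2 * 0 - 0) = eps * gam ^+ n * gam by ring.
  by rewrite ler_pM2l ?mulr_gt0 ?gamX_gt0 ?cheps_gt0// /chgam; lra.
have /natL_y/hprof_bounds/andP[_ hh] : (j <= L)%N by lia.
by rewrite ler_pM2l ?mulr_gt0 ?gamX_gt0 ?cheps_gt0//; lra.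
Qed.

Lemma Dfun_zup_ge0 z g : okst z -> 0 <= Dfun (zup z g).
Proof.
move=> hz; apply: Dfun_ge0; rewrite /okst /zup /jump ltr01.
by move: hz; rewrite /okst; case: (cj z) => //= j /ltnW.
Qed.

Lemma Dfun_zdn_bounds z g : (cj z < L)%N ->
  0 <= Dfun (zdn z g) <= eps * gam ^+ cn z.
Proof.
move=> hz; have /natL_y/hprof_bounds/andP[h1 h2] : ((cj z).+1 <= L)%N by [].
have p0 : 0 < eps * gam ^+ cn z by rewrite mulr_gt0 ?gamX_gt0 ?cheps_gt0.
rewrite /Dfun /zdn /jump ltr0N1 /= mulr_ge0 ?(ltW p0)//=.
by rewrite ger_pMr.
Qed.

Lemma Dfun_diff z g g' : (cj z < L)%N ->
  `|Dfun (zdn z g') - Dfun (zup z g)| <= 2 * y * (eps * gam ^+ cn z).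
Proof.
move=> hz; have h1 := alive_y hz; have y0 := chy_gt0; have y1 := chy_le.
have p0 : 0 < eps * gam ^+ cn z by rewrite mulr_gt0 ?gamX_gt0 ?cheps_gt0.
have [a0 _ ay] := cha_bounds.
rewrite /Dfun /zdn /zup /jump ltr0N1 ltr01 /=.
case: z hz h1 p0 => n [|j] h /= hz h1 p0.
  rewrite mul1r mul0r exprS.
  have -> : eps * gam ^+ n * hprof y - eps * (gam * gam ^+ n) * hprof 0 =
    eps * gam ^+ n * (hprof y - hprof 0 * gam) by ring.
  rewrite normrM (gtr0_norm p0) mulrC ler_pM2r// ler_norml /hprof /chgam.
  move: a y {h1} a0 ay y0 y1 => A x *.
  by rewrite expr0n/= expr0n/=; apply/andP; split; nra.
rewrite -[j.+1%:R]natr1 in h1; rewrite -[j.+2%:R]natr1 -[j.+1%:R]natr1.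
rewrite -mulrBr normrM (gtr0_norm p0) mulrC ler_pM2r// ler_norml.
have -> : (j%:R + 1 + 1) * y = (j%:R * y + y) + y by ring.
have {2 4}-> : j%:R * y = (j%:R * y + y) - y by ring.
by apply: hprof_lip; rewrite ?addrK ?mulr_ge0 ?(ltW y0)//; lra.
Qed.

(** For a cubic the second difference is exactly [h'' x y^2 = (4 - 6 x) y^2]; the relation is a
    proper inequality only at drawdown 0. *)
Lemma avg8_Dfun_alive z : (cj z < L)%N ->
  forall g g', Dfun (zup z g) + Dfun (zdn z g') - 2 * Dfun z <=
   4 * (eps * gam ^+ cn z * y ^+ 2 * (1 - 3 / 2 * ((cj z)%:R * y))).
Proof.
move=> hz g g'; have h1 := alive_y hz; have y0 := chy_gt0; have y1 := chy_le.
have p0 : 0 < eps * gam ^+ cn z by rewrite mulr_gt0 ?gamX_gt0 ?cheps_gt0.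
have [a0 _ ay] := cha_bounds.
rewrite /Dfun /zdn /zup /jump ltr0N1 ltr01 /=.
case: z hz h1 p0 => n [|j] h /= hz h1 p0.
  rewrite mul1r mul0r exprS /hprof /chgam.
  have -> : eps * ((1 + a) * (1 + a) ^+ n) * (1 - 0 + 2 * 0 ^+ 2 - 0 ^+ 3) +
    eps * (1 + a) ^+ n * (1 - y + 2 * y ^+ 2 - y ^+ 3) -
    2 * (eps * (1 + a) ^+ n * (1 - 0 + 2 * 0 ^+ 2 - 0 ^+ 3)) =
    eps * (1 + a) ^+ n * (a - y + 2 * y ^+ 2 - y ^+ 3) by ring.
  rewrite -/gam -mulrA mulrA mulr0 subr0 mulr1 [4 * _]mulrC -[leRHS]mulrA.
  by rewrite ler_pM2l//; move: a y ay y0 y1 => A x *; nra.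
rewrite -[j.+2%:R]natr1 -[j.+1%:R]natr1 /hprof.
by rewrite le_eqVlt; apply/orP; left; apply/eqP; field.
Qed.
End ChainEstimates.

(** * The mass that keeps moving and the growth of the pairing *)

Section ChainGrowth.
Variables (R : realType) (T l : nat).
Hypotheses (T12 : (12 <= T)%N) (l6 : (6 <= l)%N).
Local Notation P := (@avg8 R (cstate R) (cstep l)).
Local Notation L := (chL l).
Local Notation eps := (cheps R T).
Local Notation y := (chy R l).
Local Notation a := (cha R T l).
Local Notation gam := (chgam R T l).
Local Notation b := (chb R l).
Local Notation om := (@om R T l).
Local Notation z0 := (z0 R l).
Local Notation alive := (@alive R l).
Local Notation okst := (@okst R l).
Local Notation Dfun := (@Dfun R T l).
Implicit Types z : cstate R.

(** Time is counted diffusively: [L ^ 2] moves make one unit, and the chain runs for [T] units. *)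
Definition chN : nat := (T * L ^ 2)%N.

Lemma chN_y : chN%:R * y ^+ 2 = T%:R.
Proof.
rewrite /chN /chy natrM natrX exprVn mulfK//.
by rewrite expf_neq0// pnatr_eq0 /chL; lia.
Qed.

Lemma avg8_Dfun z : okst z -> P Dfun z <= Dfun z + eps * y ^+ 2 * om z.
Proof.
move=> oz; have e0 := cheps_gt0 R T12; have y0 := chy_gt0 R l6.
case: (ltnP (cj z) L) => h; last first.
  rewrite avg8_dead// lerDl mulr_ge0// ?(ltW (om_gt0 T12 l6 oz))//.
  by rewrite mulr_ge0 ?sqr_ge0// ltW.
rewrite avg8_alive//.
set g1 := cg z - _ - _; set g2 := cg z + _ - _; set g3 := cg z + _ + _; set g4 := cg z - _ + _.
have := avg8_Dfun_alive T12 l6 h g1 g3; have := avg8_Dfun_alive T12 l6 h g2 g4.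
have : eps * gam ^+ cn z * y ^+ 2 * (1 - 3 / 2 * ((cj z)%:R * y)) <= eps * y ^+ 2 * om z.
  have -> : eps * y ^+ 2 * om z =
     eps * gam ^+ cn z * y ^+ 2 * (1 - (1 - eps) * ((cj z)%:R * y)).
    by rewrite omE; ring.
  rewrite ler_pM2l; last by rewrite !mulr_gt0 ?gamX_gt0// exprn_gt0.
  have /andP[x0 x1] := natL_y R l6 oz; have := cheps_le R T12.
  by move: (_ * y) x0 x1 => x *; nra.
lra.
Qed.

Definition ombar z := alive z * om z.

Lemma ombar_ge k : (k <= chN)%N -> 1 / 3 <= iter k P ombar z0.
Proof.
move=> kN; have e0 := cheps_gt0 R T12; have y0 := chy_gt0 R l6.
have oz0 := okst_z0 R l6; have ost := @okst_step R l.
have h : iter k P om z0 <= 1 * iter k P ombar z0 + 1 * iter k P Dfun z0.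
  rewrite -iter_avg8_lin; apply: (iter_avg8_le ost) => // z oz.
  rewrite !mul1r /ombar /alive; case: (ltnP (cj z) L) => hz.
    by rewrite mul1r lerDl Dfun_ge0.
  have -> : om z = Dfun z; last by rewrite mul0r add0r.
  have hz' : cj z = L by apply/eqP; rewrite eqn_leq; apply/andP.
  by rewrite omE /Dfun hz' (dead_y R l6) /hprof; ring.
have /(_ k z0 oz0) := iter_avg8_drift ost (@avg8_om R T l) avg8_Dfun.
have D0 : Dfun z0 <= eps.
  have /andP[_ hh] : 0 <= hprof ((cj z0)%:R * y) <= 1.
    by apply: hprof_bounds; apply: natL_y => //; exact: (okst_z0 R l6).
  by rewrite /Dfun /= expr0 mulr1 ger_pMr.
have : k%:R * (eps * y ^+ 2) * om z0 <= 1 / 4 * om z0.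
  apply: ler_wpM2r; first exact/ltW/om_gt0.
  rewrite -(cheps_T R T12) mulrCA; apply: ler_wpM2l; first exact: ltW.
  by rewrite -chN_y ler_wpM2r ?sqr_ge0// ler_nat.
move: h; rewrite (iter_avg8_fix _ (@avg8_om R T l)) om_z0//.
have := cheps_le R T12; lra.
Qed.

(** Amplitudes of a move: [om] changes by [alph r], and [g] by [delt q + bet r]. They become the
    coefficients [al], [de] and [be] of [Bf_refine]. *)
Definition alph z := alive z * (a * gam ^+ cn z).
Definition delt z := alive z * b.
Definition bet z := alive z * (- b * sgnp (cg z)).

Lemma om_step z c : om (cstep l z c) = om z + alph z * rpat R c.
Proof.
rewrite /alph /cstep /alive; case: (ltnP (cj z) L) => h /=; last by rewrite !mul0r addr0.
rewrite mul1r.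
by move: c => [|[|[|[|[|[|c]]]]]] /=; rewrite ?mulr0 ?addr0 ?mulr1 ?mulrN1 ?(om_zup _ _ z) ?(om_zdn _ _ z).
Qed.

Lemma cg_step z c :
  cg (cstep l z c) = cg z + delt z * qpat R c + bet z * rpat R c.
Proof.
rewrite /delt /bet /cstep /alive; case: (ltnP (cj z) L) => h /=; last by rewrite !mul0r !addr0.
rewrite !mul1r /jump.
by move: c => [|[|[|[|[|[|c]]]]]] /=; rewrite ?mulr0 ?addr0//;
  case: ifP => _; case: (cj z) => [|j] /=; ring.
Qed.

Lemma alph_delt_ge0 z : 0 <= alph z * delt z.
Proof.
have [a0 _ _] := cha_bounds R T12 l6.
rewrite /alph /delt /alive; case: (_ < _)%N; rewrite ?mul0r// !mul1r.
have y0 := chy_gt0 R l6.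
have b0 : 0 <= b by rewrite /chb divr_ge0 ?ltW.
by rewrite mulr_ge0// mulr_ge0 ?(ltW a0)// (ltW (gamX_gt0 R T12 l6 _)).
Qed.

(** At a moving state [alph delt] is at least [a b om], with [a b] of order [y^2]. One unit of time
    therefore adds a constant, because a third of the mass of [om] is still moving. *)
Lemma sum_alph_delt :
  T%:R / 15 <= \sum_(k < chN) iter k P (fun z => alph z * delt z) z0.
Proof.
have y0 := chy_gt0 R l6; have [a0 a1 _] := cha_bounds R T12 l6.
have ost := @okst_step R l.
have h k : (k <= chN)%N -> y ^+ 2 / 15 <= iter k P (fun z => alph z * delt z) z0.
  move=> /ombar_ge hk.
  have h1 : iter k P (fun z => (a * b) * ombar z + 0 * ombar z) z0 <=
      iter k P (fun z => alph z * delt z) z0.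
    apply: (iter_avg8_le ost); last exact: okst_z0.
    move=> z oz; rewrite mul0r addr0 /alph /delt /ombar /alive.
    case: (_ < _)%N; rewrite ?mul0r ?mulr0// !mul1r.
    rewrite [leRHS]mulrAC ler_pM2l ?om_gamX//.
    by rewrite mulr_gt0// /chb divr_gt0.
  apply: le_trans h1; rewrite iter_avg8_lin mul0r addr0 /chb.
  have h2 : 1 / 5 * y ^+ 2 <= a * (y / 4) by nra.
  have h3 : 0 <= y ^+ 2 by exact: sqr_ge0.
  by move: (y ^+ 2) (a * _) (iter _ _ _ _) h2 h3 hk => A B C *; nra.
rewrite -chN_y -mulrA -[chN in leLHS]card_ord mulr_natl -sumr_const.
by apply: ler_sum => i _; apply: h; exact: ltnW.
Qed.

End ChainGrowth.

(** * Confinement of [g] under the measure weighted by [om] *)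

Section ChainLyapunov.
Variables (R : realType) (T l : nat).
Hypotheses (T12 : (12 <= T)%N) (l6 : (6 <= l)%N).
Local Notation P := (@avg8 R (cstate R) (cstep l)).
Local Notation L := (chL l).
Local Notation eps := (cheps R T).
Local Notation y := (chy R l).
Local Notation a := (cha R T l).
Local Notation gam := (chgam R T l).
Local Notation b := (chb R l).
Local Notation om := (@om R T l).
Local Notation z0 := (z0 R l).
Local Notation alive := (@alive R l).
Local Notation okst := (@okst R l).
Local Notation Dfun := (@Dfun R T l).
Local Notation chN := (chN T l).
Implicit Types z : cstate R.

Definition cosh2 (g : R) : R := expR g + expR (- g).
Definition sinh2 (g : R) : R := `|expR g - expR (- g)|.

Lemma cosh2_ge2 g : 2 <= cosh2 g.
Proof.
rewrite /cosh2; have e1 : expR g * expR (- g) = 1 by rewrite expRxMexpNx_1.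
have h1 := expR_gt0 g; have h2 := expR_gt0 (- g).
have : 0 <= (expR g - expR (- g)) ^+ 2 by exact: sqr_ge0.
move: (expR g) (expR (- g)) e1 h1 h2 => p m *; nra.
Qed.

Lemma sinh2_le g : sinh2 g <= cosh2 g.
Proof.
have h1 := expR_gt0 g; have h2 := expR_gt0 (- g).
by rewrite /sinh2 /cosh2 ler_norml; apply/andP; split; lra.
Qed.

Lemma sinh2_ge g : cosh2 g - 2 <= sinh2 g.
Proof.
have e1 : expR g * expR (- g) = 1 by rewrite expRxMexpNx_1.
have h1 := expR_gt0 g; have h2 := expR_gt0 (- g).
rewrite /sinh2 /cosh2; move: (expR g) (expR (- g)) e1 h1 h2 => p m e1 h1 h2.
have [pm|pm] := leP m p; first by rewrite ger0_norm; nra.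
by rewrite ler0_norm; nra.
Qed.

Definition cu : R := cosh2 (2 * b) - 2.
Definition cv : R := expR (2 * b) - expR (- (2 * b)).

Lemma cu_bounds : 0 <= cu <= 13 / 25 * y ^+ 2.
Proof.
have y0 := chy_gt0 R l6; have y1 := chy_le R l6.
have := cosh2_ge2 (2 * b); rewrite /cu /cosh2.
have := expR_ge1Dx (2 * b); have := expR_ge1Dx (- (2 * b)).
have := expRxMexpNx_1 (2 * b).
have -> : 2 * b = y / 2 by rewrite /chb; field.
move: (expR (y / 2)) (expR (- (y / 2))) => p m.
move: y y0 y1 => x x0 x1 pm hm hp h2.
apply/andP; split; first by lra.
have m1 : m * (1 + x / 2) <= 1 by nra.
have p1 : p * (1 - x / 2) <= 1 by nra.
have h3 : (p + m) * (1 - x ^+ 2 / 4) <= 2 by nra.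
have h4 : 2 <= (2 + 13 / 25 * x ^+ 2) * (1 - x ^+ 2 / 4).
  have : 0 <= x ^+ 2 by exact: sqr_ge0.
  have : x ^+ 2 <= 1 / 144 by nra.
  by move: (x ^+ 2) => q *; nra.
have h5 : 0 < 1 - x ^+ 2 / 4 by nra.
have := le_trans h3 h4; rewrite ler_pM2r//; lra.
Qed.

Lemma cv_bounds : 97 / 100 * y <= cv <= 11 / 10 * y.
Proof.
have y0 := chy_gt0 R l6; have y1 := chy_le R l6; rewrite /cv.
have := expR_ge1Dx (2 * b); have := expR_ge1Dx (- (2 * b)).
have := expRxMexpNx_1 (2 * b).
have -> : 2 * b = y / 2 by rewrite /chb; field.
move: (expR (y / 2)) (expR (- (y / 2))) => p m.
move: y y0 y1 => x x0 x1 pm hm hp.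
have m1 : m * (1 + x / 2) <= 1 by nra.
have p1 : p * (1 - x / 2) <= 1 by nra.
have h5 : 0 < 1 - x / 2 by lra.
have h6 : 0 < 1 + x / 2 by lra.
apply/andP; split.
  suff : m <= 1 + x / 2 - 97 / 100 * x by lra.
  rewrite -(ler_pM2r h6); apply: (le_trans m1); nra.
suff : p <= 1 - x / 2 + 11 / 10 * x by lra.
by rewrite -(ler_pM2r h5); apply: (le_trans p1); nra.
Qed.

(** The term [b q] either cancels the drift [b sgnp g r] or doubles it. Each direction thus yields
    one unmoved copy of [g] and one moved by [2 b], towards 0 when [om] rises and away from 0 when
    it falls. *)
Lemma cosh2_shift g : cosh2 (g - b - b * sgnp g) + cosh2 (g + b - b * sgnp g) =
    2 * cosh2 g + (cosh2 g * cu - sinh2 g * cv) / 2 /\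
  cosh2 (g + b + b * sgnp g) + cosh2 (g - b + b * sgnp g) =
    2 * cosh2 g + (cosh2 g * cu + sinh2 g * cv) / 2.
Proof.
have e t s : cosh2 (t + s) = expR t * expR s + expR (- t) * expR (- s).
  by rewrite /cosh2 opprD !expRD.
have h : 0 <= g -> 0 <= expR g - expR (- g).
  by move=> g0; rewrite subr_ge0 ler_expR; lra.
have h' : g < 0 -> expR g - expR (- g) <= 0.
  by move=> g0; rewrite subr_le0 ler_expR; lra.
rewrite /sgnp; case: ifP => [g0|/negbT]; last rewrite -ltNge => g0.
  have -> : g - b - b * 1 = g + - (2 * b) by ring.
  have -> : g + b - b * 1 = g by ring.
  have -> : g + b + b * 1 = g + 2 * b by ring.
  have -> : g - b + b * 1 = g by ring.
  by rewrite /sinh2 (ger0_norm (h g0)) /cu /cv !e !opprK /cosh2; split; field.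
have -> : g - b - b * (-1) = g by ring.
have -> : g + b - b * (-1) = g + 2 * b by ring.
have -> : g + b + b * (-1) = g by ring.
have -> : g - b + b * (-1) = g + - (2 * b) by ring.
by rewrite /sinh2 (ler0_norm (h' g0)) /cu /cv !e !opprK /cosh2; split; field.
Qed.

Lemma avg8_cosh2 (A : cstate R -> R) (Au Ad : R) z : (cj z < L)%N ->
  (forall g, A (zup z g) = Au) -> (forall g, A (zdn z g) = Ad) ->
  P (fun z => A z * cosh2 (cg z)) z = A z * cosh2 (cg z) +
   (2 * cosh2 (cg z) * (Au + Ad - 2 * A z) + (Au + Ad) * (cosh2 (cg z) * cu) / 2
    + (Ad - Au) * (sinh2 (cg z) * cv) / 2) / 8.
Proof.
move=> hz hu hd; rewrite avg8_alive// !hu !hd.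
have cgu g : cg (zup z g) = g by rewrite /zup /jump; case: ifP => // _; case: (cj z).
have cgd g : cg (zdn z g) = g by rewrite /zdn /jump; case: ifP => // _; case: (cj z).
rewrite !cgu !cgd; have [h1 h2] := cosh2_shift (cg z).
transitivity (A z * cosh2 (cg z) / 2 +
   (Au * (cosh2 (cg z - b - b * sgnp (cg z)) + cosh2 (cg z + b - b * sgnp (cg z))) +
    Ad * (cosh2 (cg z + b + b * sgnp (cg z)) + cosh2 (cg z - b + b * sgnp (cg z)))) / 8).
  by field.
by rewrite h1 h2; field.
Qed.

Definition omV z : R := om z * cosh2 (cg z).

(** Upward moves carry more of the weight [om] and push [g] towards 0. The resulting term
    [a G sinh2 cv] beats the spreading term [om cosh2 cu], up to a constant that accounts for small
    [g], where [sinh2] is only known to exceed [cosh2 - 2]. *)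
Lemma avg8_omV z : (cj z < L)%N ->
  P omV z <= omV z - gam ^+ cn z * y ^+ 2 * cosh2 (cg z) / 20
             + gam ^+ cn z * y ^+ 2 / 4.
Proof.
move=> hz; rewrite (@avg8_cosh2 om _ _ z hz (om_zup T l z) (om_zdn T l z)) -/(omV z).
have y0 := chy_gt0 R l6; have y1 := chy_le R l6.
have [a0 a1 ay] := cha_bounds R T12 l6.
have /andP[u0 u1] := cu_bounds; have /andP[v0 v1] := cv_bounds.
have G0 := gamX_gt0 R T12 l6 (cn z).
have omG := om_gamX T12 l6 z; have om0 : 0 <= om z.
  by apply/ltW/om_gt0 => //; exact: ltnW.
have V2 := cosh2_ge2 (cg z); have W0 := sinh2_ge (cg z).
move: (om z) (gam ^+ _) (cosh2 _) (sinh2 _) omG om0 G0 V2 W0 (omV z) => o G V W omG om0 G0 V2 W0 oV.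
have h1 : o * (V * cu) <= G * (V * (13 / 25 * y ^+ 2)).
  by apply: ler_pM => //; [rewrite mulr_ge0//; lra | apply: ler_wpM2l => //; lra].
have h2 : 94 / 100 * y ^+ 2 <= a * cv.
  apply: (@le_trans _ _ ((47 / 48 * y) * (97 / 100 * y))).
    by have : 0 <= y ^+ 2 by [exact: sqr_ge0]; rewrite expr2; lra.
  by apply: ler_pM => //; rewrite mulr_ge0 ?(ltW y0).
have h3 : G * ((V - 2) * (94 / 100 * y ^+ 2)) <= a * G * (W * cv).
  have -> : a * G * (W * cv) = G * (W * (a * cv)) by ring.
  apply: ler_wpM2l; first exact: ltW.
  apply: ler_pM => //; first by lra.
  by rewrite mulr_ge0 ?sqr_ge0.
have h4 : 0 <= G * y ^+ 2 * (V - 2).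
  by rewrite mulr_ge0 ?subr_ge0 // mulr_ge0 ?sqr_ge0 ?(ltW G0).
have h5 : 0 <= G * y ^+ 2 by rewrite mulr_ge0 ?sqr_ge0 ?(ltW G0).
lra.
Qed.

End ChainLyapunov.

(** * The exponential moment of [g], on moving and on frozen states *)

Section ChainStop.
Variables (R : realType) (T l : nat).
Hypotheses (T12 : (12 <= T)%N) (l6 : (6 <= l)%N).
Local Notation P := (@avg8 R (cstate R) (cstep l)).
Local Notation L := (chL l).
Local Notation eps := (cheps R T).
Local Notation y := (chy R l).
Local Notation a := (cha R T l).
Local Notation gam := (chgam R T l).
Local Notation b := (chb R l).
Local Notation om := (@om R T l).
Local Notation z0 := (z0 R l).
Local Notation alive := (@alive R l).
Local Notation okst := (@okst R l).
Local Notation Dfun := (@Dfun R T l).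
Local Notation chN := (chN T l).
Local Notation omV := (@omV R T l).
Local Notation cu := (@cu R l).
Local Notation cv := (@cv R l).
Implicit Types z : cstate R.

Lemma avg8_Dfun_le z : (cj z < L)%N -> P Dfun z <= Dfun z +
  eps * gam ^+ cn z * y ^+ 2 * (1 - 3 / 2 * ((cj z)%:R * y)).
Proof.
move=> h; rewrite avg8_alive//.
set g1 := cg z - _ - _; set g2 := cg z + _ - _; set g3 := cg z + _ + _; set g4 := cg z - _ + _.
have := avg8_Dfun_alive T12 l6 h g1 g3; have := avg8_Dfun_alive T12 l6 h g2 g4.
lra.
Qed.

Lemma omV_ge0 z : okst z -> 0 <= omV z.
Proof.
move=> oz; rewrite /omV mulr_ge0//; first exact/ltW/om_gt0.
by have := cosh2_ge2 (cg z); lra.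
Qed.

(** The source [G y^2 / 4] in the drift of [omV] is too large near the floor, where [om] is far
    below [G]. The term [eps^-1 Dfun], of size [G], has drift at most [G y^2 (1 - 3 x / 2)],
    negative there, which brings the total source down to a multiple of [G (1 - x) <= om]. *)
Definition Yfun z : R := alive z * (omV z + eps^-1 * Dfun z).

Lemma Yfun_ge0 z : okst z -> 0 <= Yfun z.
Proof.
move=> oz; rewrite /Yfun /alive mulr_ge0// addr_ge0 ?omV_ge0//.
by rewrite mulr_ge0 ?Dfun_ge0// invr_ge0 ltW// (cheps_gt0 R T12).
Qed.

Lemma avg8_Yfun z : okst z ->
  P Yfun z <= (1 - y ^+ 2 / 20) * Yfun z + 3 / 2 * y ^+ 2 * om z.
Proof.
move=> oz; have e0 := cheps_gt0 R T12; have y0 := chy_gt0 R l6.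
have om0 := om_gt0 T12 l6 oz.
case: (ltnP (cj z) L) => hz; last first.
  rewrite avg8_dead// {1 2}/Yfun /alive ltnNge hz !mul0r mulr0 add0r.
  by rewrite mulr_ge0 ?(ltW om0)// mulr_ge0// sqr_ge0.
apply: (@le_trans _ _ (P (fun z => 1 * omV z + eps^-1 * Dfun z) z)).
  apply: (avg8_le (@okst_step R l)) => //.
  move=> w ow; rewrite /Yfun /alive mul1r; case: (_ < _)%N; rewrite ?mul1r ?mul0r//.
  by rewrite addr_ge0 ?omV_ge0// mulr_ge0 ?Dfun_ge0// invr_ge0 ltW.
rewrite avg8_lin /Yfun /alive hz !mul1r.
have h1 := avg8_omV T12 l6 hz.
have h2 : eps^-1 * P Dfun z <= eps^-1 * (Dfun z +
    eps * gam ^+ cn z * y ^+ 2 * (1 - 3 / 2 * ((cj z)%:R * y))).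
  rewrite ler_pM2l; last by rewrite invr_gt0.
  exact: avg8_Dfun_le hz.
have {h2} h2 : eps^-1 * P Dfun z <= eps^-1 * Dfun z +
    gam ^+ cn z * y ^+ 2 * (1 - 3 / 2 * ((cj z)%:R * y)).
  apply: (le_trans h2); rewrite mulrDr !mulrA mulVf ?mul1r//; lra.
have eD : eps^-1 * Dfun z = gam ^+ cn z * hprof ((cj z)%:R * y).
  by rewrite /Dfun !mulrA mulVf ?mul1r//; lra.
rewrite eD in h2; rewrite eD.
have h3 : gam ^+ cn z * y ^+ 2 * (1 - (cj z)%:R * y) <= y ^+ 2 * om z.
  rewrite omE mulrA [y ^+ 2 * _]mulrC.
  apply: ler_wpM2l; first by rewrite mulr_ge0 ?sqr_ge0// ltW// gamX_gt0.
  by have /andP[x0 x1] := natL_y R l6 oz; nra.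
have h4 : y ^+ 2 * omV z <= gam ^+ cn z * y ^+ 2 * cosh2 (cg z).
  rewrite /omV mulrA; apply: ler_wpM2r; first by have := cosh2_ge2 (cg z); lra.
  by rewrite mulrC; apply: ler_wpM2r; [exact: sqr_ge0|exact: om_gamX].
have h5 : gam ^+ cn z * y ^+ 2 * hprof ((cj z)%:R * y) <= gam ^+ cn z * y ^+ 2.
  have /andP[_ hh] := hprof_bounds (natL_y R l6 oz).
  by rewrite ler_piMr// mulr_ge0 ?sqr_ge0// ltW// gamX_gt0.
have h6 : 0 <= gam ^+ cn z * y ^+ 2.
  by rewrite mulr_ge0 ?sqr_ge0// ltW// gamX_gt0.
move: h1 h2 h3 h4 h5 h6.
lra.
Qed.

Definition Xfun z : R :=
  Dfun z * cosh2 (cg z) + 26 * eps * omV z + 13 * Dfun z.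

Lemma avg8_DV z : (cj z < L)%N ->
  P (fun z => Dfun z * cosh2 (cg z)) z <= Dfun z * cosh2 (cg z) +
   13 / 10 * (eps * gam ^+ cn z * y ^+ 2 * cosh2 (cg z)).
Proof.
move=> hz; have oz : okst z by exact: ltnW.
have e0 := cheps_gt0 R T12; have y0 := chy_gt0 R l6; have y1 := chy_le R l6.
have hDu g : Dfun (zup z g) = Dfun (zup z 0).
  by rewrite /Dfun /zup /jump ltr01; case: (cj z).
have hDd g : Dfun (zdn z g) = Dfun (zdn z 0).
  by rewrite /Dfun /zdn /jump ltr0N1.
rewrite (@avg8_cosh2 R l Dfun _ _ z hz hDu hDd).
have /andP[u0 u1] := cu_bounds R l6; have /andP[v0 v1] := cv_bounds R l6.
have G0 := gamX_gt0 R T12 l6 (cn z).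
have V2 := cosh2_ge2 (cg z); have W1 := sinh2_le (cg z).
have W0 : 0 <= sinh2 (cg z) by rewrite /sinh2.
have h1 := avg8_Dfun_alive T12 l6 hz 0 0.
have h2 := Dfun_zup_le T12 l6 0 oz.
have /andP[h3 h4] := Dfun_zdn_bounds T12 l6 0 hz.
have h5 := Dfun_diff T12 l6 0 0 hz.
have h6 := Dfun_zup_ge0 T12 l6 0 oz.
have /andP[x0 _] := natL_y R l6 oz.
set K := eps * gam ^+ cn z in h1 h2 h3 h4 h5 *.
have K0 : 0 < K by rewrite mulr_gt0.
move: (Dfun (zup z 0)) (Dfun (zdn z 0)) (Dfun z) h1 h2 h3 h4 h5 h6 => Du Dd D h1 h2 h3 h4 h5 h6.
move: (cosh2 _) (sinh2 _) V2 W1 W0 => V W V2 W1 W0.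
have q0 : 0 <= y ^+ 2 by exact: sqr_ge0.
have V0 : 0 <= V by lra.
have k1 : V * (Du + Dd - 2 * D) <= V * (4 * (K * y ^+ 2)).
  apply: ler_wpM2l => //; apply: (le_trans h1); rewrite ler_pM2l//.
  by rewrite ler_piMr ?mulr_ge0 ?(ltW K0)//; lra.
have k2 : (Du + Dd) * (V * cu) <= (K * (2 + y)) * (V * (13 / 25 * y ^+ 2)).
  apply: ler_pM; [by rewrite addr_ge0|by rewrite mulr_ge0|by lra|exact: ler_wpM2l].
have k3 : (Dd - Du) * (W * cv) <= (2 * y * K) * (V * (11 / 10 * y)).
  apply: le_trans (ler_norm _) _; rewrite normrM; apply: ler_pM => //.
  have cv0 : 0 <= cv by lra.
  by rewrite ger0_norm ?mulr_ge0//; apply: ler_pM.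
have k4 : K * y * (V * (13 / 25 * y ^+ 2)) <= K * (1 / 12) * (V * (13 / 25 * y ^+ 2)).
  apply: ler_wpM2r; first by rewrite mulr_ge0// mulr_ge0//; lra.
  by rewrite ler_pM2l.
have k5 : 0 <= K * y ^+ 2 * V by rewrite !mulr_ge0// ltW.
rewrite -[X in _ + 13 / 10 * (X * _ * _)]/K.
move: k1 k2 k3 k4 k5; lra.
Qed.

Lemma avg8_Xfun z : okst z ->
  P Xfun z <= Xfun z + 39 / 2 * eps * y ^+ 2 * om z.
Proof.
move=> oz; have e0 := cheps_gt0 R T12; have y0 := chy_gt0 R l6.
have om0 := om_gt0 T12 l6 oz.
case: (ltnP (cj z) L) => hz; last first.
  by rewrite avg8_dead// lerDl mulr_ge0 ?(ltW om0)// mulr_ge0 ?sqr_ge0// mulr_ge0 ?(ltW e0).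
have -> : Xfun = fun z => 1 * (1 * (Dfun z * cosh2 (cg z)) + 26 * eps * omV z) + 13 * Dfun z.
  by apply: funext => w; rewrite /Xfun !mul1r.
rewrite !avg8_lin.
have h1 := avg8_omV T12 l6 hz; have h2 := avg8_Dfun_le hz; have h3 := avg8_DV hz.
have h4 : eps * P omV z <= eps * (omV z - gam ^+ cn z * y ^+ 2 * cosh2 (cg z) / 20
             + gam ^+ cn z * y ^+ 2 / 4).
  by rewrite ler_pM2l.
have h5 : eps * (gam ^+ cn z * y ^+ 2 * (1 - (cj z)%:R * y)) <= eps * (y ^+ 2 * om z).
  rewrite ler_pM2l// omE mulrA [y ^+ 2 * _]mulrC.
  apply: ler_wpM2l; first by rewrite mulr_ge0 ?sqr_ge0// ltW// gamX_gt0.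
  by have /andP[x0 x1] := natL_y R l6 oz; nra.
lra.
Qed.

Lemma omV_le z : okst z -> omV z <= Yfun z + Xfun z.
Proof.
move=> oz; have e0 := cheps_gt0 R T12; have y0 := chy_gt0 R l6.
have D0 := Dfun_ge0 T12 l6 oz; have o0 := omV_ge0 oz.
have V0 : 0 <= cosh2 (cg z) by have := cosh2_ge2 (cg z); lra.
have h1 : 0 <= Dfun z * cosh2 (cg z) by rewrite mulr_ge0.
have h2 : 0 <= eps * omV z by rewrite mulr_ge0// ltW.
case: (ltnP (cj z) L) => hz; rewrite /Yfun /Xfun /alive.
  have h3 : 0 <= eps^-1 * Dfun z by rewrite mulr_ge0// invr_ge0 ltW.
  rewrite hz mul1r; lra.
have hz' : cj z = L by apply/eqP; rewrite eqn_leq; apply/andP.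
have -> : Dfun z * cosh2 (cg z) = omV z.
  by rewrite /omV omE /Dfun hz' (dead_y R l6) /hprof; ring.
rewrite ltnNge hz mul0r; lra.
Qed.

Lemma omV_bound : iter chN P omV z0 <= 50.
Proof.
have e0 := cheps_gt0 R T12; have e1 := cheps_le R T12.
have y0 := chy_gt0 R l6; have y1 := chy_le R l6.
have oz0 := okst_z0 R l6; have ost := @okst_step R l.
have omz := om_z0 R T12 l6; have q0 : 0 < y ^+ 2 by rewrite exprn_gt0.
have h : iter chN P omV z0 <= 1 * iter chN P Yfun z0 + 1 * iter chN P Xfun z0.
  rewrite -iter_avg8_lin; apply: (iter_avg8_le ost) => // z oz.
  by rewrite !mul1r omV_le.
have V0 : cosh2 (0 : R) = 2 by rewrite /cosh2 oppr0 expR0.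
have oV0 : omV z0 = 1 + eps by rewrite /omV omz /= V0; field.
have D0 : 0 <= Dfun z0 <= eps.
  rewrite Dfun_ge0//.
  have /andP[_ hh] := hprof_bounds (natL_y R l6 oz0).
  by rewrite /Dfun /= expr0 mulr1 ger_pMr.
have hq : 0 < y ^+ 2 / 20 <= 1.
  by rewrite divr_gt0//=; nra.
have hY := iter_avg8_contract ost hq Yfun_ge0 (@avg8_om R T l) avg8_Yfun chN oz0.
have {hY}hY : iter chN P Yfun z0 <= Yfun z0 + 30 * om z0.
  have -> : 30 * om z0 = 3 / 2 * y ^+ 2 / (y ^+ 2 / 20) * om z0 by field; rewrite gt_eqF.
  by apply: hY; rewrite mulr_ge0 ?(ltW (om_gt0 T12 l6 oz0))//; lra.
have hX := iter_avg8_drift ost (@avg8_om R T l) avg8_Xfun chN oz0.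
have Y0 : Yfun z0 <= omV z0 + 1.
  rewrite /Yfun /alive.
  have h1 : eps^-1 * Dfun z0 <= 1.
    by rewrite mulrC ler_pdivrMr// mul1r; case/andP: D0.
  have h2 : 0 <= eps^-1 * Dfun z0.
    by rewrite mulr_ge0 ?invr_ge0 ?(ltW e0)//; case/andP: D0.
  by case: (_ < _)%N; rewrite ?mul0r ?mul1r; lra.
have X0 : Xfun z0 <= 2 * eps + 26 * eps * 2 + 13 * eps.
  rewrite /Xfun oV0 /= V0; case/andP: D0; nra.
have hk : chN%:R * (39 / 2 * eps * y ^+ 2) = 39 / 8.
  transitivity (39 / 2 * (eps * (chN%:R * y ^+ 2))); first by ring.
  by rewrite chN_y// cheps_T//; field.
rewrite hk omz in hX; rewrite omz in hY.
lra.
Qed.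

End ChainStop.

(** * Conditional means of [om ^ -tau]: size and regularity *)

Section DualChain.
Variables (R : realType) (T l : nat) (tau : R).
Hypotheses (T12 : (12 <= T)%N) (l6 : (6 <= l)%N) (tau0 : 0 < tau <= 1).
Local Notation P := (@avg8 R (cstate R) (cstep l)).
Local Notation L := (chL l).
Local Notation eps := (cheps R T).
Local Notation y := (chy R l).
Local Notation a := (cha R T l).
Local Notation gam := (chgam R T l).
Local Notation om := (@om R T l).
Local Notation z0 := (z0 R l).
Local Notation okst := (@okst R l).
Local Notation chN := (chN T l).
Implicit Types z : cstate R.

Definition mu (t : nat) z : R := iter t P (fun z => om z `^ (- tau)) z.
Definition kap : R := gam `^ (- tau).

(** Multiplying the maximum by [gam] multiplies [om ^ -tau] by [kap]. Up to a power of [kap] the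
    mean [mu] thus depends on the drawdown alone, through this one-dimensional recursion with factor
    [kap] at a new maximum. *)
Fixpoint svec (t j : nat) : R :=
  if t is t'.+1 then
    if (j < L)%N then
      svec t' j / 2 + svec t' j.+1 / 4
      + (if j is j'.+1 then svec t' j' else kap * svec t' 0) / 4
    else svec t' j
  else (1 - a * j%:R) `^ (- tau).

Lemma mu_svec t z : okst z -> mu t z = kap ^+ cn z * svec t (cj z).
Proof.
have g0 : 0 <= gam by have := chgam_ge1 R T12 l6; lra.
elim: t z => [|t IH] z oz.
  rewrite /mu /= /om powRM ?exprn_ge0//; last first.
    have /andP[x0 x1] := natL_y R l6 oz; have [a0 _ ay] := cha_bounds R T12 l6.
    have : a * (cj z)%:R <= y * (cj z)%:R by exact: ler_wpM2r.
    by rewrite [y * _]mulrC; lra.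
  congr (_ * _); rewrite /kap.
  by rewrite -[gam ^+ _]powR_mulrn// -powRrM mulrC powRrM powR_mulrn ?powR_ge0.
rewrite /mu iterS; case: (ltnP (cj z) L) => hz; last first.
  by rewrite avg8_dead// [LHS](IH z oz) /= ltnNge hz.
rewrite avg8_alive//=.
set m := (if cj z is j'.+1 then svec t j' else kap * svec t 0).
have hu g : mu t (zup z g) = kap ^+ cn z * m.
  rewrite /m IH /zup /jump ltr01; last first.
    by move: oz; rewrite /okst; case: (cj z) => //= j /ltnW.
  by case: (cj z) => //=; rewrite exprSr mulrA.
have hd g : mu t (zdn z g) = kap ^+ cn z * svec t (cj z).+1.
  by rewrite IH /zdn /jump ltr0N1.
rewrite -!/(mu t _) !hu !hd IH// hz; by field.
Qed.

Lemma kap_bounds : [/\ 0 < kap, 1 - y <= kap & kap <= 1].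
Proof.
have g1 := chgam_ge1 R T12 l6; have [a0 _ ay] := cha_bounds R T12 l6.
have /andP[t0 t1] := tau0.
have y0 := chy_gt0 R l6; have y1 := chy_le R l6.
have h : gam^-1 <= kap.
  rewrite /kap -powR_inv1; last by lra.
  by apply: ler_powR => //; lra.
split; first by rewrite powR_gt0; lra.
  apply: le_trans h; rewrite -[leRHS]mul1r ler_pdivlMr; last by lra.
  by rewrite /chgam; nra.
by rewrite /kap -(powRr0 gam); apply: ler_powR => //; lra.
Qed.

Local Notation Mx := (eps `^ (- tau)).

Lemma svec0_arg j : (j <= L)%N -> eps <= 1 - a * j%:R <= 1.
Proof.
move=> hj; have /andP[x0 x1] := natL_y R l6 hj; have e0 := cheps_gt0 R T12.
have e1 := cheps_le R T12.
have -> : a * j%:R = (1 - eps) * (j%:R * y) by rewrite /cha; ring.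
by apply/andP; split; nra.
Qed.

Lemma powN_le (u v : R) : 0 < u -> u <= v -> v `^ (- tau) <= u `^ (- tau).
Proof.
move=> u0 uv; rewrite !powRN lef_pV2 ?posrE ?powR_gt0//; last exact: lt_le_trans uv.
have /andP[t0 _] := tau0.
by apply: ge0_ler_powR; rewrite ?nnegrE//; lra.
Qed.

Lemma svec0_bounds j : (j <= L)%N -> 1 <= svec 0 j <= Mx.
Proof.
move=> /svec0_arg/andP[h1 h2]; have e0 := cheps_gt0 R T12.
rewrite /= (powN_le e0 h1) andbT.
have := @powN_le (1 - a * j%:R) 1 _ h2; rewrite powR1; apply.
exact: lt_le_trans h1.
Qed.

Lemma Mx_ge1 : 1 <= Mx.
Proof. by have /andP[h1 h2] := svec0_bounds (leq0n L); exact: le_trans h2. Qed.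

Lemma svec_dead t : svec t L = Mx.
Proof.
elim: t => [|t IH] /=; last by rewrite ltnn.
congr (_ `^ _); have -> : a * L%:R = (1 - eps) * (L%:R * y) by rewrite /cha; ring.
by rewrite dead_y//; ring.
Qed.

(** A bound linear in the drawdown survives averaging; at drawdown 0 its slope pays for the factor
    [kap >= 1 - y] of a new maximum. *)
Lemma svec_bounds t j : (j <= L)%N -> (1 + j%:R * y) / 2 <= svec t j <= Mx.
Proof.
have [k0 k1 k2] := kap_bounds; have y0 := chy_gt0 R l6.
elim: t j => [|t IH] j hj.
  have /andP[h1 ->] := svec0_bounds hj; rewrite andbT.
  by have /andP[x0 x1] := natL_y R l6 hj; apply: le_trans h1; lra.
rewrite /=; case: ltnP => hjL; last exact: IH.
have /andP[a1 a2] := IH _ hj; have /andP[b1 b2] := IH _ hjL.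
rewrite -natr1 in b1.
case: j hj hjL a1 a2 b1 b2 => [|j] hj hjL a1 a2 b1 b2.
  rewrite !mul0r ?addr0 ?add0r in a1 b1 *.
  have h1 : kap * (1 / 2) <= kap * svec t 0 by rewrite ler_pM2l//; lra.
  have h2 : kap * svec t 0 <= 1 * svec t 0 by apply: ler_wpM2r => //; lra.
  by apply/andP; split; lra.
have /andP[c1 c2] := IH j (ltnW hj).
rewrite -natr1 in a1 b1 *.
by apply/andP; split; lra.
Qed.

Local Notation Dd := (y / eps ^+ 2).

Lemma svec0_lip j : (j < L)%N -> `|svec 0 j - svec 0 j.+1| <= Dd.
Proof.
move=> hj; have /andP[h1 h2] := svec0_arg (ltnW hj); have /andP[h3 h4] := svec0_arg hj.
have e0 := cheps_gt0 R T12; have e1 := cheps_le R T12; have [a0 _ ay] := cha_bounds R T12 l6.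
have y0 := chy_gt0 R l6.
rewrite /= -natr1 mulrDr mulr1 in h3 h4 *.
set u := 1 - a * j%:R in h1 h2 *.
have -> : 1 - (a * j%:R + a) = u - a by rewrite /u; ring.
have {}h3 : eps <= u - a by rewrite /u; lra.
have p1 : u `^ (- tau) <= (u - a) `^ (- tau) by apply: powN_le; lra.
rewrite ler0_norm ?subr_le0// opprB.
(* v^-tau - u^-tau = v^-tau (1 - (v / u)^tau) and (v / u)^tau >= v / u *)
have /andP[t0 t1] := tau0.
have q0 : 0 < (u - a) / u <= 1.
  by apply/andP; split; [rewrite divr_gt0; lra|rewrite ler_pdivrMr; lra].
have hq : (u - a) / u <= ((u - a) / u) `^ tau.
  exact: ger1_powR.
have e : u `^ (- tau) = (u - a) `^ (- tau) * ((u - a) / u) `^ tau.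
  rewrite powRM ?invr_ge0; [|by lra|by lra].
  rewrite mulrA -powRD; last by apply/implyP => _; rewrite gt_eqF//; lra.
  by rewrite addNr powRr0 mul1r -powR_inv1 -?powRrM ?mulN1r//; lra.
rewrite e -{1}[(u - a) `^ _]mulr1 -mulrBr.
have hM : (u - a) `^ (- tau) <= eps^-1.
  apply: le_trans (powN_le e0 h3) _.
  rewrite powRN lef_pV2 ?posrE ?powR_gt0//.
  apply: ger1_powR => //.
  by apply/andP; split => //; lra.
have hB : 1 - ((u - a) / u) `^ tau <= y / eps.
  apply: (@le_trans _ _ (1 - (u - a) / u)); first by lra.
  have -> : 1 - (u - a) / u = a / u by field; lra.
  apply: ler_pM; [exact: ltW|by rewrite invr_ge0; lra|by []|].
  by rewrite lef_pV2 ?posrE//; lra.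
have -> : Dd = eps^-1 * (y / eps) by field; lra.
apply: ler_pM => //; first exact: powR_ge0.
rewrite subr_ge0; apply: (@le_trans _ _ (1 `^ tau)); last by rewrite powR1.
by apply: ge0_ler_powR; rewrite ?nnegrE//; case/andP: q0; lra.
Qed.

End DualChain.

Section DualSmooth.
Variables (R : realType) (T l : nat) (tau : R).
Hypotheses (T12 : (12 <= T)%N) (l6 : (6 <= l)%N) (tau0 : 0 < tau <= 1).
Local Notation P := (@avg8 R (cstate R) (cstep l)).
Local Notation L := (chL l).
Local Notation eps := (cheps R T).
Local Notation y := (chy R l).
Local Notation a := (cha R T l).
Local Notation gam := (chgam R T l).
Local Notation om := (@om R T l).
Local Notation z0 := (z0 R l).
Local Notation okst := (@okst R l).
Local Notation chN := (chN T l).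
Local Notation mu := (@mu R T l tau).
Local Notation kap := (@kap R T l tau).
Local Notation svec := (@svec R T l tau).
Local Notation Mx := (eps `^ (- tau)).
Local Notation Dd := (y / eps ^+ 2).
Implicit Types z : cstate R.

Lemma Mx_le : Mx <= eps^-1.
Proof.
have e0 := cheps_gt0 R T12; have e1 := cheps_le R T12.
rewrite powRN lef_pV2 ?posrE ?powR_gt0//; apply: ger1_powR; last by case/andP: tau0.
by apply/andP; split => //; lra.
Qed.

(** Averaging preserves a Lipschitz bound. At drawdown 0 the extra difference [(1 - kap) svec t 0]
    is at most [y Mx], and at the floor the value does not change with [t]. *)
Lemma svec_lip t j : (j < L)%N -> `|svec t j - svec t j.+1| <= Dd.
Proof.
have [k0 k1 k2] := kap_bounds T12 l6 tau0; have y0 := chy_gt0 R l6.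
have e0 := cheps_gt0 R T12; have e1 := cheps_le R T12.
elim: t j => [|t IH] j hj; first exact: svec0_lip.
have L2 : (1 < L)%N by rewrite /chL; lia.
rewrite /= hj; case: (ltnP j.+1 L) => hj1.
  have := IH j hj; have := IH j.+1 hj1.
  case: j hj hj1 => [|j] hj hj1.
    have /andP[s0 s1] := svec_bounds T12 l6 tau0 t (leq0n L).
    have : 0 <= svec t 0 - kap * svec t 0 <= Dd.
      have h1 : 0 <= svec t 0 by rewrite mul0r in s0; lra.
      have -> : svec t 0 - kap * svec t 0 = (1 - kap) * svec t 0 by ring.
      rewrite mulr_ge0 ?subr_ge0//=.
      apply: (@le_trans _ _ (y * eps^-1)).
        apply: ler_pM => //; [by rewrite subr_ge0|by lra|].
        exact: le_trans s1 Mx_le.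
      rewrite ler_pM2l// lef_pV2 ?posrE ?exprn_gt0//.
      by rewrite expr2 ler_piMl//; lra.
    move=> /andP[h1 h2]; rewrite !ler_norml => /andP[a1 a2] /andP[b1 b2].
    by apply/andP; split; lra.
  have := IH j (ltnW hj); rewrite !ler_norml => /andP[a1 a2] /andP[b1 b2] /andP[c1 c2].
  by apply/andP; split; lra.
have eL : j.+1 = L by apply/eqP; rewrite eqn_leq hj.
have {}L2 : (0 < j)%N by lia.
case: j hj eL hj1 L2 => // j hj eL hj1 _.
have := IH j.+1 hj; have := IH j (ltnW hj).
rewrite !ler_norml => /andP[a1 a2] /andP[b1 b2].
by apply/andP; split; lra.
Qed.

Lemma svec_ge_half t j : (j <= L)%N -> 1 / 2 <= svec t j.
Proof.
move=> h; have /andP[s0 _] := svec_bounds T12 l6 tau0 t h.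
by have /andP[x0 _] := natL_y R l6 h; lra.
Qed.

Lemma mu_gt0 t z : okst z -> 0 < mu t z.
Proof.
move=> oz; rewrite mu_svec// mulr_gt0//.
  by rewrite exprn_gt0//; have [] := kap_bounds T12 l6 tau0.
by have := svec_ge_half t oz; lra.
Qed.

(** The factor 2 comes from [svec >= 1 / 2], which turns the absolute bound [Dd] into a relative
    one. *)
Definition cheta : R := 2 * Dd.

Lemma mu_step t z c : okst z ->
  `|mu t (cstep l z c) - mu t z| <= cheta * mu t z.
Proof.
move=> oz; have [k0 k1 k2] := kap_bounds T12 l6 tau0; have y0 := chy_gt0 R l6.
have e0 := cheps_gt0 R T12; have e1 := cheps_le R T12.
have d0 : 0 < Dd by rewrite divr_gt0// exprn_gt0.
have triv : `|mu t z - mu t z| <= cheta * mu t z.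
  by rewrite subrr normr0 mulr_ge0 ?(ltW (mu_gt0 _ _))// /cheta mulr_ge0 ?(ltW d0).
rewrite /cstep; case: ifP => // /andP[hz _].
set g := cg z + _ - _; move: g => g.
have K0 : 0 < kap ^+ cn z by rewrite exprn_gt0.
have key j' : (j' <= L)%N -> `|svec t j' - svec t (cj z)| <= Dd ->
    `|kap ^+ cn z * svec t j' - kap ^+ cn z * svec t (cj z)| <= cheta * (kap ^+ cn z * svec t (cj z)).
  move=> hj' h; rewrite -mulrBr normrM gtr0_norm// mulrCA ler_pM2l//.
  by apply: (le_trans h); have := svec_ge_half t oz; rewrite /cheta; nra.
rewrite /jump; case: ifP => _; last first.
  rewrite !mu_svec//=; apply: key => //.
  by rewrite distrC; exact: svec_lip.
case E: (cj z) => [|j].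
  rewrite mu_svec//.
  rewrite mu_svec//= E exprSr -mulrA.
  have s0 := svec_ge_half t oz; rewrite E in s0.
  rewrite -mulrBr normrM gtr0_norm// mulrCA ler_pM2l//.
  have -> : kap * svec t 0 - svec t 0 = - ((1 - kap) * svec t 0) by ring.
  rewrite normrN ger0_norm; last by rewrite mulr_ge0 ?subr_ge0//; lra.
  apply: ler_wpM2r; first by lra.
  have : y <= Dd by rewrite ler_pdivlMr ?exprn_gt0// ler_piMr ?(ltW y0)// exprn_ile1//; lra.
  by rewrite /cheta; lra.
have jL : (j < L)%N by apply: ltnW; rewrite -E.
rewrite mu_svec; [|exact: T12|exact: l6|exact: ltnW jL].
rewrite mu_svec//; apply: key; first exact: ltnW jL.
by rewrite E; exact: svec_lip.
Qed.

Lemma om_step_le z c : okst z -> `|om (cstep l z c) - om z| <= cheta * om z.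
Proof.
move=> oz; rewrite om_step addrC addKr /alph.
have [a0 _ ay] := cha_bounds R T12 l6; have y0 := chy_gt0 R l6.
have e0 := cheps_gt0 R T12; have e1 := cheps_le R T12.
have G0 := gamX_gt0 R T12 l6 (cn z); have h := om_ge T12 l6 oz.
apply: (@le_trans _ _ (a * gam ^+ cn z)).
  rewrite normrM -[leRHS]mulr1; apply: ler_pM => //.
    rewrite /alive; case: (_ < _)%N; rewrite ?mul0r ?normr0 ?mul1r.
      by rewrite ger0_norm// mulr_ge0// ltW.
    by rewrite mulr_ge0// ltW.
  by move: c => [|[|[|[|[|[|c]]]]]] /=; rewrite ?normrN ?normr0 ?normr1 ?ler01.
apply: (@le_trans _ _ (cheta * (eps * gam ^+ cn z))).
  rewrite mulrA ler_pM2r// /cheta.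
  have -> : 2 * (y / eps ^+ 2) * eps = y * (2 / eps) by field; lra.
  apply: (le_trans ay); rewrite ler_peMr ?(ltW y0)// ler_pdivlMr//; lra.
by apply: ler_wpM2l => //; rewrite /cheta mulr_ge0// divr_ge0 ?sqr_ge0 ?(ltW y0).
Qed.

(** The powers of the running maximum cancel and leave the value at the floor. This bounds the
    product in the [A_p] condition at every node of the tree, whatever the number [t] of further
    levels. *)
Lemma om_mu_le t z : okst z -> om z `^ tau * mu t z <= Mx.
Proof.
move=> oz; rewrite mu_svec//; have /andP[t0 t1] := tau0.
have g0 : 0 < gam by have := chgam_ge1 R T12 l6; lra.
have G0 := gamX_gt0 R T12 l6 (cn z).
have /andP[s0 s1] := svec_bounds T12 l6 tau0 t oz.
have s2 := svec_ge_half t oz.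
apply: (@le_trans _ _ ((gam ^+ cn z) `^ tau * (kap ^+ cn z * Mx))).
  have [k0 _ _] := kap_bounds T12 l6 tau0.
  have kn : 0 <= kap ^+ cn z by rewrite exprn_ge0// ltW.
  apply: ler_pM; rewrite ?powR_ge0 ?mulr_ge0//; [by lra| |exact: ler_wpM2l].
  apply: ge0_ler_powR; rewrite ?nnegrE ?(ltW t0) ?(ltW (om_gt0 T12 l6 oz)) ?(ltW G0)//.
  exact: om_gamX.
rewrite mulrA /kap -!powR_mulrn ?powR_ge0 ?(ltW g0)// -!powRrM.
rewrite -powRD; last by apply/implyP => _; rewrite gt_eqF.
by rewrite mulNr [tau * _]mulrC addrN powRr0 mul1r.
Qed.

Let q : R := 1 - y ^+ 2 / 3.

(** From drawdown [x] the symmetric walk meets the floor before drawdown 0 with probability [x]. The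
    subtracted term accounts for walks undecided after [t] moves: [1 + x (1 - x)] is at most 5/4 and
    loses [y^2 / 2] in each averaging, more than the fraction [y^2 / 3] of itself. *)
Lemma svec_hit t j : (j <= L)%N ->
  Mx * (j%:R * y - q ^+ t * (1 + j%:R * y * (1 - j%:R * y))) <= svec t j.
Proof.
have y0 := chy_gt0 R l6; have y1 := chy_le R l6.
have M1 := Mx_ge1 T12 l6 tau0.
have q01 : 0 <= q <= 1 by rewrite /q; apply/andP; split; nra.
have [k0 _ _] := kap_bounds T12 l6 tau0.
have dead t' : Mx * (L%:R * y - q ^+ t' * (1 + L%:R * y * (1 - L%:R * y))) <= svec t' L.
  rewrite svec_dead// dead_y// subrr mulr0 addr0 mulr1 ler_piMr//; first by lra.
  by rewrite gerBl exprn_ge0//; case/andP: q01.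
elim: t j => [|t IH] j hj.
  have /andP[x0 x1] := natL_y R l6 hj.
  apply: (@le_trans _ _ 0); last by have := svec_ge_half 0 hj; lra.
  by rewrite mulr_ge0_le0 ?expr0 ?mul1r//; [lra|nra].
case: (ltnP j L) => hjL; last first.
  by have -> : j = L; [apply/eqP; rewrite eqn_leq hj|exact: dead].
have /andP[x0 x1] := natL_y R l6 hj.
have /andP[q0 q1] := q01; have qt : 0 <= q ^+ t by rewrite exprn_ge0.
case: j hj hjL x0 x1 => [|j] hj hjL x0 x1.
  apply: (@le_trans _ _ 0); last by have := svec_ge_half t.+1 hj; lra.
  rewrite !mul0r addr0 mulr1 sub0r mulr_ge0_le0 ?oppr_le0 ?exprn_ge0//; lra.
rewrite /= hjL.
have h1 := IH _ hj; have h2 := IH _ hjL; have h3 := IH j (ltnW hj).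
rewrite -[j.+2%:R]natr1 in h2; rewrite -[j.+1%:R]natr1 in h1 h2 x0 x1 *.
have e : j%:R * y = (j%:R + 1) * y - y by ring.
rewrite e {e} in h3.
rewrite [(_ + 1 + 1) * y]mulrDl mul1r in h2.
move: ((j%:R + 1) * y) h1 h2 h3 x0 x1 => x h1 h2 h3 x0 x1.
have h4 : Mx * (x - q ^+ t.+1 * (1 + x * (1 - x))) <=
   Mx * (x - q ^+ t * (1 + x * (1 - x) - y ^+ 2 / 2)).
  apply: ler_wpM2l; first by lra.
  rewrite lerD2l lerN2 [q ^+ t.+1]exprSr -[leRHS]mulrA; apply: ler_wpM2l => //.
  have h5 : 1 + x * (1 - x) <= 5 / 4 by have := sqr_ge0 (x - 1 / 2); lra.
  have h6 : 0 <= y ^+ 2 by exact: sqr_ge0.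
  rewrite /q mulrBl mul1r; nra.
apply: (le_trans h4); move: h1 h2 h3; move: (svec _ _) (svec _ _) (svec _ _) (q ^+ t) Mx => A B C Q M.
lra.
Qed.

Lemma mu_hit : Mx / 4 <= mu chN z0.
Proof.
rewrite mu_svec//; last exact: okst_z0.
rewrite expr0 mul1r /=; have y0 := chy_gt0 R l6; have y1 := chy_le R l6.
have hl : (l <= L)%N by rewrite /chL; lia.
apply: le_trans (svec_hit chN hl).
have -> : l%:R * y = 1 / 2.
  have := dead_y R l6; rewrite [L in L%:R]/chL natrM; lra.
have M1 := Mx_ge1 T12 l6 tau0.
(* At drawdown 1/2 the bracket is [1 / 2 - 5 / 4 * q ^+ chN]. *)
suff hq : q ^+ chN <= 1 / 5.
  apply: ler_wpM2l; first by lra.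
  lra.
have y2 : 0 < y ^+ 2 by rewrite exprn_gt0.
have q0 : 0 <= q <= 1 by rewrite /q; apply/andP; split; nra.
have bern n : 1 + n%:R * (y ^+ 2 / 3) <= (1 + y ^+ 2 / 3) ^+ n.
  elim: n => [|n IH]; first by rewrite mul0r addr0 expr0.
  have n0 : 0 <= n%:R :> R by [].
  rewrite [X in _ <= X]exprSr -natr1; apply: (@le_trans _ _ ((1 + n%:R * (y ^+ 2 / 3)) * (1 + y ^+ 2 / 3))).
    by have := mulr_ge0 n0 (sqr_ge0 (y ^+ 2)); lra.
  by apply: ler_wpM2r => //; lra.
have h1 : q ^+ chN * (1 + y ^+ 2 / 3) ^+ chN <= 1.
  have e : q * (1 + y ^+ 2 / 3) = 1 - (y ^+ 2 / 3) ^+ 2 by rewrite /q; field.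
  have y3 : y ^+ 2 / 3 <= 1 by case/andP: q0; rewrite /q; lra.
  rewrite -exprMn e exprn_ile1//; last by rewrite gerBl sqr_ge0.
  by rewrite subr_ge0 exprn_ile1//; lra.
(* Bernoulli's inequality with [chN y^2 / 3 = T / 3 >= 4]: this uses [12 <= T]. *)
have h2 : 5 <= (1 + y ^+ 2 / 3) ^+ chN.
  apply: le_trans (bern _); rewrite mulrA chN_y//.
  have : 12 <= T%:R :> R by rewrite (ler_nat _ 12).
  lra.
have h3 : 0 <= q ^+ chN by rewrite exprn_ge0//; case/andP: q0.
nra.
Qed.

End DualSmooth.

(** * The Hilbert kernel between cells of a uniform grid *)

Section HilbertKernel.
Variable R : realType.

Definition xlnx (k : int) : R := k%:~R * ln `|k%:~R : R|.

(* [wz k] is the integral over the cell [[k, k + 1]] of the Hilbert transform of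
   the indicator of the cell [[0, 1]]. *)
Definition wz (k : int) : R := xlnx (k + 1) - 2 * xlnx k + xlnx (k - 1).

Lemma xlnxN k : xlnx (- k) = - xlnx k.
Proof. by rewrite /xlnx rmorphN normrN mulNr. Qed.

Lemma wzN k : wz (- k) = - wz k.
Proof.
rewrite /wz (_ : - k + 1 = - (k - 1)); last by lia.
by rewrite (_ : - k - 1 = - (k + 1)); [rewrite !xlnxN; ring|lia].
Qed.

Lemma xlnx_nat (n : nat) : xlnx n%:Z = n%:R * ln n%:R.
Proof. by rewrite /xlnx normr_nat. Qed.

Lemma xlnx0 : xlnx 0 = 0. Proof. by rewrite /xlnx mul0r. Qed.
Lemma xlnx1 : xlnx 1 = 0. Proof. by rewrite /xlnx normr1 ln1 mulr0. Qed.

Lemma wz0 : wz 0 = 0.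
Proof. by rewrite /wz add0r sub0r xlnxN xlnx0; ring. Qed.

Lemma xlnx_tangent (s t : R) : 0 < s -> 0 <= t ->
  s * ln s + (ln s + 1) * (t - s) <= t * ln t.
Proof.
move=> s0; rewrite le_eqVlt => /orP[/eqP <-|t0]; first by rewrite mul0r; lra.
have h : ln (s / t) <= s / t - 1.
  by have := @le_ln1Dx R (s / t - 1); rewrite addrCA subrr addr0; apply; rewrite ltrBrDl subrr divr_gt0.
have {h} : t * ln (s / t) <= s - t.
  apply: (le_trans (ler_wpM2l (ltW t0) h)); rewrite mulrBr mulr1 mulrCA divff ?mulr1//.
  by rewrite gt_eqF.
rewrite ln_div ?posrE//; lra.
Qed.

Lemma wz_natE (n : nat) : wz n.+1%:Z =
  n.+2%:R * ln n.+2%:R - 2 * (n.+1%:R * ln n.+1%:R) + n%:R * ln n%:R.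
Proof.
rewrite /wz (_ : n.+1%:Z + 1 = n.+2%:Z); last by lia.
by rewrite (_ : n.+1%:Z - 1 = n%:Z); [rewrite !xlnx_nat|lia].
Qed.

Lemma wz1E : wz 1 = 2 * ln 2.
Proof. by rewrite (wz_natE 0) ln1; ring. Qed.

Lemma wz2E : wz 2 = 3 * ln 3 - 4 * ln 2.
Proof. by rewrite (wz_natE 1) ln1; ring. Qed.

Lemma wz_ge0 (k : nat) : 0 <= wz k%:Z.
Proof.
case: k => [|k]; first by rewrite wz0.
rewrite wz_natE.
have k0 : 0 < k.+1%:R :> R by rewrite ltr0n.
have h1 := xlnx_tangent k0 (ler0n _ k); have h2 := xlnx_tangent k0 (ler0n _ k.+2).
have e1 : k.+2%:R = k.+1%:R + 1 :> R by rewrite natr1.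
have e2 : k.+1%:R = k%:R + 1 :> R by rewrite natr1.
move: h1 h2; rewrite !e1; move: (ln _) (ln _) (ln _) => A B C; rewrite !e2.
lra.
Qed.

Lemma is_derive_xlnx (x c : R) : 0 < x + c ->
  is_derive x 1 (fun t : R => (t + c) * ln (t + c)) (ln (x + c) + 1).
Proof.
move=> xc.
have h1 : is_derive x 1 (fun t : R => t + c) 1.
  have : is_derive x 1 ((fun t : R => t) + cst c) (1 + 0) by apply: is_deriveD.
  by rewrite addr0.
have h2 : is_derive x 1 (fun t : R => ln (t + c)) ((x + c)^-1).
  have h := is_derive1_ln xc.
  have := @is_derive1_comp R (@ln R) (fun t : R => t + c) x _ _ h h1.
  by rewrite mulr1.
have h : is_derive x 1 ((fun t : R => t + c) * (fun t : R => ln (t + c)))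
    ((x + c) *: (x + c)^-1 + ln (x + c) *: 1) by apply: is_deriveM.
apply: (is_derive_eq h).
by rewrite /GRing.scale /= mulfV ?gt_eqF// mulr1 addrC.
Qed.

(** [wz] is a second difference of [x ln x], whose derivative at [c] is
    [ln ((c + 1) (c - 1) / c^2) <= 0]. The first step is separate, since [ln] is singular at
    [k - 1 = 0]; there the claim reduces to [3^3 <= 2^6]. *)
Lemma wz_step (k : nat) : (0 < k)%N -> wz k.+1%:Z <= wz k%:Z.
Proof.
case: k => // -[|k] _.
  rewrite wz1E wz2E.
  have h : 3 * ln 3 <= 6 * ln 2 :> R.
    have -> : 3 * ln 3 = ln (3 ^+ 3) :> R by rewrite lnXn// mulr_natl.
    have -> : 6 * ln 2 = ln (2 ^+ 6) :> R by rewrite lnXn// mulr_natl.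
    by rewrite ler_ln ?posrE ?exprn_gt0//; lra.
  lra.
set f := fun t : R => (t + 1) * ln (t + 1) - 2 * ((t + 0) * ln (t + 0)) + (t + -1) * ln (t + -1).
set df := fun t : R => (ln (t + 1) + 1) - 2 * (ln (t + 0) + 1) + (ln (t + -1) + 1).
have fE (n : nat) : f n.+1%:R = wz n.+1%:Z.
  rewrite wz_natE /f addr0 natr1.
  by rewrite (_ : n.+1%:R + -1 = n%:R)// -natr1 addrK.
have dfE (x : R) : 1 < x -> is_derive x 1 f (df x).
  move=> x1; rewrite /f /df.
  have h1 : 0 < x + 1 by lra.
  have h2 : 0 < x + 0 by lra.
  have h3 : 0 < x + -1 by lra.
  have d1 := is_derive_xlnx h1; have d2 := is_derive_xlnx h2; have d3 := is_derive_xlnx h3.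
  exact: is_deriveD.
have lt12 : k.+2%:R < k.+3%:R :> R by rewrite ltr_nat.
have k1 : 1 < k.+2%:R :> R by rewrite (ltr_nat _ 1).
have dx (x : R) : x \in `]k.+2%:R, k.+3%:R[ -> is_derive x 1 f (df x).
  by rewrite in_itv/= => /andP[h1 _]; apply: dfE; exact: lt_trans h1.
have cf : {within `[k.+2%:R, k.+3%:R], continuous f}%classic.
  apply: derivable_within_continuous => x; rewrite in_itv/= => /andP[h1 _].
  by have [] : is_derive x 1 f (df x) by apply: dfE; exact: lt_le_trans h1.
have [c hc] := MVT lt12 dx cf.
rewrite !fE => e.
suff : df c <= 0.
  by move=> h; rewrite -subr_le0 e mulr_le0_ge0// subr_ge0 ltW.
move: hc; rewrite in_itv/= => /andP[c1 _].
have {}c1 : 1 < c by exact: lt_trans c1.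
rewrite /df addr0.
have : ln (c + 1) + ln (c + -1) <= 2 * ln c.
  have -> : 2 * ln c = ln (c ^+ 2) by rewrite lnXn ?mulr_natl//; lra.
  rewrite -lnM ?posrE; [|by lra|by lra].
  by rewrite ler_ln ?posrE; nra.
lra.
Qed.

Lemma wz_noninc (k k' : nat) : (0 < k)%N -> (k <= k')%N -> wz k'%:Z <= wz k%:Z.
Proof.
move=> k0 /subnK <-; elim: (k' - k)%N => // n IH.
by apply: le_trans IH; rewrite addSn; apply: wz_step; lia.
Qed.

(** The lower bound of [blk_row_ge] for one row of block interactions; it is positive because
    [3^6 < 2^11]. *)
Definition kst : R := 6 * wz 1 - 8 * wz 2.

Lemma kst_gt0 : 0 < kst.
Proof.
rewrite /kst wz1E wz2E.
have h : 6 * ln 3 < 11 * ln 2 :> R.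
  have -> : 6 * ln 3 = ln (3 ^+ 6) :> R by rewrite lnXn// mulr_natl.
  have -> : 11 * ln 2 = ln (2 ^+ 11) :> R by rewrite lnXn// mulr_natl.
  by rewrite ltr_ln ?posrE ?exprn_gt0//; lra.
lra.
Qed.

(** All error interactions over [M] cells are bounded by multiples of this sum, which telescopes to
    order [ln M], while the main term grows like [M]. *)
Definition Lam (M : nat) : R := \sum_(k < M) wz k.+1%:Z.

Lemma Lam_le M : Lam M <= ln M.+1%:R + 1.
Proof.
have -> : Lam M = xlnx M.+1%:Z - xlnx M%:Z.
  rewrite /Lam; elim: M => [|M IH]; first by rewrite big_ord0 xlnx0 xlnx1 subrr.
  rewrite big_ord_recr/= IH /wz (_ : M.+1%:Z + 1 = M.+2%:Z); last by lia.
  by rewrite (_ : M.+1%:Z - 1 = M%:Z); [ring|lia].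
rewrite !xlnx_nat.
have M0 : 0 < M.+1%:R :> R by rewrite ltr0n.
have := xlnx_tangent M0 (ler0n _ M); rewrite -natr1; lra.
Qed.

Lemma Lam_ge0 M : 0 <= Lam M.
Proof. by apply: sumr_ge0 => i _; exact: wz_ge0. Qed.

Lemma Lam_small (theta : R) : 0 < theta -> exists2 m : nat, (0 < m)%N &
  Lam (8 * m) <= theta * (8 * m)%:R.
Proof.
move=> t0; set c := 2 / theta; have c0 : 0 < c by rewrite divr_gt0.
have [m hm] : exists m : nat, (`|ln c| + 1 / c) / (4 * theta) < m.+1%:R.
  exists (Num.trunc ((`|ln c| + 1 / c) / (4 * theta))).
  exact: truncnS_gt.
exists m.+1 => //; apply: le_trans (Lam_le _) _.
set M := (8 * m.+1)%N.
have M0 : 0 < M.+1%:R :> R by rewrite ltr0n.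
(* The tangent of [ln] at [c = 2 / theta] has slope [theta / 2]; half of [theta M] is left to absorb
   the constants. *)
have h1 : ln M.+1%:R <= ln c + M.+1%:R / c - 1.
  have q0 : 0 < M.+1%:R / c by rewrite divr_gt0.
  have := @le_ln1Dx R (M.+1%:R / c - 1).
  rewrite addrCA subrr addr0 ln_div ?posrE// => h.
  have : ln M.+1%:R - ln c <= M.+1%:R / c - 1 by apply: h; lra.
  lra.
have h2 : `|ln c| + 1 / c <= m.+1%:R * (4 * theta).
  by rewrite -ler_pdivrMr ?mulr_gt0// ltW.
have h3 : M.+1%:R / c = M%:R * theta / 2 + 1 / c.
  by rewrite -natr1 /c; field; lra.
have h4 : M%:R = 8 * m.+1%:R :> R by rewrite /M natrM.
have h5 := ler_norm (ln c).
rewrite h3 in h1; rewrite h4 in h1 *; lra.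
Qed.

End HilbertKernel.

(** * Interactions of oscillating patterns *)

Lemma sum_block (V : nmodType) (m n : nat) (F : nat -> V) :
  \sum_(i < m * n) F i = \sum_(k < m) \sum_(c < n) F (k * n + c)%N.
Proof.
elim: m => [|m IH]; first by rewrite !big_ord0.
by rewrite big_ord_recr/= -IH mulSnr big_split_ord.
Qed.

Section Oscillation.
Variable R : realType.

Lemma telescope_ord (G : nat -> R) n :
  \sum_(u < n) (G u - G u.+1) = G 0 - G n.
Proof.
elim: n => [|n IH]; first by rewrite big_ord0 subrr.
by rewrite big_ord_recr/= IH; ring.
Qed.

Section Pattern.
Variable rho : nat -> R.
Hypotheses (rho0 : \sum_(c < 8) rho c = 0) (rho1 : forall c, `|rho c| <= 1).

(** Having mean zero, the pattern sees in each period only the variation of [e], and for a monotone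
    [e] these variations add up to at most the difference of the end values. *)
Lemma pattern_sum_nondec m (e : nat -> R) :
  (forall u, (u.+1 < m * 8)%N -> e u <= e u.+1) ->
  `|\sum_(v < m * 8) rho (v %% 8)%N * e v| <= 8 * (e (m * 8).-1 - e 0).
Proof.
elim: m => [|m IH] he; first by rewrite big_ord0 normr0 subrr mulr0.
have mono i j : (i <= j)%N -> (j < m.+1 * 8)%N -> e i <= e j.
  move=> /subnK <-; elim: (j - i)%N => // k IHk hk.
  by apply: (le_trans (IHk _)); [lia|apply: he].
have {}IH := IH (fun u hu => he u ltac:(lia)).
rewrite mulSnr big_split_ord/=.
apply: (le_trans (ler_normD _ _)).
have -> : \sum_(i < 8) rho ((m * 8 + i) %% 8)%N * e (m * 8 + i)%N =
    \sum_(i < 8) rho i * (e (m * 8 + i)%N - e (m * 8)%N).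
  under [RHS]eq_bigr do rewrite mulrBr.
  rewrite sumrB -mulr_suml rho0 mul0r subr0; apply: eq_bigr => i _.
  by rewrite modnMDl modn_small.
have h2 : `|\sum_(i < 8) rho i * (e (m * 8 + i)%N - e (m * 8)%N)| <=
    8 * (e (m * 8 + 7)%N - e (m * 8)%N).
  apply: (le_trans (ler_norm_sum _ _ _)).
  have -> : 8 * (e (m * 8 + 7)%N - e (m * 8)%N) =
      \sum_(i < 8) (e (m * 8 + 7)%N - e (m * 8)%N).
    by rewrite sumr_const card_ord mulr_natl.
  apply: ler_sum => i _; rewrite normrM -[leRHS]mul1r.
  have h3 : e (m * 8)%N <= e (m * 8 + i)%N by apply: mono; have := ltn_ord i; lia.
  have h4 : e (m * 8 + i)%N <= e (m * 8 + 7)%N by apply: mono; have := ltn_ord i; lia.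
  by apply: ler_pM => //; rewrite ger0_norm ?subr_ge0 ?lerD2r.
have h5 : e (m * 8).-1 <= e (m * 8)%N by apply: mono; lia.
rewrite (_ : (m * 8 + 8).-1 = (m * 8 + 7)%N); last by lia.
lra.
Qed.

Lemma pattern_sum m (e : nat -> R) :
  (forall u, (u.+1 < m * 8)%N -> e u <= e u.+1) \/
  (forall u, (u.+1 < m * 8)%N -> e u.+1 <= e u) ->
  `|\sum_(v < m * 8) rho (v %% 8)%N * e v| <= 8 * (`|e 0| + `|e (m * 8).-1|).
Proof.
have h1 := ler_norm (e 0); have h2 := ler_norm (e (m * 8).-1).
have h3 := ler_norm (- e 0); have h4 := ler_norm (- e (m * 8).-1).
rewrite !normrN in h3 h4.
case=> he; first by apply: (le_trans (pattern_sum_nondec he)); lra.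
have := @pattern_sum_nondec m (fun u => - e u).
under [X in `|X|]eq_bigr do rewrite mulrN.
rewrite sumrN normrN => h; apply: (le_trans (h _)); last by lra.
by move=> u hu; rewrite lerN2; exact: he.
Qed.
End Pattern.

Lemma wzZ_noninc (k k' : int) : 1 <= k -> k <= k' -> wz R k' <= wz R k.
Proof. by case: k k' => k [] k' // *; apply: wz_noninc; lia. Qed.

Lemma wzZ_ge0 (k : int) : 0 <= k -> 0 <= wz R k.
Proof. by case: k => // k _; apply: wz_ge0. Qed.

Lemma wz_abs_le (k : int) (n : nat) : (0 < n)%N -> (n <= `|k|)%N ->
  `|wz R k| <= wz R n%:Z.
Proof.
move=> n0 nk; case: (leP 0 k) => k0.
  by rewrite ger0_norm ?wzZ_ge0//; apply: wzZ_noninc; lia.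
have k1 : 0 <= wz R (- k) by apply: wzZ_ge0; lia.
by rewrite -[k]opprK wzN normrN ger0_norm//; apply: wzZ_noninc; lia.
Qed.

Lemma wz_neg_noninc (k k' : int) : k <= k' -> k' <= -1 -> wz R k' <= wz R k.
Proof.
move=> h1 h2; rewrite -[k]opprK -[k']opprK (wzN _ (- k)) (wzN _ (- k')) lerN2.
by apply: wzZ_noninc; lia.
Qed.

Variable m : nat.
Hypothesis m0 : (0 < m)%N.
Local Notation M := (m * 8)%N.
Local Notation LamM := (Lam R M).
Implicit Types (d : int) (phi psi : nat -> R).

(* Interaction of the patterns [phi] and [psi] on two blocks of [M] cells whose
   positions differ by [M d]. *)
Definition Kform d phi psi : R :=
  \sum_(u < M) \sum_(v < M) phi u * psi v * wz R (M%:Z * d + v%:Z - u%:Z).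

Lemma Kform_sym d phi psi : Kform d phi psi = - Kform (- d) psi phi.
Proof.
rewrite /Kform exchange_big/= -sumrN; apply: eq_bigr => v _.
rewrite -sumrN; apply: eq_bigr => u _.
rewrite [psi v * _]mulrC -[RHS]mulrN -wzN; congr (_ * wz _ _); lia.
Qed.

Lemma Kform_linr d phi (c c' : R) psi psi' :
  Kform d phi (fun v => c * psi v + c' * psi' v) =
  c * Kform d phi psi + c' * Kform d phi psi'.
Proof.
rewrite /Kform !mulr_sumr -big_split/=; apply: eq_bigr => u _.
by rewrite !mulr_sumr -big_split/=; apply: eq_bigr => v _; ring.
Qed.

Lemma Kform_linl d (c c' : R) phi phi' psi :
  Kform d (fun v => c * phi v + c' * phi' v) psi =
  c * Kform d phi psi + c' * Kform d phi' psi.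
Proof. by rewrite Kform_sym Kform_linr [in RHS]Kform_sym [Kform d phi' _]Kform_sym; ring. Qed.

Definition Srow d (v : nat) : R := \sum_(u < M) wz R (M%:Z * d + v%:Z - u%:Z).

Lemma Srow_diff d v :
  Srow d v.+1 - Srow d v = wz R (M%:Z * d + v%:Z + 1) - wz R (M%:Z * d + v%:Z + 1 - M%:Z).
Proof.
rewrite -[X in wz R X - _](_ : M%:Z * d + v%:Z + 1 - 0%N%:Z = _); last by lia.
rewrite -(telescope_ord (fun u => wz R (M%:Z * d + v%:Z + 1 - u%:Z))) -sumrB.
by apply: eq_bigr => u _; congr (wz _ _ - wz _ _); lia.
Qed.

Lemma Lam_rev : \sum_(u < M) wz R (M - u)%N%:Z = LamM.
Proof.
rewrite (reindex_inj rev_ord_inj)/=; apply: eq_bigr => u _.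
by congr (wz _ _); case: u => /= *; lia.
Qed.

Lemma sum_wz_le : \sum_(u < M) wz R u%:Z <= LamM.
Proof.
have : forall n, \sum_(u < n) wz R u%:Z <= Lam R n; last exact.
case=> [|n]; first by rewrite /Lam !big_ord0.
rewrite big_ord_recl/= wz0 add0r /Lam big_ord_recr/= lerDl.
exact: wz_ge0.
Qed.

Lemma sum_abs_far d (F : nat -> int) : d != 0 ->
  (forall u, (u < M)%N -> (1 <= d -> M%:Z - u%:Z <= F u) /\ (d <= -1 -> F u <= - (u%:Z + 1))) ->
  \sum_(u < M) `|wz R (F u)| <= LamM.
Proof.
move=> d0 hF; have [d1|d1] : 1 <= d \/ d <= -1 by lia.
  rewrite -Lam_rev; apply: ler_sum => u _.
  by have [h _] := hF u (ltn_ord u); apply: wz_abs_le; move: (h d1) (ltn_ord u); lia.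
apply: ler_sum => u _.
by have [_ h] := hF u (ltn_ord u); apply: wz_abs_le; move: (h d1) (ltn_ord u); lia.
Qed.

Lemma Md_ge d : 1 <= d -> M%:Z <= M%:Z * d. Proof. by move=> ?; nia. Qed.
Lemma Md_le d : d <= -1 -> M%:Z * d <= - M%:Z. Proof. by move=> ?; nia. Qed.

Lemma Srow_bound d v : v = 0%N \/ v = M.-1 -> `|Srow d v| <= LamM.
Proof.
move=> hv; apply: (le_trans (ler_norm_sum _ _ _)).
have [->|d0] := eqVneq d 0; last first.
  apply: (@sum_abs_far d (fun u => M%:Z * d + v%:Z - u%:Z)) => // u hu; split=> hd.
    by have := Md_ge hd; lia.
  by have := Md_le hd; lia.
case: hv => ->.
  apply: le_trans sum_wz_le; apply: ler_sum => u _.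
  rewrite (_ : M%:Z * 0 + 0%N%:Z - u%:Z = - u%:Z) ?wzN; last by lia.
  by rewrite normrN ger0_norm// wz_ge0.
apply: le_trans sum_wz_le; rewrite (reindex_inj rev_ord_inj)/=.
apply: ler_sum => u _.
have -> : M%:Z * 0 + M.-1%:Z - (M - u.+1)%N%:Z = u%:Z by have := ltn_ord u; lia.
by rewrite ger0_norm// wz_ge0.
Qed.

(** The row sums [Srow d v] are monotone in [v]: by [Srow_diff] an increment is a difference of two
    kernel values, whose sign is known because the kernel is odd and decreases on each side of 0.
    Hence only the two end rows count, each at most [Lam]. *)
Lemma Kform_1rho d (rho : nat -> R) : \sum_(c < 8) rho c = 0 -> (forall c, `|rho c| <= 1) ->
  `|Kform d (fun=> 1) (fun v => rho (v %% 8)%N)| <= 16 * LamM.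
Proof.
move=> r0 r1.
have -> : Kform d (fun=> 1) (fun v => rho (v %% 8)%N) =
    \sum_(v < M) rho (v %% 8)%N * Srow d v.
  rewrite /Kform exchange_big/=; apply: eq_bigr => v _.
  by rewrite mulr_sumr; apply: eq_bigr => u _; rewrite mul1r.
apply: (le_trans (pattern_sum r0 r1 _)); last first.
  have := @Srow_bound d 0 (or_introl erefl); have := @Srow_bound d _ (or_intror erefl); lra.
have [->|d0] := eqVneq d 0.
  left=> u hu; rewrite -subr_ge0 Srow_diff mulr0 add0r.
  rewrite [X in _ - wz _ X](_ : _ = - (M%:Z - u%:Z - 1)); last by lia.
  by rewrite wzN opprK addr_ge0// wzZ_ge0//; lia.
right=> u hu; rewrite -subr_le0 Srow_diff subr_le0.
have [d1|d1] : 1 <= d \/ d <= -1 by lia.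
  by have := Md_ge d1 => h; apply: wzZ_noninc; lia.
by have := Md_le d1 => h; apply: wz_neg_noninc; lia.
Qed.

Lemma Kform_rho1 d (rho : nat -> R) : \sum_(c < 8) rho c = 0 -> (forall c, `|rho c| <= 1) ->
  `|Kform d (fun v => rho (v %% 8)%N) (fun=> 1)| <= 16 * LamM.
Proof. by move=> r0 r1; rewrite Kform_sym normrN; exact: Kform_1rho. Qed.

(** For [d != 0] the differences of positions keep one sign, so the kernel is monotone in [v] and
    the oscillation of [rho'] leaves two end values per row. For [d = 0] this argument fails;
    [Kform_diag0] and [Kform_rq] take its place. *)
Lemma Kform_rhorho d (rho rho' : nat -> R) : d != 0 ->
  \sum_(c < 8) rho' c = 0 -> (forall c, `|rho c| <= 1) -> (forall c, `|rho' c| <= 1) ->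
  `|Kform d (fun v => rho (v %% 8)%N) (fun v => rho' (v %% 8)%N)| <= 16 * LamM.
Proof.
move=> d0 r0 r1 r1'; rewrite /Kform.
apply: (le_trans (ler_norm_sum _ _ _)).
apply: (@le_trans _ _ (\sum_(u < M) 8 * (`|wz R (M%:Z * d + 0%N%:Z - u%:Z)| +
     `|wz R (M%:Z * d + M.-1%:Z - u%:Z)|))).
  apply: ler_sum => u _.
  under eq_bigr do rewrite -mulrA.
  rewrite -mulr_sumr normrM -[leRHS]mul1r; apply: ler_pM => //.
  apply: (pattern_sum (e := fun v => wz R (M%:Z * d + v%:Z - u%:Z)) r0 r1').
  right=> v hv; have := ltn_ord u => hu.
  have [d1|d1] : 1 <= d \/ d <= -1 by lia.
    by have := Md_ge d1 => h; apply: wzZ_noninc; lia.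
  by have := Md_le d1 => h; apply: wz_neg_noninc; lia.
rewrite -mulr_sumr big_split/=.
have h1 : \sum_(u < M) `|wz R (M%:Z * d + 0%N%:Z - u%:Z)| <= LamM.
  apply: (@sum_abs_far d (fun u => M%:Z * d + 0%N%:Z - u%:Z)) => // u hu.
  by split=> hd; [have := Md_ge hd|have := Md_le hd]; lia.
have h2 : \sum_(u < M) `|wz R (M%:Z * d + M.-1%:Z - u%:Z)| <= LamM.
  apply: (@sum_abs_far d (fun u => M%:Z * d + M.-1%:Z - u%:Z)) => // u hu.
  by split=> hd; [have := Md_ge hd|have := Md_le hd]; lia.
lra.
Qed.

Lemma Kform_diag0 phi : Kform 0 phi phi = 0.
Proof. by have := Kform_sym 0 phi phi; rewrite oppr0; lra. Qed.

Lemma xlnx_scale (k : int) :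
  xlnx R (M%:Z * k) = M%:R * xlnx R k + M%:R * k%:~R * ln M%:R.
Proof.
have M0 : 0 < M%:R :> R by rewrite ltr0n; lia.
have [->|k0] := eqVneq k 0; first by rewrite mulr0 /xlnx !mul0r; ring.
have k1 : 0 < `|k%:~R : R| by rewrite normr_gt0 intr_eq0.
rewrite /xlnx rmorphM/= normrM (_ : (M%:Z)%:~R = M%:R)// normr_nat lnM ?posrE//.
by ring.
Qed.

(** Homogeneity of the kernel: constants on blocks interact like the cells of the coarser grid,
    because the terms in [ln M] cancel in the second difference. *)
Lemma Kform_11 d : Kform d (fun=> 1) (fun=> 1) = M%:R * wz R d.
Proof.
have tel (a : int) n : \sum_(v < n) wz R (a + v%:Z) =
    (xlnx R (a + n%:Z) - xlnx R (a + n%:Z - 1)) - (xlnx R a - xlnx R (a - 1)).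
  elim: n => [|n IH]; first by rewrite big_ord0 addr0 subrr.
  rewrite big_ord_recr/= IH /wz (_ : a + n.+1%:Z = a + n%:Z + 1); last by lia.
  by rewrite addrK; ring.
have tel2 (a : int) n : \sum_(u < n) (xlnx R (a - u%:Z) - xlnx R (a - u%:Z - 1)) =
    xlnx R a - xlnx R (a - n%:Z).
  elim: n => [|n IH]; first by rewrite big_ord0 subr0 subrr.
  rewrite big_ord_recr/= IH (_ : a - n%:Z - 1 = a - n.+1%:Z); last by lia.
  by ring.
rewrite /Kform; transitivity (\sum_(u < M)
   ((xlnx R (M%:Z * d + M%:Z - u%:Z) - xlnx R (M%:Z * d + M%:Z - u%:Z - 1)) -
    (xlnx R (M%:Z * d - u%:Z) - xlnx R (M%:Z * d - u%:Z - 1)))).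
  apply: eq_bigr => u _.
  transitivity (\sum_(v < M) wz R (M%:Z * d - u%:Z + v%:Z)).
    by apply: eq_bigr => v _; rewrite !mul1r; congr (wz _ _); lia.
  by rewrite tel (_ : M%:Z * d - u%:Z + M%:Z = M%:Z * d + M%:Z - u%:Z)//; lia.
rewrite sumrB !tel2 addrK.
have -> : M%:Z * d + M%:Z = M%:Z * (d + 1) by lia.
have -> : M%:Z * d - M%:Z = M%:Z * (d - 1) by lia.
rewrite !xlnx_scale /wz rmorphD rmorphB/=; ring.
Qed.
End Oscillation.

(** * One refinement of the bilinear form *)

Section Bilinear.
Variable R : realType.
Local Notation r := (rpat R).
Local Notation q := (qpat R).

Lemma rpat_sum : \sum_(c < 8) r c = 0.
Proof. by rewrite !big_ord_recl big_ord0 /= /bump /=; ring. Qed.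
Lemma qpat_sum : \sum_(c < 8) q c = 0.
Proof. by rewrite !big_ord_recl big_ord0 /= /bump /=; ring. Qed.
Lemma rpat_le1 c : `|r c| <= 1.
Proof. by move: c => [|[|[|[|[|[|c]]]]]] /=; rewrite ?normrN ?normr0 ?normr1. Qed.
Lemma qpat_le1 c : `|q c| <= 1.
Proof. by move: c => [|[|[|[|[|[|c]]]]]] /=; rewrite ?normrN ?normr0 ?normr1. Qed.

(** Interaction of one period of [rpat] with one period of [qpat] at a distance of [d] periods. *)
Definition blk (d : int) : R :=
  \sum_(c < 8) \sum_(c' < 8) r c * q c' * wz R (8 * d + c'%:Z - c%:Z).

Lemma blkE d : blk d = 3 * (wz R (8 * d + 1) - wz R (8 * d - 1))
  - (wz R (8 * d + 3) - wz R (8 * d - 3)).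
Proof.
rewrite /blk !big_ord_recl !big_ord0 /= /bump /= !(mul0r, mulr0, add0r, addr0, mul1r, mulN1r, opprK).
have e (i j : int) k : i - j = k -> 8 * d + i - j = 8 * d + k by move=> <-; rewrite addrA.
rewrite !(e 2%Z 2%Z 0)// !(e 2%Z 3%Z (-1))// !(e 2%Z 4%Z (-2))// !(e 2%Z 5%Z (-3))//.
rewrite !(e 3%Z 2%Z 1)// !(e 3%Z 3%Z 0)// !(e 3%Z 4%Z (-1))// !(e 3%Z 5%Z (-2))//.
rewrite !(e 4%Z 2%Z 2)// !(e 4%Z 3%Z 1)// !(e 4%Z 4%Z 0)// !(e 4%Z 5%Z (-1))//.
rewrite !(e 5%Z 2%Z 3)// !(e 5%Z 3%Z 2)// !(e 5%Z 4%Z 1)// !(e 5%Z 5%Z 0)//.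
ring.
Qed.

Lemma blkN d : blk (- d) = blk d.
Proof.
rewrite !blkE.
have -> : 8 * - d + 1 = - (8 * d - 1) by lia.
have -> : 8 * - d - 1 = - (8 * d + 1) by lia.
have -> : 8 * - d + 3 = - (8 * d - 3) by lia.
have -> : 8 * - d - 3 = - (8 * d + 3) by lia.
rewrite !wzN; ring.
Qed.

(** In [blkE] the difference at [8 d + 3] and [8 d - 3] has the favourable sign, and the other one
    telescopes once [8 d + 1] is replaced by [8 d + 7], both by monotonicity of [wz]. *)
Lemma blk_sum_ge n : - (3 * wz R 7) <= \sum_(k < n) blk k.+1%:Z.
Proof.
suff h : - (3 * (wz R 7 - wz R (8 * n%:Z + 7))) <= \sum_(k < n) blk k.+1%:Z.
  by apply: le_trans h; have := @wzZ_ge0 R (8 * n%:Z + 7) ltac:(lia); lra.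
elim: n => [|n IH]; first by rewrite big_ord0 mulr0 add0r subrr mulr0 oppr0.
rewrite big_ord_recr/= blkE.
have -> : 8 * n.+1%:Z - 1 = 8 * n%:Z + 7 by lia.
have h1 : wz R (8 * n.+1%:Z + 7) <= wz R (8 * n.+1%:Z + 1) by apply: wzZ_noninc; lia.
have h2 : wz R (8 * n.+1%:Z + 3) <= wz R (8 * n.+1%:Z - 3) by apply: wzZ_noninc; lia.
lra.
Qed.

(** The two half rows cost at most [6 wz 7] against the diagonal [6 wz 1 - 2 wz 3], and both [wz 3]
    and [wz 7] are at most [wz 2]. *)
Lemma blk_row_ge m k : (k < m)%N -> kst R <= \sum_(k' < m) blk (k'%:Z - k%:Z).
Proof.
move=> km.
have -> : m = (k + (1 + (m - k.+1)))%N by lia.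
rewrite !big_split_ord/= big_ord1/=.
have -> : \sum_(i < k) blk (i%:Z - k%:Z) = \sum_(i < k) blk i.+1%:Z.
  rewrite (reindex_inj rev_ord_inj)/=; apply: eq_bigr => i _.
  by rewrite -blkN; congr blk; have := ltn_ord i; lia.
have -> : \sum_(i < m - k.+1) blk ((k + (1 + i))%N%:Z - k%:Z) = \sum_(i < m - k.+1) blk i.+1%:Z.
  by apply: eq_bigr => i _; congr blk; lia.
have -> : (k + 0)%N%:Z - k%:Z = 0 by lia.
have h1 := blk_sum_ge k; have h2 := blk_sum_ge (m - k.+1).
have -> : blk 0 = 6 * wz R 1 - 2 * wz R 3.
  by rewrite blkE mulr0 !add0r !wzN; ring.
have h3 : wz R 3 <= wz R 2 by exact: wzZ_noninc.
have h4 : wz R 7 <= wz R 2 by exact: wzZ_noninc.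
rewrite /kst; lra.
Qed.

Local Notation r8 := (fun v => r (v %% 8)%N).
Local Notation q8 := (fun v => q (v %% 8)%N).

Lemma Kform_rq m : m%:R * kst R <= Kform m 0 r8 q8.
Proof.
have -> : Kform m 0 r8 q8 = \sum_(k < m) \sum_(k' < m) blk (k'%:Z - k%:Z).
  rewrite /Kform (sum_block m 8 (fun u => \sum_(v < m * 8)
     r (u %% 8)%N * q (v %% 8)%N * wz R ((m * 8)%N%:Z * 0 + v%:Z - u%:Z))).
  apply: eq_bigr => k _.
  transitivity (\sum_(c < 8) \sum_(k' < m) \sum_(c' < 8) r c * q c' *
      wz R (8 * (k'%:Z - k%:Z) + c'%:Z - c%:Z)).
    apply: eq_bigr => c _.
    rewrite (sum_block m 8 (fun v => r ((k * 8 + c) %% 8)%N * q (v %% 8)%N *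
      wz R ((m * 8)%N%:Z * 0 + v%:Z - (k * 8 + c)%N%:Z))).
    apply: eq_bigr => k' _.
    apply: eq_bigr => c' _; rewrite !modnMDl !modn_small//; congr (_ * wz _ _); lia.
  by rewrite exchange_big.
rewrite mulr_natl -{1}(card_ord m) -sumr_const.
by apply: ler_sum => k _; exact: blk_row_ge.
Qed.

(* The pairing [int (H f) g] of step functions with values [f i], [g i] on the
   cells [[i / H, (i + 1) / H]] of [[0, 1]], [H] being the Hilbert transform. *)
Definition Bf (H : nat) (f g : nat -> R) : R :=
  H%:R^-1 * \sum_(i < H) \sum_(j < H) f i * g j * wz R (j%:Z - i%:Z).

Lemma Bf_anti H f g : Bf H f g = - Bf H g f.
Proof.
rewrite /Bf exchange_big/= -mulrN -sumrN; congr (_ * _); apply: eq_bigr => i _.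
rewrite -sumrN; apply: eq_bigr => j _; rewrite [f j * _]mulrC -[RHS]mulrN -wzN.
by congr (_ * wz _ _); lia.
Qed.

(** The refined form splits into block interactions. Constants against constants reproduce
    [Bf H f g], [rpat] against [qpat] on the diagonal gives the gain, and [rpat] against itself
    vanishes there by antisymmetry. All other terms are of order [Lam], negligible against the block
    length for large [m]. *)
Lemma Bf_refine (H : nat) (f g al be de : nat -> R) (theta : R) :
  (0 < H)%N -> 0 < theta -> (forall i, 0 <= al i * de i) ->
  exists2 m, (0 < m)%N &
    Bf H f g + kst R / 8 * (H%:R^-1 * \sum_(i < H) al i * de i) - theta <=
    Bf (H * (m * 8))
      (fun i => f (i %/ (m * 8))%N + al (i %/ (m * 8))%N * r (i %% 8)%N)
      (fun i => g (i %/ (m * 8))%N + de (i %/ (m * 8))%N * q (i %% 8)%N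
                + be (i %/ (m * 8))%N * r (i %% 8)%N).
Proof.
move=> H0 t0 alde.
pose A := 1 + \sum_(i < H) (`|f i| + `|g i| + `|al i| + `|be i| + `|de i|).
have hA i : (i < H)%N -> [/\ `|f i| <= A, `|g i| <= A, `|al i| <= A, `|be i| <= A & `|de i| <= A].
  move=> hi.
  have h : `|f i| + `|g i| + `|al i| + `|be i| + `|de i| <= A - 1.
    rewrite /A [1 + _]addrC addrK (bigD1 (Ordinal hi))//= lerDl.
    by apply: sumr_ge0 => j _; rewrite !addr_ge0.
  have := normr_ge0 (f i); have := normr_ge0 (g i); have := normr_ge0 (al i).
  have := normr_ge0 (be i); have := normr_ge0 (de i) => *; split; lra.
have A0 : 0 < A.
  by rewrite /A ltr_pwDl// sumr_ge0// => i _; rewrite !addr_ge0.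
have Hr : 0 < H%:R :> R by rewrite ltr0n.
(* A pair of blocks has at most five error terms of size [16 A^2 La]: three with a constant factor
   and two off the diagonal. *)
set E := 80 * A ^+ 2 * H%:R.
have E0 : 0 < E by rewrite /E !mulr_gt0// exprn_gt0.
have [m m0 hLam] := @Lam_small R (theta / E) (divr_gt0 t0 E0).
exists m => //; rewrite mulnC in hLam.
set M := (m * 8)%N in hLam *; set La := Lam R M in hLam.
have M0 : 0 < M%:R :> R by rewrite ltr0n /M; lia.
have La0 : 0 <= La by exact: Lam_ge0.
have MdivE (I u : nat) : (u < M)%N -> ((I * M + u) %/ M)%N = I.
  by move=> hu; rewrite divnMDl ?divn_small ?addn0//; exact: leq_ltn_trans hu.
have MmodE (I u : nat) : ((I * M + u) %% 8)%N = (u %% 8)%N.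
  by rewrite /M mulnA modnMDl.
rewrite /Bf.
pose f' i := f (i %/ M)%N + al (i %/ M)%N * r (i %% 8)%N.
pose g' i := g (i %/ M)%N + de (i %/ M)%N * q (i %% 8)%N + be (i %/ M)%N * r (i %% 8)%N.
rewrite (sum_block H M (fun i => \sum_(j < H * M) f' i * g' j * wz R (j%:Z - i%:Z))).
rewrite natrM invfM.
set S := (X in _ <= _ / _ * X).
have hS : S = \sum_(I < H) \sum_(J < H) Kform m (J%:Z - I%:Z)
   (fun u => f I * 1 + al I * r (u %% 8)%N)
   (fun v => 1 * (g J * 1 + de J * q (v %% 8)%N) + be J * r (v %% 8)%N).
  rewrite /S; apply: eq_bigr => I _; rewrite /Kform [RHS]exchange_big/=.
  apply: eq_bigr => u _.
  rewrite (sum_block H M (fun j => f' (I * M + u)%N * g' j * wz R (j%:Z - (I * M + u)%N%:Z))).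
  apply: eq_bigr => J _; apply: eq_bigr => v _; rewrite /f' /g' !MdivE// !MmodE !mulr1 mul1r.
  congr (_ * wz _ _); rewrite -/M; lia.
have r0 := rpat_sum; have q0 := qpat_sum.
have small3 (a b c : R) : `|a| <= A -> `|b| <= A -> `|c| <= 16 * La -> - (16 * A ^+ 2 * La) <= a * b * c.
  move=> ha hb hc; have : `|a * b * c| <= A ^+ 2 * (16 * La).
    by rewrite !normrM expr2; apply: ler_pM => //; exact: ler_pM.
  by rewrite ler_norml => /andP[h _]; apply: le_trans h; lra.
have key (I J : 'I_H) : M%:R * (f I * g J * wz R (J%:Z - I%:Z)) +
    (if I == J then m%:R * kst R * (al I * de I) else 0) - 80 * A ^+ 2 * La <=
    Kform m (J%:Z - I%:Z)
   (fun u => f I * 1 + al I * r (u %% 8)%N)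
   (fun v => 1 * (g J * 1 + de J * q (v %% 8)%N) + be J * r (v %% 8)%N).
  have [fI gI aI bI dI] := hA I (ltn_ord I); have [fJ gJ aJ bJ dJ] := hA J (ltn_ord J).
  set d := J%:Z - I%:Z.
  have e2 phi : Kform m d phi
      (fun v => 1 * (g J * 1 + de J * q (v %% 8)%N) + be J * r (v %% 8)%N) =
      1 * (g J * Kform m d phi (fun=> 1) + de J * Kform m d phi q8) + be J * Kform m d phi r8.
    rewrite (Kform_linr m d phi 1 (be J) (fun v => g J * 1 + de J * q (v %% 8)%N) r8).
    by rewrite (Kform_linr m d phi (g J) (de J) (fun=> 1) q8).
  rewrite (Kform_linl m0 d (f I) (al I) (fun=> 1) r8) !e2 Kform_11// -/M.
  have := small3 _ _ _ fI dJ (Kform_1rho m0 d q0 qpat_le1).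
  have := small3 _ _ _ fI bJ (Kform_1rho m0 d r0 rpat_le1).
  have := small3 _ _ _ aI gJ (Kform_rho1 m0 d r0 rpat_le1).
  have : (if I == J then m%:R * kst R * (al I * de I) else 0) - 32 * A ^+ 2 * La <=
     al I * de J * Kform m d r8 q8 + al I * be J * Kform m d r8 r8.
    case: eqVneq => [e|neIJ].
      have d0 : d = 0 by rewrite /d e subrr.
      rewrite d0 (Kform_diag0 m0 r8) mulr0 addr0 -e.
      have k5 : 0 <= 32 * A ^+ 2 * La by rewrite mulr_ge0// mulr_ge0// sqr_ge0.
      apply: (@le_trans _ _ (m%:R * kst R * (al I * de I))); first by rewrite gerBl.
      by rewrite mulrC; apply: ler_wpM2l => //; exact: Kform_rq.
    have d0 : d != 0.
      by apply: contra neIJ; rewrite /d subr_eq0 eqz_nat => /eqP h; apply/eqP/val_inj.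
    have k4 := small3 _ _ _ aI dJ (Kform_rhorho m0 d0 q0 rpat_le1 qpat_le1).
    have k5 := small3 _ _ _ aI bJ (Kform_rhorho m0 d0 r0 rpat_le1 rpat_le1).
    apply: le_trans (lerD k4 k5); lra.
  set Z := (if _ then _ else _).
  have -> : f I * (1 * (g J * (M%:R * wz R d) + de J * Kform m d (fun=> 1) q8) +
       be J * Kform m d (fun=> 1) r8) +
     al I * (1 * (g J * Kform m d r8 (fun=> 1) + de J * Kform m d r8 q8) +
       be J * Kform m d r8 r8) =
     M%:R * (f I * g J * wz R d) + f I * de J * Kform m d (fun=> 1) q8 +
     f I * be J * Kform m d (fun=> 1) r8 + al I * g J * Kform m d r8 (fun=> 1) +
     (al I * de J * Kform m d r8 q8 + al I * be J * Kform m d r8 r8) by ring.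
  move: (f I * de J * _) (f I * be J * _) (al I * g J * _) (_ + al I * be J * _).
  move: (M%:R * _) Z (A ^+ 2) => x1 Z A2 x2 x3 x4 x5; lra.
have hsum : M%:R * (\sum_(I < H) \sum_(J < H) f I * g J * wz R (J%:Z - I%:Z)) +
   m%:R * kst R * (\sum_(I < H) al I * de I) - H%:R ^+ 2 * (80 * A ^+ 2 * La) <= S.
  rewrite hS; move: (80 * A ^+ 2 * La) key => c80 key.
  apply: le_trans (ler_sum _ (fun I _ => ler_sum _ (fun J _ => key I J))).
  rewrite le_eqVlt; apply/orP; left; apply/eqP.
  rewrite !mulr_sumr (_ : H%:R ^+ 2 * c80 = \sum_(I < H) \sum_(J < H) c80); last first.
    by rewrite !sumr_const !card_ord -mulrnA -[RHS]mulr_natl natrM expr2.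
  rewrite -big_split -sumrB/=; apply: eq_bigr => I _.
  rewrite sumrB big_split/=; congr (_ + _ - _); first by rewrite mulr_sumr.
  by rewrite -big_mkcond/= (eq_bigl (fun J => J == I)) ?big_pred1_eq// => J; rewrite eq_sym.
apply: (@le_trans _ _ (H%:R^-1 / M%:R * (M%:R * (\sum_(I < H) \sum_(J < H) f I * g J * wz R (J%:Z - I%:Z)) +
   m%:R * kst R * (\sum_(I < H) al I * de I) - H%:R ^+ 2 * (80 * A ^+ 2 * La)))); last first.
  by apply: ler_wpM2l => //; rewrite divr_ge0 ?invr_ge0 ?(ltW Hr) ?(ltW M0).
suff fin X Y : H%:R^-1 * X + kst R / 8 * (H%:R^-1 * Y) - theta <=
  H%:R^-1 / M%:R * (M%:R * X + m%:R * kst R * Y - H%:R ^+ 2 * (80 * A ^+ 2 * La)) by exact: fin.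
have mr : M%:R = m%:R * 8 :> R by rewrite /M natrM.
have m1 : 0 < m%:R :> R by rewrite ltr0n.
have -> : H%:R^-1 / M%:R * (M%:R * X + m%:R * kst R * Y - H%:R ^+ 2 * (80 * A ^+ 2 * La)) =
   H%:R^-1 * X + kst R / 8 * (H%:R^-1 * Y) - E * (La / M%:R).
  by rewrite mr /E; field; rewrite !gt_eqF.
rewrite lerD2l lerN2 mulrC -ler_pdivlMr// ler_pdivrMr//.
Qed.

End Bilinear.

(** * Nested intervals and slowly varying functions on them *)

Section Tree.
Variables (R : realType) (S : Type) (step : S -> nat -> S) (z0 : S) (ok : S -> bool).
Hypotheses (ok_z0 : ok z0) (ok_step : forall z c, ok z -> ok (step z c)).
Hypotheses (step0 : forall z, step z 0 = z) (step7 : forall z, step z 7 = z).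

(* Levels are listed from the finest to the coarsest; level [m] divides each
   cell into [m * 8] subcells, on which the eight moves are repeated [m] times. *)
Fixpoint Hs (ms : seq nat) : nat :=
  if ms is m :: ms' then (Hs ms' * (m * 8))%N else 1.

(** The index runs over all integers and every unit cell has the root state, so the resulting step
    functions are 1-periodic on the whole line. *)
Fixpoint st (ms : seq nat) (i : int) : S :=
  if ms is m :: ms' then step (st ms' (i %/ (m * 8)%N%:Z)%Z) `|(i %% 8)%Z| else z0.

Definition posl (ms : seq nat) : bool := all (fun m => 0 < m)%N ms.

Lemma Hs_gt0 ms : posl ms -> (0 < Hs ms)%N.
Proof. by elim: ms => //= m ms IH /andP[m0 /IH h]; rewrite !muln_gt0 h m0. Qed.

Lemma Hs_cat ms1 ms2 : Hs (ms1 ++ ms2) = (Hs ms2 * Hs ms1)%N.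
Proof. by elim: ms1 => [|m ms1 IH] /=; rewrite ?muln1 ?IH ?mulnA. Qed.

Lemma ok_st ms i : ok (st ms i).
Proof. by elim: ms i => //= m ms IH i; apply: ok_step. Qed.

Lemma st_block m ms (I : int) (u : nat) : (u < m * 8)%N ->
  st (m :: ms) (I * (m * 8)%N%:Z + u%:Z) = step (st ms I) (u %% 8)%N.
Proof.
move=> um /=; congr (step (st _ _) _); first by nia.
have -> : I * (m * 8)%N%:Z + u%:Z = (I * m%:Z) * 8 + u%:Z by lia.
by rewrite modzMDl modz_nat.
Qed.

Lemma st_adjacent ms (i : int) : posl ms -> exists z c c',
  [/\ ok z, st ms i = step z c & st ms (i + 1) = step z c'].
Proof.
elim: ms i => [|m ms IH] i; first by exists z0, 0, 0; rewrite /= step0.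
move=> /= /andP[m0 /IH{}IH].
have [e|[e1 [e2 e3]]] : ((i + 1) %/ (m * 8)%N%:Z)%Z = (i %/ (m * 8)%N%:Z)%Z \/
   [/\ ((i + 1) %/ (m * 8)%N%:Z)%Z = (i %/ (m * 8)%N%:Z)%Z + 1,
       (i %% 8)%Z = 7 & ((i + 1) %% 8)%Z = 0].
  set N := (m * 8)%N%:Z; have N0 : 0 < N by rewrite /N; lia.
  have d1 := divz_eq i N; have d2 := modz_ge0 i (lt0r_neq0 N0).
  have d3 := ltz_pmod i N0.
  case: (ltP ((i %% N)%Z + 1) N) => h; [left|right].
    rewrite {1}d1 -addrA divzMDl ?lt0r_neq0//.
    rewrite [X in _ + X]divz_small ?addr0//.
    by apply/andP; split; lia.
  have e : i = (i %/ N)%Z * N + N - 1 by lia.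
  have e2 : (i %/ N)%Z * N + N = ((i %/ N)%Z + 1) * N by ring.
  split.
  - by rewrite {1}e subrK e2 mulzK// lt0r_neq0.
  - by rewrite {1}e /N; lia.
  - by rewrite {1}e subrK /N; lia.
  by exists (st ms (i %/ (m * 8)%N%:Z)%Z), `|(i %% 8)%Z|%N, `|((i + 1) %% 8)%Z|%N; rewrite e ok_st.
by rewrite e1 e2 e3 /= step0 step7; exact: IH.
Qed.

(** The mean over the finest cells inside a coarse one is an iterate of [avg8]: repeating the eight
    moves [m] times does not change their mean. *)
Lemma sum_st_block (phi : S -> R) ms1 ms2 (I : int) :
  \sum_(u < Hs ms1) phi (st (ms1 ++ ms2) (I * (Hs ms1)%:Z + u%:Z)) =
  (Hs ms1)%:R * iter (size ms1) (avg8 step) phi (st ms2 I).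
Proof.
elim: ms1 phi I => [|m ms1 IH] phi I.
  by rewrite big_ord1 /= mulr1 addr0 mul1r.
rewrite [size _]/= iterSr.
have -> : Hs (m :: ms1) = (Hs ms1 * (m * 8))%N by [].
rewrite (sum_block (Hs ms1) (m * 8) (fun u => phi (st ((m :: ms1) ++ ms2)
   (I * (Hs ms1 * (m * 8))%N%:Z + u%:Z)))).
transitivity (\sum_(k < Hs ms1) (m * 8)%:R * avg8 step phi (st (ms1 ++ ms2) (I * (Hs ms1)%:Z + k%:Z))).
  apply: eq_bigr => k _.
  rewrite (eq_bigr (fun c : 'I_(m * 8) => phi (step (st (ms1 ++ ms2) (I * (Hs ms1)%:Z + k%:Z)) (c %% 8)%N))); last first.
    move=> c _; rewrite -(@st_block m _ _ c (ltn_ord c)) cat_cons; congr (phi (st _ _)); nia.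
  set z := st _ _; rewrite (sum_block m 8 (fun c => phi (step z (c %% 8)%N))).
  rewrite (eq_bigr (fun=> \sum_(c < 8) phi (step z c))); last first.
    by move=> k' _; apply: eq_bigr => c _; rewrite modnMDl modn_small.
  rewrite sumr_const card_ord /avg8 natrM -mulrA mulrA -[_ *+ m]mulr_natl.
  by field.
by rewrite -mulr_sumr IH mulrA -natrM mulnC.
Qed.

Lemma avg_st (phi : S -> R) ms : posl ms ->
  (Hs ms)%:R^-1 * \sum_(u < Hs ms) phi (st ms u%:Z) = iter (size ms) (avg8 step) phi z0.
Proof.
move=> /Hs_gt0 h; have := sum_st_block phi ms [::] 0; rewrite cats0 mul0r.
rewrite (eq_bigr (fun u : 'I_(Hs ms) => phi (st ms u%:Z))); last by move=> u _; rewrite add0r.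
by move=> ->; rewrite mulKf// pnatr_eq0; lia.
Qed.

Definition slow (eta : R) (psi : S -> R) : Prop := forall z, ok z ->
  0 < psi z /\ forall c, `|psi (step z c) - psi z| <= eta * psi z.

Section Slow.
Variables (eta : R) (psi : S -> R).
Hypotheses (eta0 : 0 <= eta < 1) (psis : slow eta psi).
Let rho := (1 + eta) / (1 - eta).

Lemma slow_rho_ge1 : 1 <= rho.
Proof. by case/andP: eta0 => e0 e1; rewrite ler_pdivlMr; lra. Qed.

Lemma slow_two z c c' : ok z -> psi (step z c) <= rho * psi (step z c').
Proof.
move=> oz; have [p0 h] := psis oz; have [e0 e1] := andP eta0.
have := h c; have := h c'; rewrite !ler_norml => /andP[h1 h2] /andP[h3 h4].
rewrite /rho mulrAC ler_pdivlMr; last by lra.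
have : (1 - eta) * psi z <= psi (step z c') by lra.
have : psi (step z c) <= (1 + eta) * psi z by lra.
nra.
Qed.

Lemma slow_adj ms (i : int) : posl ms ->
  psi (st ms i) <= rho * psi (st ms (i + 1)) /\ psi (st ms (i + 1)) <= rho * psi (st ms i).
Proof.
move=> hms; have [z [c [c' [oz -> ->]]]] := st_adjacent i hms.
by split; exact: slow_two.
Qed.

Lemma slow_near ms (i j : int) (n : nat) : posl ms -> (`|i - j| <= n)%N ->
  psi (st ms i) <= rho ^+ n * psi (st ms j).
Proof.
move=> hms; have r1 := slow_rho_ge1.
have pos k : 0 < psi (st ms k) by have [] := psis (ok_st ms k).
elim: n i => [|n IH] i hij.
  by have -> : i = j; [lia|rewrite expr0 mul1r].
have [ij|[ij|ij]] : i = j \/ i < j \/ j < i by lia.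
- by rewrite ij ler_peMl ?(ltW (pos _))// exprn_ege1.
- have [h _] := slow_adj i hms; apply: (le_trans h); rewrite exprS -mulrA.
  by apply: ler_wpM2l; [lra|apply: IH; lia].
have [_ h] := slow_adj (i - 1) hms; rewrite subrK in h.
apply: (le_trans h); rewrite exprS -mulrA.
by apply: ler_wpM2l; [lra|apply: IH; lia].
Qed.

(** The exponent counts the passage to the parent, [n] steps between parents, and the passage back
    down. It does not depend on [m], which is arbitrarily large. *)
Lemma slow_near_children m ms (i j : int) (n : nat) : posl (m :: ms) ->
  (`|(i %/ (m * 8)%N%:Z)%Z - (j %/ (m * 8)%N%:Z)%Z| <= n)%N ->
  psi (st (m :: ms) i) <= rho ^+ n.+2 * psi (st (m :: ms) j).
Proof.
move=> /= /andP[m0 hms] hij; have r1 := slow_rho_ge1.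
have h1 z c : ok z -> psi (step z c) <= rho * psi z.
  by move=> oz; rewrite -{2}(step0 z); exact: slow_two.
have h2 z c : ok z -> psi z <= rho * psi (step z c).
  by move=> oz; rewrite -{1}(step0 z); exact: slow_two.
apply: (le_trans (h1 _ _ (ok_st _ _))).
rewrite exprS -mulrA; apply: ler_wpM2l; first by lra.
apply: (le_trans (slow_near hms hij)); rewrite exprSr -mulrA.
by apply: ler_wpM2l; [rewrite exprn_ge0//; lra|apply: h2; exact: ok_st].
Qed.
End Slow.

Lemma scale_split (K len : R) ms : posl ms ->
  len * (Hs ms)%:R < K \/
  exists ms1 ms2, [/\ ms = ms1 ++ ms2, K <= len * (Hs ms2)%:R &
    (ms2 = [::] \/ exists m ms3, ms2 = m :: ms3 /\ len * (Hs ms3)%:R < K)].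
Proof.
elim: ms => [|m ms IH] hms.
  case: (ltP (len * (Hs [::])%:R) K) => h; [by left|right].
  by exists [::], [::]; split=> //; left.
case: (ltP (len * (Hs (m :: ms))%:R) K) => h; [by left|right].
have [|h1|[ms1 [ms2 [e h1 h2]]]] := IH; first by case/andP: hms.
  by exists [::], (m :: ms); split=> //; right; exists m, ms.
by exists (m :: ms1), ms2; split=> //; rewrite e.
Qed.

End Tree.

(** * Masses of bounded functions and of step functions *)

Section BoundedMass.
Variables (R : realType) (f : R -> R) (B : R).
Hypotheses (mf : measurable_fun setT f) (fB : forall x, `|f x| <= B).
Local Notation leb := (@lebesgue_measure R).

Lemma bounded_integrable (D : set R) : measurable D -> (leb D < +oo)%E ->
  leb.-integrable D (EFin \o f).
Proof.
move=> mD fD; apply: measurable_bounded_integrable => //.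
  exact: (measurable_funS measurableT).
exists B; split; first exact: num_real.
by move=> M BM x _ /=; apply: (le_trans (fB x)); exact: ltW.
Qed.

Lemma itv_finite (a b : R) (p q : bool) :
  (leb [set` Interval (BSide p a) (BSide q b)] < +oo)%E.
Proof. by rewrite lebesgue_measure_itv/=; case: ifP => _; rewrite ?ltry. Qed.

Definition mass (a b : R) : R := \int[leb]_(x in `[a, b]) f x.

Lemma weight_massE a b : weight_mass f a b = (mass a b)%:E.
Proof.
rewrite /weight_mass /mass /Rintegral fineK//.
apply: integrable_fin_num => //.
exact: (bounded_integrable (measurable_itv _) (itv_finite _ _ _ _)).
Qed.

Lemma mass_add a b c : a <= b -> b <= c -> mass a c = mass a b + mass b c.
Proof.
move=> ab bc; rewrite /mass.
have h := @Rintegral_itvB R f (BLeft a) (BRight c) b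
  (bounded_integrable (measurable_itv _) (itv_finite _ _ _ _)).
rewrite -(@Rintegral_itv_obnd_cbnd R b (BRight c)); last first.
  exact: (bounded_integrable (measurable_itv _) (itv_finite _ _ _ _)).
by rewrite -h ?bnd_simp// addrC subrK.
Qed.

Lemma mass_co a b : mass a b = \int[leb]_(x in `[a, b[) f x.
Proof.
rewrite /mass Rintegral_itv_bndo_bndc//.
exact: (bounded_integrable (measurable_itv _) (itv_finite _ _ _ _)).
Qed.

Lemma Rintegral_cst_co (C a b : R) : a <= b ->
  \int[leb]_(x in `[a, b[) C = C * (b - a).
Proof.
move=> ab; rewrite Rintegral_cst//; congr (_ * _).
have -> : b - a = fine (if a < b then (b - a)%:E else 0%:E).
  by move: ab; rewrite le_eqVlt => /orP[/eqP ->|->]; rewrite ?ltxx ?subrr.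
by congr fine; apply: (etrans (lebesgue_measure_itv _)); rewrite /= lte_fin.
Qed.

Lemma cst_integrable_co (C a b : R) : leb.-integrable `[a, b[ (EFin \o cst C).
Proof.
apply: measurable_bounded_integrable => //; first exact: itv_finite.
by apply: bounded_cst.
Qed.

Lemma mass_le (C a b : R) : a <= b -> (forall x, a <= x < b -> f x <= C) ->
  mass a b <= C * (b - a).
Proof.
move=> ab h; rewrite mass_co -Rintegral_cst_co//; apply: le_Rintegral => //.
- exact: (bounded_integrable (measurable_itv _) (itv_finite _ _ _ _)).
- exact: cst_integrable_co.
Qed.

Lemma mass_ge (C a b : R) : a <= b -> (forall x, a <= x < b -> C <= f x) ->
  C * (b - a) <= mass a b.
Proof.
move=> ab h; rewrite mass_co -Rintegral_cst_co//; apply: le_Rintegral => //.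
- exact: cst_integrable_co.
- exact: (bounded_integrable (measurable_itv _) (itv_finite _ _ _ _)).
Qed.

Lemma mass_ge0 a b : (forall x, 0 <= f x) -> 0 <= mass a b.
Proof. by move=> h; apply: Rintegral_ge0. Qed.

End BoundedMass.

Section StepFunction.
Variables (R : realType) (H : nat) (V : int -> R) (B : R).
Hypotheses (H0 : (0 < H)%N) (VB : forall i, `|V i| <= B).

Definition sf (x : R) : R := V (Num.floor (x * H%:R)).

Lemma sf_bound x : `|sf x| <= B. Proof. exact: VB. Qed.

Let Hr : 0 < H%:R :> R. Proof. by rewrite ltr0n. Qed.

Lemma sf_cell (i : int) (x : R) : i%:~R / H%:R <= x < (i + 1)%:~R / H%:R -> sf x = V i.
Proof.
rewrite ler_pdivrMr// ltr_pdivlMr// => h.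
by rewrite /sf; congr V; apply/eqP; rewrite floor_eq.
Qed.

Lemma measurable_sf : measurable_fun setT sf.
Proof.
move=> _ Y mY; rewrite setTI.
have -> : (sf @^-1` Y = \bigcup_(i in [set i | Y (V i)])
    `[(i%:~R / H%:R : R), ((i + 1)%:~R / H%:R : R)[)%classic.
  apply/seteqP; split=> x /=.
    move=> hx; exists (Num.floor (x * H%:R)) => //.
    by rewrite /= in_itv/= ler_pdivrMr// ltr_pdivlMr//; exact: floor_itv.
  by case=> i /= hY; rewrite in_itv/= => hx; rewrite (sf_cell hx).
rewrite bigcup_mkcond; apply: countable_bigcupT_measurable => [|i]; first exact: countableP.
by case: ifP => // _; exact: measurable_itv.
Qed.

Lemma mass_cell (i : int) : mass sf (i%:~R / H%:R) ((i + 1)%:~R / H%:R) = V i / H%:R.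
Proof.
have e : (i + 1)%:~R / H%:R - i%:~R / H%:R = H%:R^-1 :> R.
  by rewrite -mulrBl intrD addrC addKr mul1r.
have le : i%:~R / H%:R <= (i + 1)%:~R / H%:R :> R.
  by rewrite -subr_ge0 e invr_ge0 ltW.
have -> : V i / H%:R = V i * ((i + 1)%:~R / H%:R - i%:~R / H%:R) by rewrite e.
apply/eqP; rewrite eq_le; apply/andP; split.
  by apply: (mass_le measurable_sf sf_bound) => // x hx; rewrite (sf_cell hx).
by apply: (mass_ge measurable_sf sf_bound) => // x hx; rewrite (sf_cell hx).
Qed.

Lemma mass_cells (i : int) (n : nat) :
  mass sf (i%:~R / H%:R) ((i + n%:Z)%:~R / H%:R) = (\sum_(u < n) V (i + u%:Z)) / H%:R.
Proof.
elim: n => [|n IH].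
  rewrite big_ord0 mul0r addr0; apply/eqP; rewrite eq_le.
  have h1 := mass_le measurable_sf sf_bound (lexx (i%:~R / H%:R)) (C := B)
    (fun x _ => le_trans (ler_norm _) (sf_bound x)).
  have h2 := mass_ge measurable_sf sf_bound (lexx (i%:~R / H%:R)) (C := - B).
  rewrite subrr !mulr0 in h1 h2; rewrite h1 h2// => x _.
  by have := sf_bound x; rewrite ler_norml => /andP[].
have mono (j k : int) : j <= k -> j%:~R / H%:R <= k%:~R / H%:R :> R.
  by move=> jk; rewrite ler_pM2r ?invr_gt0// ler_int.
rewrite (mass_add measurable_sf sf_bound (b := (i + n%:Z)%:~R / H%:R)); last 2 first.
- by apply: mono; lia.
- by apply: mono; lia.
rewrite IH (_ : i + n.+1%:Z = i + n%:Z + 1); last by lia.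
by rewrite mass_cell big_ord_recr/= mulrDl.
Qed.

End StepFunction.

Lemma mass_sub (R : realType) (f : R -> R) (B u v u' v' : R) :
  measurable_fun setT f -> (forall x, `|f x| <= B) -> (forall x, 0 <= f x) ->
  u' <= u -> u <= v -> v <= v' -> mass f u v <= mass f u' v'.
Proof.
move=> mf fB f0 h1 h2 h3.
rewrite (mass_add mf fB h1 (le_trans h2 h3)) (mass_add mf fB h2 h3).
by have := mass_ge0 u' u f0; have := mass_ge0 v v' f0; lra.
Qed.

Lemma absz_near (i j : int) (K : nat) : j <= i -> i - j < K.+1%:Z ->
  (`|i - j| <= K)%N /\ (`|j - i| <= K)%N.
Proof. by lia. Qed.

Lemma absz_divz_near (i j : int) (K N : nat) : (0 < N)%N -> j <= i ->
  i - j <= K%:Z * N%:Z ->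
  (`|(i %/ N%:Z)%Z - (j %/ N%:Z)%Z| <= K)%N /\ (`|(j %/ N%:Z)%Z - (i %/ N%:Z)%Z| <= K)%N.
Proof.
move=> N0 ji h; have N1 : (0 : int) < N%:Z by lia.
have h1 : (i %/ N%:Z)%Z <= K%:Z + (j %/ N%:Z)%Z.
  have := divz_eq i N%:Z; have := divz_eq j N%:Z.
  have := modz_ge0 i (lt0r_neq0 N1); have := ltz_pmod j N1; nia.
have h2 : (j %/ N%:Z)%Z <= (i %/ N%:Z)%Z.
  have := divz_eq i N%:Z; have := divz_eq j N%:Z.
  have := modz_ge0 j (lt0r_neq0 N1); have := ltz_pmod i N1; nia.
by apply: absz_near => //; lia.
Qed.

(** * Masses of the tree weights at every scale *)

Section MassScale.
Variables (R : realType) (S : Type) (step : S -> nat -> S) (z0 : S) (ok : S -> bool).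
Hypotheses (ok_z0 : ok z0) (ok_step : forall z c, ok z -> ok (step z c)).
Hypotheses (step0 : forall z, step z 0 = z) (step7 : forall z, step z 7 = z).
Local Notation st := (st step z0).
Local Notation avg8 := (@avg8 R S step).

Definition wt (phi : S -> R) (ms : seq nat) : R -> R :=
  sf (Hs ms) (fun i => phi (st ms i)).

Lemma st_bounded (phi : S -> R) ms : exists B, forall i, `|phi (st ms i)| <= B.
Proof.
elim: ms phi => [|m ms IH] phi; first by exists `|phi z0|.
have [B hB] := IH (fun z => \sum_(c < 8) `|phi (step z c)|).
exists B => i; apply: le_trans (hB (i %/ (m * 8)%N%:Z)%Z).
have h8 : (`|(i %% 8)%Z| < 8)%N by have := @ltz_pmod i 8 isT; have := @modz_ge0 i 8 isT; lia.
rewrite [leRHS]ger0_norm ?sumr_ge0//= (bigD1 (Ordinal h8))//= lerDl.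
exact: sumr_ge0.
Qed.

Variables (ms : seq nat) (eta : R) (K : nat).
Hypotheses (msp : posl ms) (eta0 : 0 <= eta < 1) (K4 : (4 <= K)%N).
Let rho : R := (1 + eta) / (1 - eta).
Let C : R := rho ^+ K.+2.

Lemma mass_coarse (phi : S -> R) ms1 ms2 (I : int) (n : nat) : ms = ms1 ++ ms2 ->
  mass (wt phi ms) (I%:~R / (Hs ms2)%:R) ((I + n%:Z)%:~R / (Hs ms2)%:R) =
  (\sum_(k < n) iter (size ms1) avg8 phi (st ms2 (I + k%:Z))) / (Hs ms2)%:R.
Proof.
move=> e; have [B hB] := st_bounded phi ms.
have Hp := Hs_gt0 msp.
have [h1 h2] : (0 < Hs ms1)%N /\ (0 < Hs ms2)%N.
  by move: Hp; rewrite e Hs_cat muln_gt0 => /andP[].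
have r1 : (Hs ms1)%:R != 0 :> R by rewrite pnatr_eq0; lia.
have r2 : (Hs ms2)%:R != 0 :> R by rewrite pnatr_eq0; lia.
have hx (j : int) : j%:~R / (Hs ms2)%:R = (j * (Hs ms1)%:Z)%:~R / (Hs ms)%:R :> R.
  rewrite e Hs_cat natrM intrM (_ : (Hs ms1)%:Z%:~R = (Hs ms1)%:R)//.
  by field; rewrite r1 r2.
rewrite !hx (_ : (I + n%:Z) * (Hs ms1)%:Z = I * (Hs ms1)%:Z + (n * Hs ms1)%N%:Z); last by lia.
rewrite (mass_cells Hp hB).
rewrite (sum_block n (Hs ms1) (fun u => phi (st ms (I * (Hs ms1)%:Z + u%:Z)))).
rewrite (eq_bigr (fun k : 'I_n => (Hs ms1)%:R * iter (size ms1) avg8 phi (st ms2 (I + k%:Z)))); last first.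
  move=> k _; rewrite -(sum_st_block step ok_z0 phi ms1 ms2) -e; apply: eq_bigr => u _.
  by congr (phi (st _ _)); lia.
rewrite -mulr_sumr e Hs_cat natrM; field; by rewrite r1 r2.
Qed.

(** One pair [(k, z)] serves every [phi] and every subinterval of at least half the length. The
    first uniformity allows a weight and its dual to be multiplied, the second compares an interval
    with its double. *)
Lemma mass_scale (x y : R) : x < y -> exists (k : nat) z, ok z /\
  forall phi : S -> R, (forall k', slow step ok eta (iter k' avg8 phi)) ->
  forall u v, x <= u -> v <= y -> (y - x) / 2 <= v - u ->
    (v - u) * ((1 - 4 / K%:R) / C) * iter k avg8 phi z <= mass (wt phi ms) u v /\
    mass (wt phi ms) u v <= (v - u) * ((1 + 4 / K%:R) * C) * iter k avg8 phi z.
Proof.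
move=> xy; set len := y - x; have len0 : 0 < len by rewrite subr_gt0.
have rho1 : 1 <= rho := slow_rho_ge1 eta0.
have C1 : 1 <= C by rewrite exprn_ege1.
have K0 : 4 <= K%:R :> R by rewrite (ler_nat _ 4).
have kk : 0 <= 4 / (K%:R : R) <= 1.
  by apply/andP; split; [rewrite divr_ge0|rewrite ler_pdivrMr; lra].
have i0P H (i : int) : i%:~R <= y * H%:R ->
    (i - Num.floor (x * H%:R))%:~R < len * H%:R + 1.
  move=> hi; have /andP[_ f2] := floor_itv (x * H%:R).
  by rewrite intrB /len; rewrite intrD in f2; lra.
(* A window shorter than [K] finest cells sees a nearly constant weight, and [k = 0]. Otherwise the
   comparison takes place at the coarsest level with at least [K] cells in the window. *)
case: (scale_split K%:R len msp) => [hlen|[ms1 [ms2 [e hK hcl]]]].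
  exists 0, (st ms (Num.floor (x * (Hs ms)%:R))); split.
    exact: ok_st.
  move=> phi hphi u v xu vy huv /=.
  have [B hB] := st_bounded phi ms; have Hp := Hs_gt0 msp.
  have Hr : 0 < (Hs ms)%:R :> R by rewrite ltr0n.
  have sl := hphi 0; rewrite /= in sl.
  set z := st ms _; have [pz _] := sl z (ok_st ok_z0 ok_step ms _).
  have uv : u <= v by rewrite -subr_ge0; apply: le_trans huv; rewrite divr_ge0// ltW.
  have near t : u <= t < v -> wt phi ms t <= C * phi z /\ phi z <= C * wt phi ms t.
    move=> /andP[ut tv]; rewrite /wt /sf; set i := Num.floor _.
    have hi : i%:~R <= y * (Hs ms)%:R.
      have /andP[f1 _] := floor_itv (t * (Hs ms)%:R).
      by apply: (le_trans f1); rewrite ler_pM2r//; lra.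
    have i1 : Num.floor (x * (Hs ms)%:R) <= i by apply: le_floor; rewrite ler_pM2r//; lra.
    have hK : (i - Num.floor (x * (Hs ms)%:R)) < (K.+1)%:Z.
      rewrite -(ltr_int R); apply: (lt_trans (i0P _ _ hi)).
      by rewrite (_ : K.+1%:Z%:~R = K%:R + 1) ?natr1//; lra.
    have CK : rho ^+ K <= C by rewrite /C; apply: ler_weXn2l => //; rewrite !leqW.
    have pi : 0 < phi (st ms i) by have [] := sl _ (ok_st ok_z0 ok_step ms i).
    have [k1 k2] := absz_near i1 hK.
    split.
      apply: (le_trans (slow_near ok_z0 ok_step step0 step7 eta0 sl msp k1)).
      by rewrite ler_pM2r.
    apply: (le_trans (slow_near ok_z0 ok_step step0 step7 eta0 sl msp k2)).
    by rewrite ler_pM2r.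
  have C0 : 0 < C by lra.
  have mw : measurable_fun setT (wt phi ms) by apply: measurable_sf.
  have bw : forall t, `|wt phi ms t| <= B by move=> t; exact: hB.
  split.
    have h : forall t, u <= t < v -> phi z / C <= wt phi ms t.
      by move=> t /near[_]; rewrite ler_pdivrMr// mulrC.
    apply: le_trans (mass_ge mw bw uv h).
    rewrite mulrC -[leRHS]mulrA [C^-1 * _]mulrC ler_pM2l//.
    rewrite ler_wpM2l ?subr_ge0//.
    by rewrite ler_piMl ?invr_ge0 ?(ltW C0)//; lra.
  have h : forall t, u <= t < v -> wt phi ms t <= C * phi z by move=> t /near[].
  apply: (le_trans (mass_le mw bw uv h)).
  have -> : C * phi z * (v - u) = (v - u) * (1 * C) * phi z by ring.
  rewrite ler_pM2r// ler_wpM2l ?subr_ge0// ler_wpM2r ?(ltW C0)//.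
  by case/andP: kk; lra.
set H := Hs ms2 in hK.
have ms2p : posl ms2 by move: msp; rewrite e /posl all_cat => /andP[].
have Hp : (0 < H)%N := Hs_gt0 ms2p.
have Hr : 0 < H%:R :> R by rewrite ltr0n.
set i0 := Num.floor (x * H%:R).
exists (size ms1), (st ms2 i0); split; first exact: ok_st.
move=> phi hphi u v xu vy huv; set psi := iter _ _ _; set z := st ms2 i0.
have sl := hphi (size ms1); rewrite -/psi in sl.
have [B hB] := st_bounded phi ms; have Hmsp := Hs_gt0 msp.
have pos i : 0 < psi (st ms2 i) by have [] := sl _ (ok_st ok_z0 ok_step ms2 i).
have pz : 0 < psi z by exact: pos.
have f0 t : 0 <= wt phi ms t.
  have sl0 := hphi 0; rewrite /= in sl0.
  by rewrite /wt /sf ltW//; have [] := sl0 _ (ok_st ok_z0 ok_step ms (Num.floor (t * (Hs ms)%:R))).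
have uv : u <= v by rewrite -subr_ge0; apply: le_trans huv; rewrite divr_ge0// ltW.
have near (i : int) : i0 <= i -> i%:~R <= y * H%:R ->
    psi (st ms2 i) <= C * psi z /\ psi z <= C * psi (st ms2 i).
  (* At the root all cells have the same state; otherwise the parents of the cells in the window are
     at most [K] places apart. *)
  move=> i1 hi; case: hcl => [e2|[m [ms3 [e2 hK3]]]].
    have hh : psi (st ms2 i) = psi z by rewrite /z e2.
    by rewrite hh ler_peMl ?(ltW pz).
  have M0 : (0 < m)%N by move: ms2p; rewrite e2 => /andP[].
  have h := i0P _ _ hi; rewrite -/i0 in h.
  have N0 : (0 < m * 8)%N by rewrite muln_gt0 M0.
  have hd : i - i0 <= K%:Z * (m * 8)%N%:Z.
    rewrite -ltzD1 -(ltr_int R); apply: (lt_le_trans h).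
    rewrite intrD intrM lerD2r /H e2 /= natrM mulrA.
    rewrite (_ : (m * 8)%N%:Z%:~R = (m * 8)%:R)// ler_pM2r; first exact: ltW.
    by rewrite ltr0n.
  have [k1 k2] := absz_divz_near N0 i1 hd.
  rewrite /z e2; rewrite e2 in ms2p.
  by split; exact: (slow_near_children ok_z0 ok_step step0 step7 eta0 sl ms2p).
set p := Num.floor (u * H%:R); set q := Num.floor (v * H%:R).
have /andP[p1 p2] := floor_itv (u * H%:R); have /andP[q1 q2] := floor_itv (v * H%:R).
rewrite -/p in p1 p2; rewrite -/q in q1 q2.
have i0p : i0 <= p by apply: le_floor; rewrite ler_pM2r.
have pq : p <= q by apply: le_floor; rewrite ler_pM2r.
have qy : q%:~R <= y * H%:R by apply: (le_trans q1); rewrite ler_pM2r.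
have hH : H%:R^-1 <= len / K%:R.
  by rewrite ler_pdivlMr; [rewrite mulrC ler_pdivrMr|lra].
(* The two incomplete end cells have total length at most [2 / H]; the 4 reflects that [v - u] may
   be only half of [len]. *)
have hH2 : 2 / H%:R <= 4 / K%:R * (v - u).
  apply: (@le_trans _ _ (2 * (len / K%:R))); first by rewrite ler_pM2l.
  have -> : 2 * (len / K%:R) = 4 / K%:R * (len / 2) by field; lra.
  by apply: ler_wpM2l => //; case/andP: kk.
rewrite !intrD in p2 q2.
clearbody p q.
have mw : measurable_fun setT (wt phi ms) by apply: measurable_sf.
have bw : forall t, `|wt phi ms t| <= B by move=> t; exact: hB.
have C0 : 0 < C by lra.
split.
  apply: (@le_trans _ _ ((q - p - 1)%:~R / H%:R * (psi z / C))).
    rewrite mulrA -mulrA [_ / C]mulrC mulrA [_ * C^-1]mulrC.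
    rewrite [X in _ <= _ * X]mulrC mulrA [leLHS]mulrC -mulrA [leRHS]mulrC -[leRHS]mulrA.
    rewrite !ler_pM2l ?invr_gt0// !intrB.
    have : (q%:~R - p%:~R - 1) / H%:R >= (v - u) - 2 / H%:R.
      rewrite ler_pdivlMr// mulrBl mulfVK ?gt_eqF//; lra.
    by rewrite mulrBr mulr1; lra.
  case: (leP (p + 1) q) => pq1; last first.
    apply: (@le_trans _ _ 0); last exact: mass_ge0.
    rewrite mulr_le0_ge0//; last by rewrite divr_ge0// ltW.
    by rewrite mulr_le0_ge0 ?invr_ge0 ?(ltW Hr)// (ler_int _ _ 0); move: pq1; clear; lia.
  have [n hn] : exists n : nat, q = p + 1 + n%:Z by exists `|(q - p - 1)%R|%N; move: pq1; clear; lia.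
  apply: (@le_trans _ _ (mass (wt phi ms) ((p + 1)%:~R / H%:R) (q%:~R / H%:R))).
    rewrite hn (mass_coarse phi (p + 1) n e) -/psi -/H mulrAC ler_pM2r ?invr_gt0//.
    rewrite (_ : (_ - p - 1)%:~R = n%:R); last by rewrite (_ : _ - p - 1 = n%:Z)//; clear; lia.
    have -> : n%:R * (psi z / C) = \sum_(k < n) (psi z / C).
      by rewrite sumr_const card_ord mulr_natl.
    apply: ler_sum => k _.
    rewrite ler_pdivrMr// mulrC.
    have kn := ltn_ord k.
    have [] := near (p + 1 + k%:Z) _ _ => //; first by move: i0p; clear; lia.
    by apply: le_trans qy; rewrite ler_int; move: hn kn; clear; lia.
  apply: (mass_sub mw bw f0).
  - by rewrite ler_pdivlMr// intrD; lra.
  - by rewrite ler_pM2r ?invr_gt0// ler_int.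
  - by rewrite ler_pdivrMr.
have [n hn] : exists n : nat, q + 1 = p + n%:Z by exists `|(q + 1 - p)%R|%N; move: pq; clear; lia.
apply: (@le_trans _ _ (mass (wt phi ms) (p%:~R / H%:R) ((q + 1)%:~R / H%:R))).
  apply: (mass_sub mw bw f0) => //.
  - by rewrite ler_pdivrMr.
  - by rewrite ler_pdivlMr// intrD; lra.
rewrite hn (mass_coarse phi p n e) -/psi -/H.
apply: (@le_trans _ _ (n%:R / H%:R * (C * psi z))).
  have -> : n%:R / H%:R * (C * psi z) = (\sum_(k < n) (C * psi z)) / H%:R.
    by rewrite sumr_const card_ord -[C * psi z *+ n]mulr_natl mulrAC.
  rewrite ler_pM2r ?invr_gt0//.
  apply: ler_sum => k _; have kn := ltn_ord k.
  have [] := near (p + k%:Z) _ _ => //; first by move: i0p; clear; lia.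
  by apply: le_trans qy; rewrite ler_int; move: hn kn; clear; lia.
have -> : n%:R = q%:~R + 1 - p%:~R :> R.
  have : (q + 1)%:~R = (p + n%:Z)%:~R :> R by rewrite hn.
  by rewrite !intrD (_ : n%:Z%:~R = n%:R)//; lra.
have -> : (v - u) * ((1 + 4 / K%:R) * C) * psi z =
    (v - u + 4 / K%:R * (v - u)) * (C * psi z) by ring.
apply: ler_wpM2r; first by rewrite mulr_ge0 ?ltW.
rewrite ler_pdivrMr//.
have h2 : 2 <= 4 / K%:R * (v - u) * H%:R by rewrite -ler_pdivrMr.
by rewrite mulrDl; lra.
Qed.

End MassScale.

(** * Explicit integrals of the Cauchy kernel and of the logarithm *)

Section ExplicitIntegrals.
Local Open Scope classical_set_scope.
Local Open Scope ring_scope.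
Variable R : realType.
Local Notation leb := (@lebesgue_measure R).
Implicit Types a b c x y t : R.

Lemma Rintegral_FTC (f F : R -> R) a b : a <= b ->
  (forall t, a <= t <= b -> is_derive t 1 F (f t)) ->
  (forall t, a <= t <= b -> derivable f t 1) ->
  leb.-integrable `[a, b] (EFin \o f) /\ \int[leb]_(t in `[a, b]) f t = F b - F a.
Proof.
move=> ab dF df.
have cf : {within `[a, b], continuous f}%classic.
  apply: derivable_within_continuous => t; rewrite in_itv/= => ht; exact: df.
have intf : leb.-integrable `[a, b] (EFin \o f).
  by apply: continuous_compact_integrable => //; exact: segment_compact.
split=> //; move: ab; rewrite le_eqVlt => /orP[/eqP ab|ab].
  by rewrite -ab set_itv1 Rintegral_set1 subrr.
rewrite /Rintegral (@continuous_FTC2 R f F a b ab cf)//.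
  have ctsF t : a <= t <= b -> {for t, continuous F}.
    move=> ht; apply: differentiable_continuous; apply/derivable1_diffP.
    by have [] := dF t ht.
  split.
  - move=> t; rewrite in_itv/= => /andP[h1 h2].
    by have [] : is_derive t 1 F (f t) by apply: dF; rewrite !ltW.
  - by apply: cvg_at_right_filter; apply: ctsF; rewrite lexx ltW.
  - by apply: cvg_at_left_filter; apply: ctsF; rewrite lexx ltW.
move=> t; rewrite in_itv/= => /andP[h1 h2].
rewrite derive1E; have h : is_derive t 1 F (f t) by apply: dF; rewrite !ltW.
by rewrite derive_val.
Qed.

Lemma is_derive_lnB c t : t < c -> is_derive t 1 (fun s : R => ln (c - s)) (- (c - t)^-1).
Proof.
move=> tc; have ct : 0 < c - t by rewrite subr_gt0.
have h1 : is_derive t 1 (fun s : R => c - s) (- 1).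
  have : is_derive t 1 (cst c - (fun s : R => s)) (0 - 1) by apply: is_deriveB.
  by rewrite sub0r.
have h := is_derive1_ln ct.
have := @is_derive1_comp R (@ln R) (fun s : R => c - s) t _ _ h h1.
by rewrite mulrN mulr1.
Qed.

Lemma is_derive_lnD c t : c < t -> is_derive t 1 (fun s : R => ln (s - c)) ((t - c)^-1).
Proof.
move=> tc; have ct : 0 < t - c by rewrite subr_gt0.
have h1 : is_derive t 1 (fun s : R => s - c) 1.
  have : is_derive t 1 ((fun s : R => s) - cst c) (1 - 0) by apply: is_deriveB.
  by rewrite subr0.
have h := is_derive1_ln ct.
have := @is_derive1_comp R (@ln R) (fun s : R => s - c) t _ _ h h1.
by rewrite mulr1.
Qed.

Lemma derivable_invB c t : t != c -> derivable (fun s : R => (c - s)^-1) t 1.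
Proof.
move=> tc; apply: (@derivableV R R^o (fun s : R => c - s)).
  by rewrite subr_eq0 eq_sym.
by apply: derivableB.
Qed.

Lemma cauchy_left x a b : a <= b -> b < x ->
  leb.-integrable `[a, b] (EFin \o (fun y => (x - y)^-1)) /\
  \int[leb]_(y in `[a, b]) (x - y)^-1 = ln (x - a) - ln (x - b).
Proof.
move=> ab bx.
have [] := @Rintegral_FTC (fun y => (x - y)^-1) (- (fun y => ln (x - y))) a b ab.
- move=> t /andP[h1 h2]; have tx : t < x by exact: le_lt_trans bx.
  by have := is_deriveN (is_derive_lnB tx); rewrite opprK.
- move=> t /andP[h1 h2]; apply: derivable_invB; rewrite lt_eqF//; exact: le_lt_trans bx.
move=> h1 ->; split=> //; rewrite !opprfctE; ring.
Qed.

Lemma cauchy_right x a b : a <= b -> x < a ->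
  leb.-integrable `[a, b] (EFin \o (fun y => (x - y)^-1)) /\
  \int[leb]_(y in `[a, b]) (x - y)^-1 = ln (a - x) - ln (b - x).
Proof.
move=> ab bx.
have [] := @Rintegral_FTC (fun y => (x - y)^-1) (- (fun y => ln (y - x))) a b ab.
- move=> t /andP[h1 h2]; have tx : x < t by exact: lt_le_trans h1.
  by have := is_deriveN (is_derive_lnD tx); rewrite -invrN opprB.
- move=> t /andP[h1 h2]; apply: derivable_invB; rewrite gt_eqF//; exact: lt_le_trans h1.
move=> h1 ->; split=> //; rewrite !opprfctE; ring.
Qed.

Definition xln (t : R) : R := t * ln `|t|.

Lemma ln_abs_integral (a c d : R) : c <= d -> d < a \/ a < c ->
  leb.-integrable `[c, d] (EFin \o (fun t => ln `|t - a|)) /\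
  \int[leb]_(t in `[c, d]) ln `|t - a| = xln (d - a) - xln (c - a) - (d - c).
Proof.
move=> cd; case=> h.
  have e (t : R) : t \in [set` `[c, d]] -> ln (a - t) = ln `|t - a|.
    rewrite inE/= in_itv/= => /andP[_ h2].
    by rewrite distrC gtr0_norm// subr_gt0 (le_lt_trans h2).
  have [] := @Rintegral_FTC (fun t => ln (a - t))
     (fun t => - ((a - t) * ln (a - t)) - t) c d cd.
  - move=> t /andP[h1 h2]; have ta : t < a by exact: le_lt_trans h.
    have d1 := is_derive_lnB ta.
    have d2 : is_derive t 1 (fun s : R => a - s) (- 1).
      have : is_derive t 1 (cst a - (fun s : R => s)) (0 - 1) by apply: is_deriveB.
      by rewrite sub0r.
    have d3 : is_derive t 1 (- ((fun s : R => a - s) * (fun s : R => ln (a - s))) - id)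
        (- ((a - t) *: (- (a - t)^-1) + ln (a - t) *: - 1) - 1).
      by apply: is_deriveB; apply: is_deriveN; apply: is_deriveM.
    apply: (is_derive_eq d3); rewrite /GRing.scale/= mulrN mulfV; first by ring.
    by rewrite gt_eqF// subr_gt0.
  - move=> t /andP[h1 h2]; have ta : t < a by exact: le_lt_trans h.
    by have [] := is_derive_lnB ta.
  move=> h1 h2; split.
    by apply: eq_integrable h1 => // t ht /=; rewrite e.
  have -> : \int[leb]_(t in `[c, d]) ln `|t - a| = \int[leb]_(t in `[c, d]) ln (a - t).
    by apply: eq_Rintegral => t ht; rewrite e.
  rewrite h2 /xln.
  have ce := e c; have de := e d.
  rewrite -ce ?inE/= ?in_itv/= ?lexx// -de ?inE/= ?in_itv/= ?lexx ?cd//; ring.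
have e (t : R) : t \in [set` `[c, d]] -> ln (t + - a) = ln `|t - a|.
  rewrite inE/= in_itv/= => /andP[h2 _].
  by rewrite gtr0_norm// subr_gt0 (lt_le_trans h).
have [] := @Rintegral_FTC (fun t => ln (t + - a))
     (fun t => ((t + - a) * ln (t + - a)) - t) c d cd.
- move=> t /andP[h1 h2]; have ta : 0 < t + - a by rewrite subr_gt0 (lt_le_trans h).
  have d1 := is_derive_xlnx ta.
  have d3 : is_derive t 1 ((fun s : R => (s + - a) * ln (s + - a)) - id)
      (ln (t + - a) + 1 - 1) by apply: is_deriveB.
  by apply: (is_derive_eq d3); rewrite addrK.
- move=> t /andP[h1 h2]; have ta : a < t by exact: lt_le_trans h1.
  by have [] := is_derive_lnD ta.
move=> h1 h2; split.
  by apply: eq_integrable h1 => // t ht /=; rewrite e.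
have -> : \int[leb]_(t in `[c, d]) ln `|t - a| = \int[leb]_(t in `[c, d]) ln (t + - a).
  by apply: eq_Rintegral => t ht; rewrite e.
rewrite h2 /xln.
have ce := e c; have de := e d.
rewrite -ce ?inE/= ?in_itv/= ?lexx// -de ?inE/= ?in_itv/= ?lexx ?cd//; ring.
Qed.

Lemma xln_continuous (t : R) : {for t, continuous xln}.
Proof.
have posc s : 0 < s -> {for s, continuous (fun u : R => u * ln u)}.
  by move=> s0; apply: cvgM; [exact: cvg_id|exact: continuous_ln].
have [t0|t0|->] := ltgtP t 0.
- have near_t : \forall u \near t, - (- u * ln (- u)) = xln u.
    near=> u; have u0 : u < 0 by near: u; exact: lt_nbhsl.
    by rewrite /xln ltr0_norm// mulNr opprK.
  have h : xln t = - (- t * ln (- t)) by rewrite /xln ltr0_norm// mulNr opprK.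
  suff c : - (- u * ln (- u)) @[u --> t] --> xln t.
    exact: cvg_trans (near_eq_cvg near_t) c.
  rewrite h; apply: cvgN; apply: (@continuous_comp _ _ _ (fun u : R => - u) (fun u : R => u * ln u)).
    exact: opp_continuous.
  by apply: posc; rewrite oppr_gt0.
- have near_t : \forall u \near t, u * ln u = xln u.
    near=> u; have u0 : 0 < u by near: u; exact: lt_nbhsr.
    by rewrite /xln gtr0_norm.
  have h : xln t = t * ln t by rewrite /xln gtr0_norm.
  suff c : u * ln u @[u --> t] --> xln t.
    exact: cvg_trans (near_eq_cvg near_t) c.
  by rewrite h; exact: posc.
(* [|u ln |u|| <= 2 sqrt |u|] for [|u| <= 1] *)
have h0 : xln 0 = 0 by rewrite /xln mul0r.
suff c : xln u @[u --> 0] --> xln 0 by [].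
rewrite h0.
apply/cvgrPdist_le => e e0.
have m0 : 0 < Num.min 1 ((e / 2) ^+ 2) by rewrite lt_min ltr01 exprn_gt0// divr_gt0.
near=> u; rewrite sub0r normrN /xln.
have [->|u0] := eqVneq u 0; first by rewrite mul0r normr0 ltW.
have : `|u| < Num.min 1 ((e / 2) ^+ 2) by near: u; apply/nbhs_ballP; exists (Num.min 1 ((e / 2) ^+ 2)) => //= z;
    rewrite /ball/= sub0r normrN.
set v := `|u|; have v0 : 0 < v by rewrite normr_gt0.
rewrite lt_min => /andP[v1 v2].
set s := Num.sqrt v; have s0 : 0 < s by rewrite sqrtr_gt0.
have vs : v = s ^+ 2 by rewrite sqr_sqrtr// ltW.
have se : s <= e / 2.
  by rewrite -(@ler_pXn2r _ 2)// ?nnegrE ?(ltW s0) ?divr_ge0 ?(ltW e0)// -vs ltW.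
have h : - ln s < s^-1 by rewrite -lnV ?posrE//; apply: ln_sublinear; rewrite invr_gt0.
have ln0 : ln v <= 0 by apply: ln_le0; exact: ltW.
rewrite normrM -/v (ler0_norm ln0) vs lnXn// -mulr_natl.
apply: (@le_trans _ _ (s ^+ 2 * (2 * s^-1))).
  by apply: ler_wpM2l; [exact: sqr_ge0|lra].
rewrite expr2 -mulrA [s * (2 * _)]mulrCA mulfV ?gt_eqF//; lra.
Unshelve. all: by end_near.
Qed.

End ExplicitIntegrals.

Section IntegralSums.
Variables (d : measure_display) (T : measurableType d) (R : realType).
Variable mu : {measure set T -> \bar R}.
Local Open Scope classical_set_scope.
Local Open Scope ring_scope.

Lemma integrable_setU_disj (A B : set T) (h : T -> R) :
  measurable A -> measurable B -> [disjoint A & B] ->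
  mu.-integrable A (EFin \o h) -> mu.-integrable B (EFin \o h) ->
  mu.-integrable (A `|` B) (EFin \o h).
Proof.
move=> mA mB dAB iA iB; apply/(integrable_mkcond _ (measurableU _ _ mA mB)).
have -> : (EFin \o h) \_ (A `|` B) = (((EFin \o h) \_ A) \+ ((EFin \o h) \_ B))%E.
  apply: funext => x; rewrite !patchE in_setU.
  have : ~~ ((x \in A) && (x \in B)).
    by apply/negP => /andP[/set_mem xA /set_mem xB]; move/disj_setPS: dAB => /(_ x); apply.
  by case: (x \in A); case: (x \in B) => //= _; rewrite ?adde0 ?add0e.
apply: integrableD => //; exact/(integrable_mkcond _ _).1.
Qed.

Lemma Rintegral_sum_ord (D : set T) (n : nat) (g : nat -> T -> R) :
  measurable D -> (forall j, (j < n)%N -> mu.-integrable D (EFin \o g j)) ->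
  mu.-integrable D (EFin \o (fun y => \sum_(j < n) g j y)) /\
  \int[mu]_(y in D) (\sum_(j < n) g j y) = \sum_(j < n) \int[mu]_(y in D) g j y.
Proof.
move=> mD; elim: n => [|n IH] hg.
  have -> : (fun y => \sum_(j < 0) g j y) = cst 0 by apply: funext => y; rewrite big_ord0.
  rewrite big_ord0; split; first exact: integrable0.
  by rewrite /Rintegral integral0_eq.
have -> : (fun y => \sum_(j < n.+1) g j y) = (fun y => \sum_(j < n) g j y + g n y).
  by apply: funext => y; rewrite big_ord_recr.
have [i1 e1] := IH (fun j hj => hg j (ltnW hj)).
have i2 := hg n (ltnSn n).
split; first exact: (integrableD mD i1 i2).
by rewrite RintegralD// e1 big_ord_recr.
Qed.

Lemma Rintegral_restrict (D C : set T) (h : T -> R) :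
  measurable D -> measurable C -> mu.-integrable (D `&` C) (EFin \o h) ->
  mu.-integrable D (EFin \o (h \_ C)) /\
  \int[mu]_(y in D) (h \_ C) y = \int[mu]_(y in D `&` C) h y.
Proof.
move=> mD mC ih; split; last by rewrite Rintegral_mkcondr.
apply/(integrable_mkcond _ mD).
rewrite -restrict_EFin -patch_setI setIC restrict_EFin.
by move/(integrable_mkcond _ (measurableI _ _ mD mC)): ih; rewrite restrict_EFin [C `&` D]setIC.
Qed.

End IntegralSums.

(** * The Hilbert transform of a step function *)

Section HilbertStep.
Variables (R : realType) (H : nat) (f : nat -> R).
Hypothesis H0 : (0 < H)%N.
Local Notation leb := (@lebesgue_measure R).
Local Open Scope classical_set_scope.
Local Open Scope ring_scope.

Definition zext (i : int) : R := if (0 <= i) && (i < H%:Z) then f `|i|%N else 0.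

Lemma zext_bound : exists B, forall i, `|zext i| <= B.
Proof.
exists (\sum_(j < H) `|f j|) => i; rewrite /zext; case: ifP => [/andP[h1 h2]|_].
  have hi : (`|i| < H)%N by lia.
  by rewrite (bigD1 (Ordinal hi))//= lerDl sumr_ge0.
by rewrite normr0 sumr_ge0.
Qed.

(** The principal value computed cell by cell, [- ln |x - y|] being a primitive of [1 / (x - y)] in
    [y]. *)
Definition hstep (x : R) : R :=
  \sum_(j < H) f j * (ln `|x - j%:R / H%:R| - ln `|x - j.+1%:R / H%:R|).

Let Hr : 0 < H%:R :> R. Proof. by rewrite ltr0n. Qed.

Lemma cell_lt (j : nat) : j%:R / H%:R < j.+1%:R / H%:R :> R.
Proof. by rewrite ltr_pM2r ?invr_gt0// ltr_nat. Qed.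

Variables (x e0 eps : R).
Hypotheses (eps0 : 0 < eps < e0) (xe0 : forall j, (j <= H)%N -> e0 <= `|x - j%:R / H%:R|).

Let D : set R := [set y | eps < `|x - y|].

Lemma measurable_trunc : measurable D.
Proof.
have -> : D = (`]-oo, x - eps[ `|` `]x + eps, +oo[)%classic.
  apply/seteqP; split=> y; rewrite /D /= !in_itv/= ?andbT ltr_normr.
    by move=> /orP[h|h]; [left|right]; lra.
  by case=> h; apply/orP; [left|right]; lra.
exact: measurableU.
Qed.

(** If [x] lies inside the cell, the removed interval is symmetric about [x] and the two terms
    [ln eps] cancel; so the truncated integral does not depend on [eps]. *)
Lemma trunc_cell (j : nat) : (j < H)%N ->
  leb.-integrable (D `&` `[j%:R / H%:R, j.+1%:R / H%:R[) (EFin \o (fun y => (x - y)^-1)) /\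
  \int[leb]_(y in D `&` `[j%:R / H%:R, j.+1%:R / H%:R[) (x - y)^-1 =
  ln `|x - j%:R / H%:R| - ln `|x - j.+1%:R / H%:R|.
Proof.
move=> jH; have ea := xe0 (ltnW jH); have eb := xe0 jH; have /andP[e1 e2] := eps0.
have ab := cell_lt j; move: (j%:R / H%:R) (j.+1%:R / H%:R) ea eb ab => a b ea eb ab.
have co_cc h : leb.-integrable `[a, b] (EFin \o h) -> leb.-integrable `[a, b[ (EFin \o h).
  apply: integrableS => //; apply: subset_itv_co_cc.
have [bx|xb|xb] := ltgtP b x.
- have [i1 v1] := cauchy_left (ltW ab) bx.
  have -> : D `&` `[a, b[ = `[a, b[%classic.
    apply: setIidr => y; rewrite /= in_itv/= => /andP[_ yb]; rewrite /D/= ltr_normr.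
    by rewrite ger0_norm in eb; [apply/orP; left|]; lra.
  split; first exact: co_cc.
  rewrite Rintegral_itv_bndo_bndc ?v1//; last exact: co_cc.
  by rewrite !ger0_norm//; lra.
- have [ax|xa|xa] := ltgtP a x.
  + have ea' : e0 <= x - a by rewrite ger0_norm in ea; lra.
    have eb' : e0 <= b - x by rewrite ler0_norm in eb; lra.
    have -> : D `&` `[a, b[ = (`[a, x - eps[ `|` `]x + eps, b[)%classic.
      apply/seteqP; split=> y; rewrite /D /= !in_itv/= ltr_normr.
        by move=> [/orP[h|h] /andP[h1 h2]]; [left|right]; apply/andP; split; lra.
      by case=> /andP[h1 h2]; split; [apply/orP; left| |apply/orP; right|]; try (apply/andP; split); lra.
    have [i1 v1] := @cauchy_left R x a (x - eps) ltac:(lra) ltac:(lra).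
    have [i2 v2] := @cauchy_right R x (x + eps) b ltac:(lra) ltac:(lra).
    have j1 : leb.-integrable `[a, x - eps[ (EFin \o (fun y => (x - y)^-1)).
      by apply: integrableS i1 => //; apply: subset_itv_co_cc.
    have j2' : leb.-integrable `]x + eps, b] (EFin \o (fun y => (x - y)^-1)).
      by apply: integrableS i2 => //; apply: subset_itv_oc_cc.
    have j2 : leb.-integrable `]x + eps, b[ (EFin \o (fun y => (x - y)^-1)).
      by apply: integrableS i2 => //; apply: subset_itv_oo_cc.
    have dis : [disjoint `[a, x - eps[%classic & `]x + eps, b[%classic].
      apply/disj_setPS => y /=; rewrite !in_itv/= => -[/andP[h1 h2] /andP[h3 h4]]; lra.
    split; first exact: integrable_setU_disj.
    rewrite Rintegral_setU//; last exact: integrable_setU_disj.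
    rewrite Rintegral_itv_bndo_bndc// v1.
    rewrite Rintegral_itv_bndo_bndc// Rintegral_itv_obnd_cbnd// v2.
    rewrite (ger0_norm (_ : 0 <= x - a)); last by lra.
    rewrite (ler0_norm (_ : x - b <= 0)); last by lra.
    have -> : x - (x - eps) = eps by ring.
    have -> : x + eps - x = eps by ring.
    by rewrite opprB; ring.
  + have [i1 v1] := cauchy_right (ltW ab) xa.
    have -> : D `&` `[a, b[ = `[a, b[%classic.
      apply: setIidr => y; rewrite /= in_itv/= => /andP[ya yb]; rewrite /D/= ltr_normr.
      by rewrite ler0_norm in ea; [apply/orP; right|]; lra.
    split; first exact: co_cc.
    rewrite Rintegral_itv_bndo_bndc ?v1//; last exact: co_cc.
    by rewrite !ler0_norm ?opprB//; lra.
  + by move: ea; rewrite xa subrr normr0; lra.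
- by move: eb; rewrite xb subrr normr0; lra.
Qed.

Lemma trunc_step :
  \int[leb]_(y in D) (sf H zext y / (x - y)) = hstep x.
Proof.
pose g (j : nat) := (fun y => f j * (x - y)^-1) \_ `[j%:R / H%:R, j.+1%:R / H%:R[.
have gE j : (j < H)%N -> leb.-integrable D (EFin \o g j) /\
    \int[leb]_(y in D) g j y = f j * (ln `|x - j%:R / H%:R| - ln `|x - j.+1%:R / H%:R|).
  move=> jH; have [i1 v1] := trunc_cell jH.
  have i2 : leb.-integrable (D `&` `[j%:R / H%:R, j.+1%:R / H%:R[) (EFin \o (fun y => f j * (x - y)^-1)).
    have -> : EFin \o (fun y => f j * (x - y)^-1) = (fun y => ((f j)%:E * (EFin \o (fun y0 => ((x - y0)^-1)%R)) y)%E).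
      by apply: funext => y /=; rewrite EFinM.
    apply: integrableZl => //; apply: measurableI => //; exact: measurable_trunc.
  have [i3 v3] := @Rintegral_restrict _ _ R leb D (`[j%:R / H%:R, j.+1%:R / H%:R[%classic)
    (fun y => f j * (x - y)^-1) measurable_trunc (measurable_itv _) i2.
  split=> //; rewrite v3 RintegralZl// ?v1//.
  by apply: measurableI => //; exact: measurable_trunc.
have -> : (fun y => sf H zext y / (x - y)) = (fun y => \sum_(j < H) g j y).
  apply: funext => y; rewrite /sf /zext.
  have fl := floor_itv (y * H%:R).
  have gy (j : nat) : g j y = if Num.floor (y * H%:R) == j%:Z then f j / (x - y) else 0.
    rewrite floor_eq (_ : (j%:Z + 1)%:~R = j.+1%:R); last by rewrite intrD natr1.
    by rewrite /g patchE mem_setE in_itv/= ler_pdivrMr// ltr_pdivlMr//.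
  case: ifP => [/andP[h1 h2]|hn].
    have hi : (`|Num.floor (y * H%:R)| < H)%N by move: h1 h2; clear; lia.
    rewrite (bigD1 (Ordinal hi))//= gy gez0_abs// eqxx big1 ?addr0// => j jn.
    rewrite gy; case: eqP => // e; move/eqP: jn; case; apply/val_inj => /=.
    by rewrite e.
  rewrite mul0r big1// => j _; rewrite gy; case: eqP => // e.
  by move: hn (ltn_ord j); rewrite e; clear; lia.
have [_ ->] := @Rintegral_sum_ord _ _ R leb D H g measurable_trunc (fun j hj => (gE j hj).1).
by apply: eq_bigr => j _; have [_ ->] := gE j (ltn_ord j).
Qed.

End HilbertStep.

(** All truncations with [eps < e0] agree, so the limit is that of an eventually constant function;
    [e0] keeps [x] away from the grid points. *)
Lemma hilbert_step (R : realType) (H : nat) (f : nat -> R) (x e0 : R) :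
  (0 < H)%N -> 0 < e0 -> (forall j, (j <= H)%N -> e0 <= `|x - j%:R / H%:R|) ->
  hilbert_transform (sf H (zext H f)) x = hstep H f x.
Proof.
move=> H0 e00 he; rewrite /hilbert_transform; apply: lim_near_cst.
  exact: Rhausdorff.
near=> eps; apply: (@trunc_step R H f H0 x e0 eps) => //.
apply/andP; split; near: eps; [exact: nbhs_right_gt|exact: nbhs_right_lt].
Unshelve. all: by end_near.
Qed.

(** * Lower bound of the operator norm by duality *)

Section LowerIntegral.
Variables (d : measure_display) (T : measurableType d) (R : realType).
Variable mu : {measure set T -> \bar R}.
Local Open Scope classical_set_scope.
Local Open Scope ring_scope.

(* The Hilbert transform is not known to be measurable, but the integral of any
   nonnegative function is a supremum over the simple functions below it. *)
Lemma integral_ge_integrable (N psi : T -> R) :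
  (forall x, 0 <= N x) -> (forall x, psi x <= N x) ->
  mu.-integrable setT (EFin \o psi) ->
  ((\int[mu]_x psi x)%:E <= \int[mu]_x (N x)%:E)%E.
Proof.
move=> N0 hN ipsi.
have fin := integrable_fin_num measurableT ipsi.
rewrite /Rintegral fineK// integralE.
apply: (@le_trans _ _ (\int[mu]_x ((EFin \o psi)^\+ x))%E).
  by rewrite leeBlDr ?leeDl ?integral_ge0//; exact: integrable_neg_fin_num.
rewrite !ge0_integralTE//.
apply: ereal_sup_le => _ [h /= hh <-]; exists h => //= x.
apply: le_trans (hh x) _; rewrite funeposE ge_max /= lee_fin.
by rewrite hN lee_fin N0.
Qed.
End LowerIntegral.

Section Young.
Variable R : realType.

(** Young's inequality as a linearisation: for [u = H f] the left side is affine in [H f], so its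
    integral can be computed exactly. The scale [s] is chosen in [hilbert_lower]. *)
Lemma young_weighted (p s u g v : R) : 1 < p -> 0 <= s -> 0 < v ->
  p * s * (u * g) - (p - 1) * s `^ (p / (p - 1)) *
     (`|g| `^ (p / (p - 1)) * v `^ (1 - p / (p - 1))) <= `|u| `^ p * v.
Proof.
move=> p1 s0 v0; set q := p / (p - 1).
have p0 : 0 < p by lra.
have q0 : 0 < q by rewrite divr_gt0//; lra.
have pq : p^-1 + q^-1 = 1 by rewrite /q invf_div; field; lra.
have exq : - p^-1 * q = 1 - q.
  have -> : p^-1 = 1 - q^-1 by rewrite -pq addrK.
  by rewrite mulNr mulrBl mul1r mulVf ?gt_eqF// opprB.
have h := @conjugate_powR R (`|u| * v `^ p^-1) (s * `|g| * v `^ (- p^-1)) p q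
  (mulr_ge0 (normr_ge0 _) (powR_ge0 _ _))
  (mulr_ge0 (mulr_ge0 s0 (normr_ge0 _)) (powR_ge0 _ _)) p0 q0 pq.
have e1 : `|u| * v `^ p^-1 * (s * `|g| * v `^ (- p^-1)) = s * (`|u| * `|g|).
  rewrite powRN; field; by rewrite gt_eqF// powR_gt0.
have e2 : (`|u| * v `^ p^-1) `^ p = `|u| `^ p * v.
  by rewrite powRM// ?powR_ge0// -powRrM mulVf ?gt_eqF// powRr1// ltW.
have e3 : (s * `|g| * v `^ (- p^-1)) `^ q = s `^ q * (`|g| `^ q * v `^ (1 - q)).
  by rewrite powRM ?mulr_ge0 ?powR_ge0// powRM// -powRrM exq mulrA.
rewrite e1 e2 e3 in h.
have hp : p * (s * (`|u| * `|g|)) <= `|u| `^ p * v + (p - 1) * (s `^ q * (`|g| `^ q * v `^ (1 - q))).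
  have := ler_wpM2l (ltW p0) h.
  rewrite mulrDr; set X := `|u| `^ p * v; set Y := s `^ q * _.
  have -> : p * (X / p) = X by rewrite mulrC divfK ?gt_eqF.
  suff -> : p * (Y / q) = (p - 1) * Y by [].
  by rewrite [q^-1]invf_div mulrCA [p * _]mulrC divfK ?gt_eqF// mulrC.
have h5 : p * s * (u * g) <= p * (s * (`|u| * `|g|)).
  by rewrite -normrM -mulrA ler_pM2l// ler_wpM2l// ler_norm.
by rewrite lerBlDr -[(p - 1) * _ * _]mulrA; exact: le_trans h5 hp.
Qed.
End Young.

Section Pairing.
Variables (R : realType) (H : nat) (f : nat -> R).
Hypothesis H0 : (0 < H)%N.
Local Notation leb := (@lebesgue_measure R).
Local Open Scope classical_set_scope.
Local Open Scope ring_scope.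
Let Hr : 0 < H%:R :> R. Proof. by rewrite ltr0n. Qed.

(** The cells are shortened by [e] at both ends, away from the grid points where [hstep] is singular
    and [hilbert_step] does not apply. *)
Definition shrL (e : R) (i : nat) : R := i%:R / H%:R + e.
Definition shrR (e : R) (i : nat) : R := i.+1%:R / H%:R - e.

Definition cellpair (e : R) (i j : nat) : R :=
  (xln (shrR e i - j%:R / H%:R) - xln (shrL e i - j%:R / H%:R)) -
  (xln (shrR e i - j.+1%:R / H%:R) - xln (shrL e i - j.+1%:R / H%:R)).

Lemma shr_le e i : e <= (2 * H%:R)^-1 -> shrL e i <= shrR e i.
Proof.
move=> he; rewrite /shrL /shrR -natr1 mulrDl mul1r.
have : H%:R^-1 = 2 * (2 * H%:R)^-1 :> R by field; rewrite gt_eqF.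
lra.
Qed.

Lemma shr_far e i j x : shrL e i <= x <= shrR e i ->
  ((j <= i)%N -> e <= x - j%:R / H%:R) /\ ((i < j)%N -> e <= j%:R / H%:R - x).
Proof.
rewrite /shrL /shrR => /andP[h1 h2]; split=> hj.
  have : j%:R / H%:R <= i%:R / H%:R :> R by rewrite ler_pM2r ?invr_gt0// ler_nat.
  lra.
have : i.+1%:R / H%:R <= j%:R / H%:R :> R by rewrite ler_pM2r ?invr_gt0// ler_nat.
lra.
Qed.

Lemma shr_dist e i j x : shrL e i <= x <= shrR e i -> e <= `|x - j%:R / H%:R|.
Proof.
move=> /(@shr_far e i j)[h1 h2]; rewrite ler_normr; case: (leqP j i) => hj.
  by rewrite h1.
by rewrite opprB h2 ?orbT.
Qed.

Lemma integral_hstep e i : 0 < e -> e <= (2 * H%:R)^-1 ->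
  leb.-integrable `[shrL e i, shrR e i] (EFin \o hstep H f) /\
  \int[leb]_(x in `[shrL e i, shrR e i]) hstep H f x =
  \sum_(j < H) f j * cellpair e i j.
Proof.
move=> e0 he; have lr := shr_le i he.
have side j : shrR e i < j%:R / H%:R \/ j%:R / H%:R < shrL e i.
  have hL : shrL e i <= shrL e i <= shrR e i by rewrite lexx.
  have hR : shrL e i <= shrR e i <= shrR e i by rewrite lexx lr.
  have [l1 l2] := shr_far j hL; have [r1 r2] := shr_far j hR.
  by case: (leqP j i) => hj; [right; have := l1 hj|left; have := r2 hj]; lra.
pose g (j : nat) (x : R) := f j * (ln `|x - j%:R / H%:R| - ln `|x - j.+1%:R / H%:R|).
have gE j : leb.-integrable `[shrL e i, shrR e i] (EFin \o g j) /\
    \int[leb]_(x in `[shrL e i, shrR e i]) g j x = f j * cellpair e i j.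
  have [i1 v1] := ln_abs_integral lr (side j).
  have [i2 v2] := ln_abs_integral lr (side j.+1).
  have i3 : leb.-integrable `[shrL e i, shrR e i]
      (EFin \o (fun x => ln `|x - j%:R / H%:R| - ln `|x - j.+1%:R / H%:R|)).
    have -> : EFin \o (fun x => ln `|x - j%:R / H%:R| - ln `|x - j.+1%:R / H%:R|) =
       ((EFin \o (fun x : R => ln `|x - j%:R / H%:R|%R)) \- (EFin \o (fun x : R => ln `|x - j.+1%:R / H%:R|%R)))%E.
      by apply: funext => x; rewrite /= EFinB.
    exact: integrableB.
  split.
    have -> : EFin \o g j = (fun x => ((f j)%:E * (EFin \o (fun y : R => (ln `|y - j%:R / H%:R| - ln `|y - j.+1%:R / H%:R|)%R)) x)%E).
      by apply: funext => x; rewrite /g /= EFinM.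
    exact: integrableZl.
  by rewrite RintegralZl// RintegralB// v1 v2 /cellpair; ring.
have [i1 v1] := @Rintegral_sum_ord _ _ R leb (`[shrL e i, shrR e i]%classic) H g
  (measurable_itv _) (fun j _ => (gE j).1).
split; first exact: i1.
rewrite [LHS]v1; apply: eq_bigr => j _; exact: (gE j).2.
Qed.

Definition pairing (g : nat -> R) (e : R) : R :=
  \sum_(i < H) g i * \sum_(j < H) f j * cellpair e i j.

Lemma xln_scale (k : int) : xln (k%:~R / H%:R) =
  (xlnx R k - k%:~R * ln H%:R) / H%:R.
Proof.
have [->|k0] := eqVneq k 0; first by rewrite /xln /xlnx !mul0r subrr mul0r.
have k1 : 0 < `|k%:~R : R| by rewrite normr_gt0 intr_eq0.
rewrite /xln /xlnx normrM normfV (gtr0_norm Hr) ln_div ?posrE//; ring.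
Qed.

Lemma cellpair0 i j : cellpair 0 i j = wz R (i%:Z - j%:Z) / H%:R.
Proof.
have e (k l : nat) : k%:R / H%:R - l%:R / H%:R = (k%:Z - l%:Z)%:~R / H%:R :> R.
  by rewrite -mulrBl intrB.
rewrite /cellpair /shrL /shrR addr0 subr0 !e !xln_scale /wz.
have -> : i.+1%:Z - j%:Z = i%:Z - j%:Z + 1 by lia.
have -> : i.+1%:Z - j.+1%:Z = i%:Z - j%:Z by lia.
have -> : i%:Z - j.+1%:Z = i%:Z - j%:Z - 1 by lia.
by rewrite intrD intrB; ring.
Qed.

Lemma pairing0 g : pairing g 0 = Bf H f g.
Proof.
rewrite /pairing /Bf exchange_big/= mulr_sumr; apply: eq_bigr => i _.
rewrite !mulr_sumr; apply: eq_bigr => j _; rewrite cellpair0; ring.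
Qed.

Lemma cvg_sum_ord n (F : nat -> R -> R) (a : nat -> R) (t : R) :
  (forall i, F i e @[e --> t] --> a i) ->
  \sum_(i < n) F i e @[e --> t] --> \sum_(i < n) a i.
Proof.
move=> hF; elim: n => [|n IH].
  have -> : (fun e => \sum_(i < 0) F i e) = cst 0 by apply: funext => e; rewrite big_ord0.
  by rewrite big_ord0; exact: cvg_cst.
have -> : (fun e => \sum_(i < n.+1) F i e) = (fun e => \sum_(i < n) F i e + F n e).
  by apply: funext => e; rewrite big_ord_recr.
by rewrite big_ord_recr; apply: cvgD.
Qed.

Lemma pairing_cvg g : pairing g e @[e --> 0] --> pairing g 0.
Proof.
apply: (@cvg_sum_ord H (fun i e => g i * \sum_(j < H) f j * cellpair e i j)
  (fun i => g i * \sum_(j < H) f j * cellpair 0 i j)) => i.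
apply: cvgMr.
apply: (@cvg_sum_ord H (fun j e => f j * cellpair e i j)
  (fun j => f j * cellpair 0 i j)) => j; apply: cvgMr.
have shift (a : R) (F : R -> R) : {for 0, continuous F} ->
    xln (F e - a) @[e --> 0] --> xln (F 0 - a).
  move=> cF; have h1 : F e - a @[e --> 0] --> F 0 - a by apply: cvgB; [exact: cF|exact: cvg_cst].
  exact: (cvg_comp _ _ h1 (@xln_continuous R (F 0 - a))).
have cL : {for 0, continuous (shrL^~ i)}.
  by apply: cvgD; [exact: cvg_cst|exact: cvg_id].
have cR : {for 0, continuous (shrR^~ i)}.
  by apply: cvgB; [exact: cvg_cst|exact: cvg_id].
by apply: cvgB; apply: cvgB; apply: shift.
Qed.

Lemma pairing_near g (b : R) : b < Bf H f g ->
  exists e, [/\ 0 < e, e <= (2 * H%:R)^-1 & b < pairing g e].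
Proof.
rewrite -pairing0 => hb.
have /cvgrPdist_lt /(_ (pairing g 0 - b)) := pairing_cvg (g := g).
rewrite subr_gt0 => /(_ hb) /nbhs_ballP[d /= d0 hd].
have h2 : 0 < (2 * H%:R)^-1 :> R by rewrite invr_gt0 mulr_gt0.
exists (Num.min (d / 2) (2 * H%:R)^-1); split.
- by rewrite lt_min h2 divr_gt0.
- by rewrite ge_min lexx orbT.
have /hd : ball (0 : R) d (Num.min (d / 2) (2 * H%:R)^-1).
  rewrite /ball/= sub0r normrN ger0_norm; last by rewrite le_min (ltW h2) divr_ge0// ltW.
  by rewrite gt_min; apply/orP; left; lra.
by move=> /=; rewrite ltr_norml => /andP[_]; lra.
Qed.

End Pairing.

Section HilbertLower.
Variables (R : realType) (p : R) (H : nat) (f g : nat -> R) (V : int -> R) (C3 : R).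
Hypotheses (p1 : 1 < p) (H0 : (0 < H)%N) (V0 : forall i, 0 < V i).
Local Notation leb := (@lebesgue_measure R).
Local Open Scope classical_set_scope.
Local Open Scope ring_scope.
Let q : R := p / (p - 1).
Hypotheses (fnorm : H%:R^-1 * (\sum_(i < H) `|f i| `^ p * V i%:Z) <= 1)
  (gnorm : H%:R^-1 * (\sum_(i < H) `|g i| `^ q * V i%:Z `^ (1 - q)) <= C3)
  (C31 : 1 <= C3) (B0 : 0 < Bf H f g).
Let Hr : 0 < H%:R :> R. Proof. by rewrite ltr0n. Qed.
Let F : R -> R := sf H (zext H f).
Let w : R -> R := sf H V.

Lemma weighted_norm_step : (weighted_norm p w F <= 1)%E.
Proof.
have p2 : 0 < p := lt_trans ltr01 p1.
have p0 : p != 0 by exact: lt0r_neq0.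
pose U := zext H (fun i => `|f i| `^ p * V i%:Z).
have UE x : `|F x| `^ p * w x = sf H U x.
  rewrite /F /w /sf /U /zext; case: ifP => [/andP[h1 h2]|_].
    by rewrite gez0_abs.
  by rewrite normr0 powR0// mul0r.
have [B hB] := zext_bound (fun i => `|f i| `^ p * V i%:Z) H0.
have U0 x : 0 <= sf H U x.
  by rewrite -UE mulr_ge0 ?powR_ge0// ltW// V0.
have -> : weighted_norm p w F = poweR (mass (sf H U) 0 1)%:E p^-1.
  rewrite /weighted_norm -(weight_massE (measurable_sf U H0) (fun x => hB _)).
  congr poweR; rewrite /weight_mass [RHS]integral_mkcond.
  apply: eq_integral => x _; rewrite patchE UE mem_setE in_itv/=.
  case: ifP => // hx; congr EFin; rewrite /sf /U /zext; case: ifP => // /andP[h1 h2].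
  move/negP: hx; case; have /andP[f1 f2] := floor_itv (x * H%:R).
  apply/andP; split.
    rewrite -(pmulr_lge0 _ Hr); apply: le_trans f1; by rewrite ler0z.
  rewrite -(ler_pM2r Hr) mul1r; apply/ltW/(lt_le_trans f2).
  suff : Num.floor (x * H%:R) + 1 <= H%:Z by rewrite -(ler_int R).
  by move: h2; clear; lia.
have hm : mass (sf H U) 0 1 = (\sum_(i < H) U i%:Z) / H%:R.
  have := mass_cells H0 hB 0 H; rewrite add0r mul0r (_ : H%:Z%:~R = H%:R)// mulfV ?gt_eqF// => ->.
have hU : mass (sf H U) 0 1 <= 1.
  rewrite hm mulrC; apply: le_trans fnorm; apply: ler_wpM2l; first by rewrite invr_ge0 ltW.
  by apply: ler_sum => i _; rewrite /U /zext /= ltz_nat ltn_ord.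
have U1 : 0 <= mass (sf H U) 0 1 by exact: mass_ge0.
have h1 : (1 : R) `^ p^-1 = 1 by rewrite powR1.
rewrite poweR_EFin lee_fin -[leRHS]h1.
by apply: ge0_ler_powR; rewrite ?nnegrE// invr_ge0 ltW.
Qed.

(** On the shortened cells Young's inequality bounds [|H F|^p w] from below by the explicit [psi].
    Shortening costs at most half of [B]. With [s = b ^ (p - 1)] and [C3 b = B / 2] the integral of
    [psi] is at least [p s C3 b - (p - 1) s C3 b = s C3 b >= b ^ p]. *)
Lemma hilbert_lower : ((Bf H f g / (2 * C3))%:E <= hilbert_opnorm p w)%E.
Proof.
have p2 : 1 < p by [].
have C32 : 1 <= C3 by [].
have B1 : 0 < Bf H f g by [].
set B := Bf H f g in B1 *.
have q0 : 0 < q by rewrite divr_gt0//; lra.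
have hB2 : B / 2 < B by lra.
have [e [e0 e1 hpair]] := @pairing_near R H f H0 g (B / 2) hB2.
set b := B / (2 * C3); have b0 : 0 < b by rewrite divr_gt0// mulr_gt0//; lra.
set s := b `^ (p - 1); have s0 : 0 <= s by exact: powR_ge0.
have sq : s `^ q = b `^ p.
  by rewrite /s -powRrM; congr (_ `^ _); rewrite /q; field; lra.
apply: (@le_trans _ _ (weighted_norm p w (hilbert_transform F))); last first.
  apply: ereal_sup_ubound; exists F; split=> //.
    by have [Bb hB] := zext_bound f H0; exact: (measurable_sf _ H0).
  exact: weighted_norm_step.
pose cst_ (i : nat) := (p - 1) * s `^ q * (`|g i| `^ q * V i%:Z `^ (1 - q)).
pose h (i : nat) := (fun x => p * s * g i * hstep H f x - cst_ i) \_ `[shrL H e i, shrR H e i].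
pose psi x := \sum_(i < H) h i x.
pose N x := `|hilbert_transform F x| `^ p * w x.
have N0 x : 0 <= N x by rewrite mulr_ge0 ?powR_ge0// ltW// V0.
have hval i x : shrL H e i <= x <= shrR H e i -> Num.floor (x * H%:R) = i%:Z.
  rewrite /shrL /shrR => /andP[x1 x2]; apply/eqP; rewrite floor_eq -ler_pdivrMr// -ltr_pdivlMr//.
  rewrite intrD natr1; apply/andP; split; lra.
have psiN x : psi x <= N x.
  rewrite /psi; have [[i hi]|hn] := pselect (exists i : 'I_H, shrL H e i <= x <= shrR H e i); last first.
    rewrite big1// => i _; rewrite /h patchE mem_setE in_itv/=; case: ifP => // hi.
    by case: hn; exists i.
  rewrite (bigD1 i)//= big1 ?addr0; last first.
    move=> j ji; rewrite /h patchE mem_setE in_itv/=; case: ifP => // hj.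
    move/eqP: ji; case; apply/val_inj; have := hval i x hi; rewrite (hval j x hj).
    by case.
  rewrite /h patchE mem_setE in_itv/= hi /N /w /sf (hval i x hi).
  rewrite /F (@hilbert_step R H f x e H0 e0); last by move=> j _; exact: (shr_dist H0 j hi).
  apply: le_trans (@young_weighted R p s (hstep H f x) (g i) (V i%:Z) p1 s0 (V0 _)).
  by rewrite /cst_ -/q; lra.
have hE i : leb.-integrable setT (EFin \o h i) /\
    \int[leb]_x h i x = p * s * (g i * \sum_(j < H) f j * cellpair H e i j) -
       cst_ i * (shrR H e i - shrL H e i).
  have [i1 v1] := integral_hstep f H0 i e0 e1.
  have lr : shrL H e i <= shrR H e i by exact: shr_le.
  have ic : leb.-integrable `[shrL H e i, shrR H e i] (EFin \o cst (cst_ i)).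
    by apply: continuous_compact_integrable; [exact: segment_compact|exact: continuous_subspaceT (@cst_continuous _ _ _)].
  have i2 : leb.-integrable `[shrL H e i, shrR H e i] (EFin \o (fun x => p * s * g i * hstep H f x)).
    have -> : EFin \o (fun x => p * s * g i * hstep H f x) =
       (fun x => ((p * s * g i)%R%:E * (EFin \o hstep H f) x)%E).
      by apply: funext => x; rewrite /= EFinM.
    exact: integrableZl.
  have i3 : leb.-integrable `[shrL H e i, shrR H e i] (EFin \o (fun x => p * s * g i * hstep H f x - cst_ i)).
    have -> : EFin \o (fun x => p * s * g i * hstep H f x - cst_ i) =
      ((EFin \o (fun x => (p * s * g i * hstep H f x)%R)) \- (EFin \o cst (cst_ i)))%E.
      by apply: funext => x; rewrite /= EFinB.
    exact: integrableB.
  have i4 : leb.-integrable (setT `&` `[shrL H e i, shrR H e i]) (EFin \o (fun x => p * s * g i * hstep H f x - cst_ i)).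
    by rewrite setTI.
  have [i5 v5] := @Rintegral_restrict _ _ R leb setT (`[shrL H e i, shrR H e i]%classic)
    _ measurableT (measurable_itv _) i4.
  split=> //; rewrite /h v5 setTI RintegralB//.
  rewrite RintegralZl// v1; congr (_ - _); first by rewrite -!mulrA.
  have := @Rintegral_FTC R (fun=> cst_ i) (fun x => cst_ i * x) _ _ lr.
  move=> [].
  - move=> t _; have : is_derive t 1 (cst_ i *: (id : R -> R)) (cst_ i *: 1) by apply: is_deriveZ.
    by rewrite /GRing.scale/= mulr1.
  - by move=> t _; exact: derivable_cst.
  by move=> _ ->; ring.
have [ipsi vpsi] := @Rintegral_sum_ord _ _ R leb setT H h measurableT (fun i _ => (hE i).1).
have key := @integral_ge_integrable _ _ R leb N psi N0 psiN ipsi.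
have vlow : b `^ p <= \int[leb]_x psi x.
  rewrite [leRHS]vpsi.
  have -> : \sum_(j < H) \int[leb]_x h j x = p * s * pairing H f g e -
     \sum_(i < H) cst_ i * (shrR H e i - shrL H e i).
    by rewrite /pairing mulr_sumr -sumrB; apply: eq_bigr => i _; exact: (hE i).2.
  have hc : \sum_(i < H) cst_ i * (shrR H e i - shrL H e i) <= (p - 1) * b `^ p * C3.
    apply: (@le_trans _ _ (\sum_(i < H) cst_ i * H%:R^-1)).
      apply: ler_sum => i _; apply: ler_wpM2l.
        by rewrite /cst_ mulr_ge0 ?mulr_ge0 ?powR_ge0//; lra.
      by rewrite /shrL /shrR -natr1 mulrDl mul1r; lra.
    rewrite -mulr_suml /cst_ -mulr_sumr sq -mulrA [_ * H%:R^-1]mulrC.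
    by rewrite ler_wpM2l ?mulr_ge0 ?powR_ge0//; lra.
  have C3b : C3 * b = B / 2 by rewrite /b; field; lra.
  have bp : b `^ p = b * s by rewrite /s mulr_powRB1 ?(ltW b0)//; lra.
  have h1 : p * s * (B / 2) <= p * s * pairing H f g e.
    by apply: ler_wpM2l; [rewrite mulr_ge0//; lra|exact: ltW].
  have h2 : (p - 1) * b `^ p * C3 = (p - 1) * s * (B / 2).
    by rewrite -C3b bp; ring.
  have h3 : b * s <= s * (B / 2).
    by rewrite mulrC ler_wpM2l// -C3b ler_peMl// ltW.
  rewrite h2 in hc; rewrite bp; lra.
have final : ((b `^ p)%:E <= \int[leb]_x (N x)%:E)%E.
  by apply: le_trans key; rewrite lee_fin.
have -> : b%:E = poweR ((b `^ p)%:E) p^-1.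
  by rewrite poweR_EFin -powRrM mulfV ?powRr1 ?(ltW b0)// gt_eqF//; lra.
apply: gt0_ler_poweR => //; first by rewrite invr_ge0; lra.
- by rewrite in_itv/= lee_fin powR_ge0 leey.
- rewrite in_itv/= leey andbT; apply: integral_ge0 => x _; rewrite lee_fin; exact: N0.
Qed.

End HilbertLower.

(** * Doubling constants and characteristics of the tree weights *)

Lemma oscillation_constants (R : realType) (th : R) : 0 < th -> exists (K : nat) (e0 : R),
  [/\ (4 <= K)%N, 0 < e0 < 1 & forall eta, 0 <= eta <= e0 ->
    let C := ((1 + eta) / (1 - eta)) ^+ K.+2 in
    (1 + th)^-1 <= (1 - 4 / K%:R) / C /\ (1 + 4 / K%:R) * C <= 1 + th].
Proof.
move=> th0; set t1 := th / (2 * (1 + th)).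
have t10 : 0 < t1 by rewrite divr_gt0// mulr_gt0//; lra.
have t1E : 1 - 2 * t1 = (1 + th)^-1 by rewrite /t1; field; lra.
have t11 : t1 < 1 / 2 by rewrite /t1 ltr_pdivrMr; lra.
set K := (Num.trunc (4 / t1) + 4)%N.
have K4 : 4 <= K%:R :> R by rewrite (ler_nat _ 4) /K leq_addl.
have hK : 4 / K%:R <= t1.
  rewrite ler_pdivrMr; last by lra.
  rewrite mulrC -ler_pdivrMr//; apply: ltW; apply: (lt_le_trans (truncnS_gt _)).
  by rewrite ler_nat /K -addn1 leq_add2l.
have kk : 0 <= 4 / K%:R :> R by rewrite divr_ge0.
set n := K.+2; have n0 : 0 < n%:R :> R by rewrite ltr0n.
have n1 : 1 <= n%:R :> R by rewrite (ler_nat _ 1).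
exists K, (t1 / (2 * n%:R)); split.
- by rewrite /K leq_addl.
- apply/andP; split; first by rewrite divr_gt0// mulr_gt0.
  rewrite ltr_pdivrMr ?mulr_gt0//; lra.
move=> eta /andP[eta0 eta1] C.
have eta2 : 2 * n%:R * eta <= t1 by rewrite mulrC -ler_pdivlMr// mulr_gt0.
have eta3 : eta < 1 by nra.
set r := (1 - eta) / (1 + eta).
have r0 : 0 < r by rewrite divr_gt0; lra.
have r1 : 1 - 2 * eta <= r by rewrite ler_pdivlMr; nra.
have bern k : 1 - k%:R * (2 * eta) <= r ^+ k.
  elim: k => [|k IH]; first by rewrite mul0r subr0 expr0.
  have rk : r ^+ k <= 1 by rewrite exprn_ile1 ?(ltW r0)// ler_pdivrMr; lra.
  rewrite exprS -natr1; have rk0 : 0 <= r ^+ k by rewrite exprn_ge0// ltW.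
  nra.
have CE : C = (r ^+ n)^-1.
  by rewrite /C -exprVn /r invf_div.
have hC : 1 - t1 <= r ^+ n.
  by apply: le_trans (bern n); lra.
have rn0 : 0 < r ^+ n by lra.
have low : (1 + th)^-1 <= (1 - 4 / K%:R) * r ^+ n.
  rewrite -t1E; apply: (@le_trans _ _ ((1 - t1) * (1 - t1))); first by nra.
  by apply: ler_pM; lra.
split; first by rewrite CE invrK.
have th1 : 0 < 1 + th by lra.
rewrite CE ler_pdivrMr//.
set A := 1 - 4 / K%:R in low; set B := 1 + 4 / K%:R.
have A0 : 0 < A.
  have i0 : 0 < (1 + th)^-1 by rewrite invr_gt0.
  have := lt_le_trans i0 low; rewrite pmulr_lgt0//.
(* With this product bound the upper estimate follows from the lower one. *)
have AB : A * B <= 1.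
  have -> : A * B = 1 - (4 / K%:R) ^+ 2 by rewrite /A /B; ring.
  by rewrite gerBl sqr_ge0.
have h1 : 1 <= (1 + th) * (A * r ^+ n).
  by rewrite mulrC -ler_pdivrMr// div1r.
rewrite -(ler_pM2l A0); apply: (le_trans AB); apply: (le_trans h1).
by rewrite mulrCA.
Qed.

Section TreeWeights.
Variables (R : realType) (S : Type) (step : S -> nat -> S) (z0 : S) (ok : S -> bool).
Hypotheses (ok_z0 : ok z0) (ok_step : forall z c, ok z -> ok (step z c)).
Hypotheses (step0 : forall z, step z 0 = z) (step7 : forall z, step z 7 = z).
Local Notation st := (st step z0).
Local Notation avg8 := (@avg8 R S step).
Local Notation wt := (@wt R S step z0).
Variables (ms : seq nat) (eta th : R) (K : nat).
Hypotheses (msp : posl ms) (eta0 : 0 <= eta < 1) (K4 : (4 <= K)%N) (th0 : 0 < th).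
Let C : R := ((1 + eta) / (1 - eta)) ^+ K.+2.
Hypotheses (lowC : (1 + th)^-1 <= (1 - 4 / K%:R) / C)
           (upC : (1 + 4 / K%:R) * C <= 1 + th).

(** Slowness is asked of all iterates, because intervals of different lengths are compared with
    conditional means at different levels. *)
Definition nice (phi : S -> R) : Prop := forall k, slow step ok eta (iter k avg8 phi).

Lemma nice_pos phi k z : nice phi -> ok z -> 0 < iter k avg8 phi z.
Proof. by move=> h oz; have [] := h k z oz. Qed.

Lemma wt_gt0 phi x : nice phi -> 0 < wt phi ms x.
Proof. by move=> h; apply: (nice_pos 0 h); exact: ok_st. Qed.

Lemma measurable_wt phi : measurable_fun setT (wt phi ms).
Proof. by apply: measurable_sf; exact: Hs_gt0. Qed.

Lemma wt_bounded phi : exists B, forall x, `|wt phi ms x| <= B.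
Proof. by have [B hB] := st_bounded step ok_z0 phi ms; exists B => x; exact: hB. Qed.

Lemma wt_massE phi a b : weight_mass (wt phi ms) a b = (mass (wt phi ms) a b)%:E.
Proof. by have [B hB] := wt_bounded phi; exact: (weight_massE (measurable_wt phi) hB). Qed.

Lemma mass_window (x y : R) : x < y -> exists (k : nat) z, ok z /\
  forall phi, nice phi -> forall u v, x <= u -> v <= y -> (y - x) / 2 <= v - u ->
    (v - u) / (1 + th) * iter k avg8 phi z <= mass (wt phi ms) u v /\
    mass (wt phi ms) u v <= (v - u) * (1 + th) * iter k avg8 phi z.
Proof.
move=> xy; have [k [z [oz h]]] := mass_scale ok_z0 ok_step step0 step7 msp eta0 K4 xy.
exists k, z; split=> // phi hphi u v xu vy huv.
have uv : 0 <= v - u by apply: le_trans huv; rewrite divr_ge0// subr_ge0 ltW.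
have pos := nice_pos k hphi oz.
have [h1 h2] := h phi hphi u v xu vy huv; split.
  apply: le_trans h1; rewrite ler_pM2r//; exact: ler_wpM2l.
apply: (le_trans h2); rewrite ler_pM2r//; exact: ler_wpM2l.
Qed.

Lemma wt_weight phi : nice phi -> is_weight (wt phi ms).
Proof.
move=> hphi; split; last first.
  by apply: aeW => x; exact: wt_gt0.
split; [exact: measurable_wt|exact: openT|move=> Kc _ cK].
have [B hB] := wt_bounded phi.
have mK : measurable Kc.
  by apply: measurable_realfun.compact_measurable.
have := bounded_integrable (measurable_wt phi) hB mK (compact_finite_measure cK).
by move=> /integrableP[].
Qed.

Lemma averageE phi a b : average (wt phi ms) a b = ((b - a)^-1 * mass (wt phi ms) a b)%:E.
Proof. by rewrite /average wt_massE EFinM. Qed.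

(** In the window of the doubled interval the inner one has exactly half the length, so the same
    node describes both masses: the lengths give 2 and each comparison a factor [1 + th]. *)
Lemma doubling_wt phi : nice phi ->
  (doubling_const (wt phi ms) <= (2 * (1 + th) ^+ 2)%:E)%E.
Proof.
move=> hphi; apply: ge_ereal_sup => _ [z [r [r0 ->]]].
rewrite !wt_massE.
have xy : z - 2 * r < z + 2 * r by lra.
have [k [s [os h]]] := mass_window xy.
have p0 := nice_pos k hphi os.
have [_ h1] := h phi hphi (z - 2 * r) (z + 2 * r) (lexx _) (lexx _) ltac:(lra).
have [h2 _] := h phi hphi (z - r) (z + r) ltac:(lra) ltac:(lra) ltac:(lra).
set m1 := mass _ _ _ in h1 *; set m2 := mass _ _ _ in h2 *.
move: (iter _ _ _ _) p0 h1 h2 => P p0 h1 h2.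
have th1 : 0 < th by [].
have t0 : 0 < 1 + th by lra.
have q0 : 0 < (z + r - (z - r)) / (1 + th) * P by rewrite mulr_gt0// divr_gt0//; lra.
have m20 : 0 < m2 by exact: lt_le_trans h2.
rewrite inver gt_eqF// -EFinM lee_fin ler_pdivrMr//; apply: (le_trans h1).
apply: (@le_trans _ _ (2 * (1 + th) ^+ 2 * ((z + r - (z - r)) / (1 + th) * P))).
  rewrite le_eqVlt; apply/orP; left; apply/eqP; field; lra.
by rewrite ler_pM2l// mulr_gt0// exprn_gt0.
Qed.

Lemma Ap_upper phi1 phi2 (e D : R) : 0 < e -> nice phi1 -> nice phi2 ->
  (forall k z, ok z -> iter k avg8 phi1 z * iter k avg8 phi2 z `^ e <= D) ->
  forall a b, a < b -> (average (wt phi1 ms) a b * poweR (average (wt phi2 ms) a b) e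
    <= ((1 + th) `^ (1 + e) * D)%:E)%E.
Proof.
move=> e0 n1 n2 hD a b ab; rewrite !averageE poweR_EFin -EFinM lee_fin.
have [k [z [oz h]]] := mass_window ab.
have ba : 0 < b - a by rewrite subr_gt0.
have half : (b - a) / 2 <= b - a by lra.
have [_ h1] := h phi1 n1 a b (lexx _) (lexx _) half.
have [l2 h2] := h phi2 n2 a b (lexx _) (lexx _) half.
have p1 := nice_pos k n1 oz; have p2 := nice_pos k n2 oz.
have th1 : 0 < th by [].
have t0 : 0 < 1 + th by lra.
have a1 : (b - a)^-1 * mass (wt phi1 ms) a b <= (1 + th) * iter k avg8 phi1 z.
  by rewrite mulrC ler_pdivrMr// [leRHS]mulrC mulrA.
have a2 : (b - a)^-1 * mass (wt phi2 ms) a b <= (1 + th) * iter k avg8 phi2 z.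
  by rewrite mulrC ler_pdivrMr// [leRHS]mulrC mulrA.
have m1 : 0 <= (b - a)^-1 * mass (wt phi1 ms) a b.
  by rewrite mulr_ge0 ?invr_ge0 ?(ltW ba)//; apply: mass_ge0 => x; apply/ltW/wt_gt0.
have m2 : 0 <= (b - a)^-1 * mass (wt phi2 ms) a b.
  by rewrite mulr_ge0 ?invr_ge0 ?(ltW ba)//; apply: mass_ge0 => x; apply/ltW/wt_gt0.
apply: (@le_trans _ _ ((1 + th) * iter k avg8 phi1 z * ((1 + th) * iter k avg8 phi2 z) `^ e)).
  apply: ler_pM => //; first exact: powR_ge0.
  apply: ge0_ler_powR => //; rewrite ?nnegrE//; first exact: ltW.
  by rewrite mulr_ge0// ltW.
rewrite powRM ?(ltW t0) ?(ltW p2)// powRD; last by apply/implyP => _; rewrite gt_eqF.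
rewrite powRr1 ?(ltW t0)//.
have -> : (1 + th) * iter k avg8 phi1 z * ((1 + th) `^ e * iter k avg8 phi2 z `^ e) =
  (1 + th) * (1 + th) `^ e * (iter k avg8 phi1 z * iter k avg8 phi2 z `^ e) by ring.
apply: ler_wpM2l; last exact: hD.
by rewrite mulr_ge0 ?powR_ge0// ltW.
Qed.

Lemma average01 phi : average (wt phi ms) 0 1 = (iter (size ms) avg8 phi z0)%:E.
Proof.
rewrite averageE subr0 invr1 mul1r; congr EFin.
have e : ms = ms ++ [::] by rewrite cats0.
have := mass_coarse step ok_z0 msp eta0 K4 phi 0 1 e.
by rewrite /= !divr1 add0r big_ord1 => ->.
Qed.

End TreeWeights.

(** * Construction of the levels and of the weight *)

(** Each new level gains [kst / 8] times the mean of [alph delt] over the current cells and costs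
    [theta]; its [m] depends on the levels already built. *)
Lemma build_levels (R : realType) (T l : nat) (theta : R) :
  (12 <= T)%N -> (6 <= l)%N -> 0 < theta -> forall n, exists ms,
  [/\ size ms = n, posl ms &
    kst R / 8 * (\sum_(k < n) iter k (avg8 (cstep l)) (fun z => alph T l z * delt l z) (z0 R l))
      - n%:R * theta <=
    Bf (Hs ms) (fun i => om T l (st (cstep l) (z0 R l) ms i%:Z))
      (fun i => cg (st (cstep l) (z0 R l) ms i%:Z))].
Proof.
move=> T12 l6 t0; elim=> [|n [ms [sms pms IH]]].
  exists [::]; split=> //.
  by rewrite big_ord0 mulr0 mul0r subr0 /Bf !big_ord1 subrr wz0 mulr0 mulr0.
set f := fun i : nat => _ in IH; set g := fun i : nat => cg _ in IH.
pose s i := st (cstep l) (z0 R l) ms i%:Z.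
have [m m0 hm] := @Bf_refine R (Hs ms) f g (fun i => alph T l (s i)) (fun i => bet l (s i))
  (fun i => delt l (s i)) theta (Hs_gt0 pms) t0 (fun i => alph_delt_ge0 T12 l6 (s i)).
exists (m :: ms); split; first by rewrite /= sms.
  by rewrite /posl /= m0.
have sE (i : nat) : st (cstep l) (z0 R l) (m :: ms) i%:Z =
    cstep l (s (i %/ (m * 8))%N) (i %% 8)%N.
  by rewrite /s /= divz_nat modz_nat.
have avgE : (Hs ms)%:R^-1 * (\sum_(i < Hs ms) alph T l (s i) * delt l (s i)) =
    iter n (avg8 (cstep l)) (fun z => alph T l z * delt l z) (z0 R l).
  by rewrite -sms -(avg_st (cstep l) (okst_z0 R l6) _ pms).
rewrite avgE in hm.
set f' := fun i : nat => _ + _ in hm; set g' := fun i : nat => _ + _ + _ in hm.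
have -> : (fun i : nat => om T l (st (cstep l) (z0 R l) (m :: ms) i%:Z)) = f'.
  by apply: funext => i; rewrite sE om_step.
have -> : (fun i : nat => cg (st (cstep l) (z0 R l) (m :: ms) i%:Z)) = g'.
  by apply: funext => i; rewrite sE cg_step.
apply: le_trans hm; rewrite big_ord_recr/=.
have -> : n.+1%:R * theta = n%:R * theta + theta by rewrite -natr1 mulrDl mul1r.
rewrite mulrDr opprD addrA lerB// addrAC lerD//.
Qed.

Lemma weight_data (R : realType) (T : nat) (tau th : R) :
  (12 <= T)%N -> 0 < tau <= 1 -> 0 < th -> exists (H : nat) (V : int -> R) (g : nat -> R),
  let w1 := sf H V in let w2 := sf H (fun i => V i `^ (- tau)) in
  [/\ (0 < H)%N /\ (forall i, 0 < V i),
      is_weight w1 /\ is_weight w2,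
      (doubling_const w1 <= (2 * (1 + th) ^+ 2)%:E)%E /\
      (doubling_const w2 <= (2 * (1 + th) ^+ 2)%:E)%E,
      (forall a b, a < b -> (average w1 a b * poweR (average w2 a b) tau^-1 <=
        ((1 + th) `^ (1 + tau^-1) * (4 * T%:R))%:E)%E) /\
      (forall a b, a < b -> (average w2 a b * poweR (average w1 a b) tau <=
        ((1 + th) `^ (1 + tau) * (4 * T%:R) `^ tau)%:E)%E) &
      [/\ exists2 m, 1 / 2 <= m & average w1 0 1 = m%:E,
          exists2 m, (4 * T%:R) `^ tau / 4 <= m & average w2 0 1 = m%:E,
          kst R * T%:R / 240 <= Bf H (fun i => V i%:Z) g,
          H%:R^-1 * (\sum_(i < H) V i%:Z) <= 1 &
          H%:R^-1 * (\sum_(i < H) V i%:Z * cosh2 (g i)) <= 50]].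
Proof.
move=> T12 tau0 th0.
have T0 : 0 < T%:R :> R by rewrite ltr0n; move: T12; clear; lia.
have [K [e0 [K4 /andP[e00 e01] hK]]] := oscillation_constants th0.
have ep0 := cheps_gt0 R T12.
(* Since [eta = 1 / (l eps^2)], this choice gives [eta <= e0]. *)
set l := (6 + Num.trunc ((e0 * cheps R T ^+ 2)^-1))%N.
have l6 : (6 <= l)%N by rewrite /l leq_addr.
have lr : (e0 * cheps R T ^+ 2)^-1 <= l%:R.
  apply: ltW; apply: (lt_le_trans (truncnS_gt _)).
  by rewrite ler_nat /l -addn1 addnC leq_add2r.
set eta := cheta R T l.
have y0 := chy_gt0 R l6.
have eta00 : 0 <= eta by rewrite /eta /cheta mulr_ge0// divr_ge0 ?sqr_ge0 ?(ltW y0).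
have lr0 : 0 < l%:R :> R by rewrite ltr0n; move: l6; clear; lia.
have etale : eta <= e0.
  have -> : eta = (l%:R * cheps R T ^+ 2)^-1.
    rewrite /eta /cheta /chy /chL natrM; field.
    by rewrite !gt_eqF.
  have ee : 0 < cheps R T ^+ 2 by rewrite exprn_gt0.
  rewrite invf_ple ?posrE ?mulr_gt0//.
  by rewrite mulrC -ler_pdivrMl// mulrC -invfM.
have eta1 : 0 <= eta < 1 by rewrite eta00; exact: le_lt_trans e01.
have [cl cu'] := hK eta (introT andP (conj eta00 etale)).
have kst0 := kst_gt0 R.
have N0 : 0 < (chN T l)%:R :> R.
  rewrite ltr0n /chN muln_gt0 expn_gt0 /chL.
  by move: T12 l6; clear; lia.
(* The gain is at least [kst / 8 * T / 15 = kst T / 120], and the total cost [chN theta] takes half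
   of it. *)
set theta := kst R * T%:R / (240 * (chN T l)%:R).
have t0 : 0 < theta.
  by apply: divr_gt0; [exact: mulr_gt0|apply: mulr_gt0; [rewrite ltr0n|exact: N0]].
have [ms [sms pms hB]] := build_levels T12 l6 t0 (chN T l).
have oz0 := okst_z0 R l6.
have ost := @okst_step R l.
have st0 : forall z : cstate R, cstep l z 0 = z by move=> z; rewrite /cstep andbF.
have st7 : forall z : cstate R, cstep l z 7 = z by move=> z; rewrite /cstep andbF.
have nom : nice (cstep l) (okst l) eta (om T l).
  move=> k; have -> : iter k (avg8 (cstep l)) (om T l) = om T l :> (cstate R -> R).
    by apply: funext => z; apply: iter_avg8_fix; exact: avg8_om.
  by move=> z oz; split; [exact: om_gt0|move=> c; exact: om_step_le].
have nmu : nice (cstep l) (okst l) eta (fun z => om T l z `^ (- tau)).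
  move=> k z oz; split; first exact: (mu_gt0 T12 l6 tau0 k oz).
  by move=> c; exact: (mu_step T12 l6 tau0 k c oz).
have ofix k z : iter k (avg8 (cstep l)) (om T l) z = om T l z.
  by apply: iter_avg8_fix; exact: avg8_om.
have epsE : cheps R T `^ (- tau) = (4 * T%:R) `^ tau.
  rewrite /cheps -powR_inv1 ?mulr_ge0 ?(ltW T0)// -powRrM mulrN mulN1r opprK//.
have [tau1 tau2] := andP tau0.
have T40 : 0 < 4 * T%:R :> R by rewrite mulr_gt0.
exists (Hs ms), (fun i => om T l (st (cstep l) (z0 R l) ms i)),
  (fun i => cg (st (cstep l) (z0 R l) ms i%:Z)) => w1 w2.
have e1 : w1 = wt (cstep l) (z0 R l) (om T l) ms by [].
have e2 : w2 = wt (cstep l) (z0 R l) (fun z => om T l z `^ (- tau)) ms by [].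
split.
- split; first exact: Hs_gt0.
  by move=> i; apply: om_gt0 => //; exact: ok_st.
- by rewrite e1 e2; split; apply: (wt_weight oz0 ost pms); [exact: nom|exact: nmu].
- by rewrite e1 e2; split; apply: (doubling_wt oz0 ost st0 st7 pms eta1 K4 th0 cl cu');
    [exact: nom|exact: nmu].
- split=> a b ab; rewrite e1 e2.
    apply: (Ap_upper oz0 ost st0 st7 pms eta1 K4 th0 cl cu') ab => //.
      by rewrite invr_gt0.
    move=> k z oz; rewrite ofix.
    have om0 := om_gt0 T12 l6 oz; have mu0 := mu_gt0 T12 l6 tau0 k oz.
    have h := om_mu_le T12 l6 tau0 k oz; rewrite epsE in h.
    have -> : om T l z * iter k (avg8 (cstep l)) (fun z => om T l z `^ (- tau)) z `^ tau^-1 =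
       (om T l z `^ tau * mu T l tau k z) `^ tau^-1.
      by rewrite powRM ?powR_ge0 ?(ltW mu0)// -powRrM mulfV ?gt_eqF// powRr1// ltW.
    have -> : 4 * T%:R = ((4 * T%:R) `^ tau) `^ tau^-1 :> R.
      by rewrite -powRrM mulfV ?gt_eqF// powRr1// ltW.
    apply: ge0_ler_powR; rewrite ?nnegrE ?invr_ge0 ?(ltW tau1) ?powR_ge0//.
    by rewrite mulr_ge0 ?powR_ge0// ltW.
  apply: (Ap_upper oz0 ost st0 st7 pms eta1 K4 th0 cl cu') ab => //.
  move=> k z oz; rewrite ofix mulrC -epsE.
  exact: (om_mu_le T12 l6 tau0 k oz).
- split.
  + exists (om T l (z0 R l)); first by rewrite om_z0//; lra.
    by rewrite e1 (average01 (cstep l) oz0 pms eta1 K4) ofix.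
  + exists (mu T l tau (chN T l) (z0 R l)); first by rewrite -epsE; exact: mu_hit.
    by rewrite e2 (average01 (cstep l) oz0 pms eta1 K4) sms.
  + apply: le_trans hB; have hs := sum_alph_delt R T12 l6.
    have h1 : kst R / 8 * (T%:R / 15) <= kst R / 8 * \sum_(k < chN T l)
        iter k (avg8 (cstep l)) (fun z => alph T l z * delt l z) (z0 R l).
      by apply: ler_wpM2l => //; rewrite divr_ge0// ltW.
    have h2 : (chN T l)%:R * theta = kst R * T%:R / 240.
      by rewrite /theta; field; rewrite gt_eqF.
    rewrite h2; lra.
  + rewrite (avg_st (cstep l) oz0 (om T l) pms) ofix om_z0//.
    by have := cheps_le R T12; lra.
  + rewrite (avg_st (cstep l) oz0 (fun z => om T l z * cosh2 (cg z)) pms) sms.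
    exact: omV_bound.
Qed.

Lemma theta_exists (R : realType) (e delta : R) : 0 < e -> 0 < delta ->
  exists th : R, [/\ 0 < th, 2 * (1 + th) ^+ 2 <= 2 + delta & (1 + th) `^ e <= 2].
Proof.
move=> e0 d0; have h2 : 1 < 2 `^ e^-1 :> R.
  have E : 1 = 1 `^ e^-1 :> R by rewrite powR1.
  by rewrite [ltLHS]E; apply: gt0_ltr_powR; rewrite ?invr_gt0 ?nnegrE//; lra.
(* For [0 <= t <= 1] one has [2 (1 + t)^2 <= 2 + 6 t], hence [delta / 6]. *)
exists (Num.min (Num.min 1 (delta / 6)) (2 `^ e^-1 - 1)).
set th := Num.min _ _.
have t0 : 0 < th by rewrite !lt_min ltr01 divr_gt0//= subr_gt0.
have : th <= th by []; rewrite {2}/th !le_min => /andP[/andP[t1 t2] t3].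
split=> //; first by nra.
apply: (@le_trans _ _ ((2 `^ e^-1) `^ e)).
  by apply: ge0_ler_powR; rewrite ?nnegrE; lra.
by rewrite -powRrM mulVf ?gt_eqF// powRr1.
Qed.

(** This is [|t| / q <= exp (|t| / q)] raised to the power [q]. *)
Lemma powR_le_cosh2 (R : realType) (q t : R) : 0 < q ->
  `|t| `^ q <= q `^ q * cosh2 t.
Proof.
move=> q0; have nt := normr_ge0 t.
have h : `|t| / q <= expR (`|t| / q) by have := expR_ge1Dx (`|t| / q); lra.
have -> : `|t| `^ q = q `^ q * (`|t| / q) `^ q.
  rewrite -powRM ?divr_ge0 ?(ltW q0)//.
  by rewrite mulrC divfK// gt_eqF.
apply: ler_wpM2l; first exact: powR_ge0.
apply: (@le_trans _ _ (expR (`|t| / q) `^ q)).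
  by apply: ge0_ler_powR; rewrite ?nnegrE ?divr_ge0 ?expR_ge0// ltW.
rewrite -expRM divfK ?gt_eqF// /cosh2.
by case: (ger0P t) => _; rewrite ?lerDl ?lerDr expR_ge0.
Qed.

Lemma BfZl (R : realType) (H : nat) (c : R) (f g : nat -> R) :
  Bf H (fun i => c * f i) g = c * Bf H f g.
Proof.
rewrite /Bf mulrCA; congr (_ * _); rewrite mulr_sumr; apply: eq_bigr => i _.
by rewrite mulr_sumr; apply: eq_bigr => j _; rewrite !mulrA.
Qed.

Lemma Ap_char_bounds (R : realType) (p M U m1 m2 : R) (w w' : R -> R) :
  is_weight w -> dual_weight p w = w' ->
  (forall a b, a < b ->
    (average w a b * poweR (average w' a b) (p - 1) <= U%:E)%E) ->
  average w 0 1 = m1%:E -> average w' 0 1 = m2%:E -> M <= m1 * m2 `^ (p - 1) ->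
  [/\ is_Ap_weight p w, (M%:E <= Ap_char p w)%E & (Ap_char p w <= U%:E)%E].
Proof.
move=> ww dw hU h1 h2 hM.
have up : (Ap_char p w <= U%:E)%E.
  by apply: ge_ereal_sup => _ [a [b [ab ->]]]; rewrite dw; exact: hU.
split=> //; first by split=> //; apply: le_lt_trans up _; exact: ltry.
apply: (@le_trans _ _ (m1 * m2 `^ (p - 1))%:E); first by rewrite lee_fin.
apply: ereal_sup_ubound; exists 0, 1; split=> //.
by rewrite dw h1 h2 poweR_EFin.
Qed.

(** * The two ranges of [p] *)

(** The weight is [om], the test function [- lam g] and the dual function [om] itself: antisymmetry
    of [Bf] moves the Hilbert transform from [om] to [g], and the minus sign makes the pairing
    positive. *)
Lemma ge2_case (R : realType) (p : R) : 2 <= p ->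
  exists c C : R, 0 < c /\
    forall M : R, 2 < M -> forall delta : R, 0 < delta ->
    exists w : R -> R,
      [/\ is_Ap_weight p w,
          (M%:E <= Ap_char p w)%E /\ (Ap_char p w <= (C * M)%:E)%E,
          (doubling_const w <= (2 + delta)%:E)%E,
          (doubling_const (dual_weight p w) <= (2 + delta)%:E)%E &
          ((c * M)%:E <= hilbert_opnorm p w)%E].
Proof.
(* [T >= K M] makes the [A_p] product on [[0, 1]], at least [1 / 2 * 4 T / 4 ^ (p - 1)], reach [M].
   With [lam p = 1 / 50] the norm of [lam g] absorbs the bound 50 of the exponential moment. *)
move=> p2; set K := 4 `^ (p - 1) / 2; set lam := (50 * p)^-1.
have K0 : 0 < K by rewrite divr_gt0// powR_gt0.
have lam0 : 0 < lam by rewrite invr_gt0; lra.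
have ks0 := kst_gt0 R.
(* 480 is 240 from the pairing times 2 from duality. The upper constant comes from [2 * 4 T] with
   [T <= 12 + K M <= (K + 6) M], as [M > 2]. *)
exists (lam * kst R * K / 480), (8 * (K + 6)); split.
  by apply: divr_gt0; [apply: mulr_gt0; [exact: mulr_gt0|exact: K0]|rewrite ltr0n].
move=> M M2 delta d0.
pose T := (12 + Num.trunc (K * M))%N.
have KM0 : 0 <= K * M by rewrite mulr_ge0; lra.
have TM : K * M <= T%:R.
  apply: ltW; apply: (lt_le_trans (truncnS_gt _)).
  by rewrite ler_nat /T -addn1 addnC leq_add2r.
have TC : T%:R <= (K + 6) * M.
  have := truncn_le (K * M); rewrite KM0 /T natrD; lra.
pose tau := (p - 1)^-1.
have tau0 : 0 < tau by rewrite invr_gt0; lra.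
have tau1 : tau <= 1 by rewrite invf_le1; lra.
have tauV : tau^-1 = p - 1 by rewrite invrK.
have e0 : 0 < 1 + tau^-1 by rewrite tauV; lra.
have [th [th0 dth pth]] := theta_exists e0 d0.
have T12 : (12 <= T)%N by rewrite leq_addr.
have T0 : 0 < T%:R :> R by rewrite ltr0n.
have [|H [V [g]]] := @weight_data R T tau th T12 _ th0; first by rewrite tau0.
cbv zeta; set w1 := sf H V; set w2 := sf H _.
case=> -[H0 V0] [ww1 _] [D1 D2] [A1 _] [[m1 hm1 a1] [m2 hm2 a2] hB hV hg].
have dE : dual_weight p w1 = w2 by [].
exists w1.
have Mle : M <= m1 * m2 `^ (p - 1).
  have q0 : 0 < 4 `^ (p - 1) :> R by rewrite powR_gt0.
  have h : 4 * T%:R / 4 `^ (p - 1) <= m2 `^ (p - 1).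
    apply: (@le_trans _ _ (((4 * T%:R) `^ tau / 4) `^ (p - 1))).
      have -> : (4 `^ (p - 1))^-1 = 4^-1 `^ (p - 1) :> R.
        by rewrite -[4^-1]powR_inv1// -powRrM mulN1r powRN.
      have {1}-> : 4 * T%:R = ((4 * T%:R) `^ tau) `^ (p - 1) :> R.
        by rewrite -powRrM mulVf ?powRr1// ?mulr_ge0// gt_eqF//; lra.
      by rewrite -powRM ?powR_ge0.
    have m20 : 0 <= m2 by apply: le_trans hm2; rewrite divr_ge0// powR_ge0.
    apply: ge0_ler_powR; rewrite ?nnegrE ?divr_ge0 ?powR_ge0//.
    by move: p2; clear; lra.
  have h' : 2 * M <= 4 * T%:R / 4 `^ (p - 1).
    by rewrite ler_pdivlMr//; move: TM; rewrite /K; lra.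
  have : 0 < M by lra.
  nra.
have hU a b : a < b ->
    (average w1 a b * poweR (average w2 a b) (p - 1) <= (8 * (K + 6) * M)%:E)%E.
  move=> ab; rewrite -tauV; apply: le_trans (A1 _ _ ab) _; rewrite lee_fin.
  apply: (@le_trans _ _ (2 * (4 * T%:R))); last by lra.
  by apply: ler_wpM2r => //; rewrite mulr_ge0// ltW.
have [apw lo up] := Ap_char_bounds ww1 dE hU a1 a2 Mle.
split=> //; [by apply: (le_trans D1); rewrite lee_fin| |].
  by rewrite dE; apply: (le_trans D2); rewrite lee_fin.
pose f i := - lam * g i.
have BE : Bf H f (fun i => V i%:Z) = lam * Bf H (fun i => V i%:Z) g.
  by rewrite BfZl Bf_anti mulNr mulrN opprK.
have Blow : lam * (kst R * T%:R / 240) <= Bf H f (fun i => V i%:Z).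
  by rewrite BE ler_wpM2l// ltW.
have B0 : 0 < Bf H f (fun i => V i%:Z).
  apply: lt_le_trans Blow; apply: mulr_gt0; first exact: lam0.
  by apply: divr_gt0; [exact: mulr_gt0|rewrite ltr0n].
have p1 : 1 < p by lra.
have Hr : 0 <= H%:R^-1 :> R by rewrite invr_ge0.
have fle : H%:R^-1 * (\sum_(i < H) `|f i| `^ p * V i) <= 1.
  apply: (@le_trans _ _ (50^-1 * (H%:R^-1 * (\sum_(i < H) V i%:Z * cosh2 (g i))))).
    rewrite mulrCA ler_wpM2l// mulr_sumr ler_sum// => i _.
    rewrite mulrC [leRHS]mulrCA ler_wpM2l ?(ltW (V0 _))//.
    rewrite /f normrM normrN (gtr0_norm lam0) powRM ?(ltW lam0)//.
    apply: (@le_trans _ _ (lam `^ p * (p `^ p * cosh2 (g i)))).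
      by rewrite ler_wpM2l ?powR_ge0// powR_le_cosh2//; lra.
    rewrite mulrA -powRM ?(ltW lam0)//; last lra.
    have -> : lam * p = 50^-1 by rewrite /lam; field; lra.
    apply: ler_wpM2r; first by have := cosh2_ge2 (g i); lra.
    by apply: ge1r_powR; lra.
  by lra.
have gle : H%:R^-1 * (\sum_(i < H) `|V i| `^ (p / (p - 1)) * V i `^ (1 - p / (p - 1))) <= 1.
  apply: le_trans hV; rewrite ler_wpM2l// ler_sum// => i _.
  rewrite gtr0_norm// -powRD; last by rewrite (gt_eqF (V0 _)) implybT.
  by rewrite addrC subrK powRr1// ltW.
apply: le_trans (hilbert_lower p1 H0 V0 fle gle _ B0); last by [].
rewrite lee_fin mulr1; move: Blow; move: (Bf _ _ _) => B hB'.
have : lam * kst R * (K * M) <= lam * kst R * T%:R by rewrite ler_wpM2l// mulr_ge0// ltW.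
lra.
Qed.

(** The weight is [om ^ -tau] with [tau = p - 1], the test function [om] and the dual function [g];
    both norms reduce to integrals against [om], because [p - tau = 1] and [- tau (1 - q) = 1]. The
    characteristic has order [T ^ tau], so [T] has order [M ^ (1 / (p - 1))]. *)
Lemma lt2_case (R : realType) (p : R) : 1 < p < 2 ->
  exists c C : R, 0 < c /\
    forall M : R, 2 < M -> forall delta : R, 0 < delta ->
    exists w : R -> R,
      [/\ is_Ap_weight p w,
          (M%:E <= Ap_char p w)%E /\ (Ap_char p w <= (C * M)%:E)%E,
          (doubling_const w <= (2 + delta)%:E)%E,
          (doubling_const (dual_weight p w) <= (2 + delta)%:E)%E &
          ((c * M `^ (p - 1)^-1)%:E <= hilbert_opnorm p w)%E].
Proof.
case/andP=> p1 p2; pose tau := p - 1; pose q := p / (p - 1).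
have tau0 : 0 < tau by rewrite /tau; lra.
have tau1 : tau <= 1 by rewrite /tau; lra.
have q1 : 1 <= q by rewrite /q ler_pdivlMr; lra.
set C3 := 50 * q `^ q.
have qq : 1 <= q `^ q.
  by apply: (le_trans q1); rewrite -[leLHS]powRr1 ?ler_powR//; lra.
have C31 : 1 <= C3 by rewrite /C3; lra.
have C30 : 0 < C3 by lra.
have ks0 := kst_gt0 R.
(* The upper constant comes from [4 T <= 52 X], [X ^ tau = 8 M] and the factor 2 bounding
   [(1 + th) ^ (1 + tau)]. *)
exists (kst R / (480 * C3)), (16 * 52 `^ tau); split.
  by apply: divr_gt0; [exact: ks0|apply: mulr_gt0; [rewrite ltr0n|exact: C30]].
move=> M M2 delta d0.
have M0 : 0 < M by lra.
(* With [T >= X] the product on [[0, 1]] is at least [8 M / 4 * 1 / 2 = M]. *)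
set X := (8 * M) `^ tau^-1.
have MX : M `^ tau^-1 <= X.
  by apply: ge0_ler_powR; rewrite ?nnegrE ?invr_ge0 ?(ltW tau0)//; lra.
have X1 : 1 <= X.
  have -> : 1 = 1 `^ tau^-1 :> R by rewrite powR1.
  by apply: ge0_ler_powR; rewrite ?nnegrE ?invr_ge0 ?(ltW tau0)//; lra.
have Xtau : X `^ tau = 8 * M by rewrite -powRrM mulVf ?gt_eqF// powRr1//; lra.
pose T := (12 + Num.trunc X)%N.
have TX : X <= T%:R.
  apply: ltW; apply: (lt_le_trans (truncnS_gt _)).
  by rewrite ler_nat /T -addn1 addnC leq_add2r.
have TC : T%:R <= 13 * X.
  have X0 : 0 <= X by lra.
  have := truncn_le X; rewrite X0 /T natrD; lra.
have e0 : 0 < 1 + tau by lra.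
have [th [th0 dth pth]] := theta_exists e0 d0.
have T12 : (12 <= T)%N by rewrite leq_addr.
have T0 : 0 < T%:R :> R by rewrite ltr0n.
have [|H [V [g]]] := @weight_data R T tau th T12 _ th0; first by rewrite tau0.
cbv zeta; set w1 := sf H V; set V2 := fun i : int => V i `^ (- tau); set w2 := sf H V2.
case=> -[H0 V0] [_ ww2] [D1 D2] [_ A2] [[m1 hm1 a1] [m2 hm2 a2] hB hV hg].
have V20 i : 0 < V2 i by rewrite powR_gt0.
have dE : dual_weight p w2 = w1.
  apply: funext => x; rewrite /dual_weight /w2 /sf /V2 -powRrM mulrNN.
  by rewrite mulfV ?powRr1 ?gt_eqF// ltW.
exists w2.
have Mle : M <= m2 * m1 `^ (p - 1).
  have h1 : 1 / 2 <= m1 `^ (p - 1).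
    apply: (@le_trans _ _ ((1 / 2) `^ tau)); first by apply: ger1_powR; lra.
    by apply: ge0_ler_powR; rewrite ?nnegrE ?(ltW tau0)//; lra.
  have h2 : 8 * M <= (4 * T%:R) `^ tau.
    by rewrite -Xtau; apply: ge0_ler_powR; rewrite ?nnegrE ?(ltW tau0)//; lra.
  nra.
have hU a b : a < b ->
    (average w2 a b * poweR (average w1 a b) (p - 1) <= (16 * 52 `^ tau * M)%:E)%E.
  move=> ab; apply: le_trans (A2 _ _ ab) _; rewrite lee_fin.
  have -> : 16 * 52 `^ tau * M = 2 * (52 * X) `^ tau.
    by rewrite powRM; [rewrite Xtau; ring|lra|lra].
  apply: (@le_trans _ _ (2 * (4 * T%:R) `^ tau)).
    by apply: ler_wpM2r => //; exact: powR_ge0.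
  apply: ler_wpM2l => //.
  by apply: ge0_ler_powR; rewrite ?nnegrE ?(ltW tau0)//; lra.
have [apw lo up] := Ap_char_bounds ww2 dE hU a2 a1 Mle.
split=> //; [by apply: (le_trans D2); rewrite lee_fin| |].
  by rewrite dE; apply: (le_trans D1); rewrite lee_fin.
have B0 : 0 < Bf H (fun i => V i%:Z) g.
  by apply: lt_le_trans hB; apply: divr_gt0; [exact: mulr_gt0|rewrite ltr0n].
have Hr : 0 <= H%:R^-1 :> R by rewrite invr_ge0.
have fle : H%:R^-1 * (\sum_(i < H) `|V i| `^ p * V2 i) <= 1.
  apply: le_trans hV; rewrite ler_wpM2l// ler_sum// => i _.
  rewrite gtr0_norm// /V2 -powRD; last by rewrite (gt_eqF (V0 _)) implybT.
  have -> : p - tau = 1 by rewrite /tau; ring.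
  by rewrite powRr1// ltW.
have gle : H%:R^-1 * (\sum_(i < H) `|g i| `^ (p / (p - 1)) * V2 i `^ (1 - p / (p - 1))) <= C3.
  apply: (@le_trans _ _ (q `^ q * (H%:R^-1 * (\sum_(i < H) V i%:Z * cosh2 (g i))))); last first.
    by rewrite /C3 [leRHS]mulrC ler_wpM2l// powR_ge0.
  rewrite mulrCA ler_wpM2l// mulr_sumr ler_sum// => i _.
  rewrite /V2 -powRrM.
  have -> : - tau * (1 - p / (p - 1)) = 1 by rewrite /tau; field; lra.
  rewrite powRr1 ?(ltW (V0 _))// mulrC [leRHS]mulrCA ler_wpM2l ?(ltW (V0 _))//.
  by apply: powR_le_cosh2; exact: lt_le_trans ltr01 q1.
apply: le_trans (hilbert_lower p1 H0 V20 fle gle C31 B0).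
have C320 : 0 < 2 * C3 by rewrite pmulr_rgt0.
rewrite lee_fin ler_pdivlMr//.
apply: le_trans hB.
have -> : kst R / (480 * C3) * M `^ (p - 1)^-1 * (2 * C3) = kst R * M `^ tau^-1 / 240.
  by rewrite /tau; field; rewrite gt_eqF.
apply: ler_wpM2r; first by rewrite invr_ge0 ler0n.
by apply: ler_wpM2l; [exact: ltW|exact: le_trans TX].
Qed.

Theorem theorem1p1 (R : realType) (p : R) (hp : 1 < p) :
  exists c C : R, 0 < c /\
    forall M : R, 2 < M -> forall delta : R, 0 < delta ->
    exists w : R -> R,
      [/\ is_Ap_weight p w,
          (M%:E <= Ap_char p w)%E /\ (Ap_char p w <= (C * M)%:E)%E,
          (doubling_const w <= (2 + delta)%:E)%E,
          (doubling_const (dual_weight p w) <= (2 + delta)%:E)%E &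
          ((c * M `^ (Num.max 1 (1 / (p - 1))))%:E <= hilbert_opnorm p w)%E].
Proof.
case: (leP 2 p) => p2.
  have -> : Num.max 1 (1 / (p - 1)) = 1.
    by apply: max_l; rewrite ler_pdivrMr; lra.
  have [c [C [c0 h]]] := ge2_case p2.
  exists c, C; split=> // M M2 d d0; rewrite powRr1; [exact: h|lra].
have -> : Num.max 1 (1 / (p - 1)) = (p - 1)^-1.
  by rewrite div1r; apply: max_r; rewrite -div1r ler_pdivlMr; lra.
by apply: lt2_case; rewrite hp.
Qed.
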